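(* Let $f$ be a polynomial of degree at least $2$ and let $A\subset\overline{\mathbb C}$ be a finite set with $\#A\ge 4$, such that the marked rational map $(f,A)$ is a CTP map whose regular set $E=A\setminus f^{-1}(V_f)$ is non-empty (i.e. $(f,A)$ is regular or mixing). Then $(f,A)$ satisfies McMullen's condition: there exist a Belyi map $s$ and a rational map $g$ such that $f=g\circ s$ and $\#(s(A)\cup V_s)=3$.
   Context: $V_h$ denotes the set of critical values of a rational map $h$. A marked rational map $(f,A)$ is a rational map $f$ with $\deg f\ge 2$ together with a finite set $A\subset\overline{\mathbb C}$, $\#A\ge3$; put $B=f(A)\cup V_f$ (assumed to have at least $3$ points). For a finite set $X\subset\overline{\mathbb C}$ with $\#X\ge 3$, $\mathrm{Teich}(\overline{\mathbb C},X)$ is the set of orientation-preserving homeomorphisms $\phi$ of $\overline{\mathbb C}$ modulo the relation: $\phi_1\sim\phi_2$ iff $\phi_2\circ\phi_1^{-1}$ is isotopic rel $\phi_1(X)$ to a Möbius transformation. For $[\phi_0]\in\mathrm{Teich}(\overline{\mathbb C},B)$ there exist a homeomorphism $\phi_1$ of $\overline{\mathbb C}$ and a rational map $g$ with $g\circ\phi_1=\phi_0\circ f$; the class $[\phi_1]\in\mathrm{Teich}(\overline{\mathbb C},A)$ is well defined, giving the Thurston pullback map $\sigma_{f,A,B}:[\phi_0]\mapsto[\phi_1]$. $(f,A)$ is a CTP map if $\sigma_{f,A,B}$ is constant; it is trivial if $\#A=3$. The regular set is $E=A\setminus f^{-1}(V_f)$; $(f,A)$ is regular if $E=A$, mixing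 if $\emptyset\neq E\neq A$. A Belyi map is a rational map $s$ with $\deg s\ge2$ and $\#V_s\le 3$. *)

(* Defs.v *)
(* complex numbers R[i] over an arbitrary R : realType
   (realType is real closed, so R[i] is an algebraically closed field). *)
From HB Require Import structures.
From mathcomp Require Import all_boot all_order all_algebra.
From mathcomp Require Import complex.
From mathcomp Require Import reals.
Set Implicit Arguments. Unset Strict Implicit. Unset Printing Implicit Defensive.
Import Order.TTheory GRing.Theory Num.Theory.
Local Open Scope ring_scope.

(** The Riemann sphere  C ∪ {∞}:  [Some z] is z, [None] is ∞. *)
Definition sphere (R : realType) := option R[i].

Definition sqnormc (R : realType) (z : R[i]) : R :=
  match z with Complex a b => a ^+ 2 + b ^+ 2 end.

Definition chordal (R : realType) (x y : sphere R) : R :=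
  match x, y with
  | Some z, Some w =>
      2 * Num.sqrt (sqnormc (z - w)) / Num.sqrt ((1 + sqnormc z) * (1 + sqnormc w))
  | Some z, None | None, Some z => 2 / Num.sqrt (1 + sqnormc z)
  | None, None => 0
  end.

Definition sph_continuous (R : realType) (h : sphere R -> sphere R) : Prop :=
  forall (x : sphere R) (e : R), 0 < e ->
    exists2 d : R, 0 < d & forall y, chordal x y < d -> chordal (h x) (h y) < e.

Definition sph_homeo (R : realType) (h : sphere R -> sphere R) : Prop :=
  sph_continuous h /\
  exists k : sphere R -> sphere R,
    [/\ cancel h k, cancel k h & sph_continuous k].

Definition isotopy_rel (R : realType) (H : R -> sphere R -> sphere R)
    (Y : sphere R -> Prop) : Prop :=
  [/\ (forall t : R, 0 <= t <= 1 -> sph_homeo (H t)),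
      (forall (t : R) (x : sphere R) (e : R), 0 <= t <= 1 -> 0 < e ->
         exists2 d : R, 0 < d & forall (t' : R) (y : sphere R),
           0 <= t' <= 1 -> `|t - t'| < d -> chordal x y < d ->
           chordal (H t x) (H t' y) < e)
    & (forall (t : R) (y : sphere R), 0 <= t <= 1 -> Y y -> H t y = H 0 y)].

Definition isotopic_rel (R : realType) (h k : sphere R -> sphere R)
    (Y : sphere R -> Prop) : Prop :=
  exists H : R -> sphere R -> sphere R,
    [/\ isotopy_rel H Y, forall x, H 0 x = h x & forall x, H 1 x = k x].

Definition orient_pres (R : realType) (h : sphere R -> sphere R) : Prop :=
  sph_homeo h /\ isotopic_rel h id (fun _ => False).

Definition rat_eval (R : realType) (p q : {poly R[i]}) (x : sphere R) : sphere R :=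
  match x with
  | Some z => if q.[z] == 0 then None else Some (p.[z] / q.[z])
  | None =>
      if (size q < size p)%N then None
      else if (size p < size q)%N then Some 0
      else Some (lead_coef p / lead_coef q)
  end.

Definition rational_deg (R : realType) (d : nat) (h : sphere R -> sphere R) : Prop :=
  exists p q : {poly R[i]},
    [/\ coprimep p q, d = (maxn (size p) (size q)).-1
      & forall x, h x = rat_eval p q x].

Definition rational_map (R : realType) (h : sphere R -> sphere R) : Prop :=
  exists d, rational_deg d h.

Definition mobius (R : realType) (h : sphere R -> sphere R) : Prop :=
  rational_deg 1 h.

Definition polynomial_deg (R : realType) (d : nat) (h : sphere R -> sphere R) : Prop :=
  exists p : {poly R[i]}, size p = d.+1 /\ forall x, h x = rat_eval p 1 x.

Definition critical_point (R : realType) (h : sphere R -> sphere R) (x : sphere R) : Prop :=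
  ~ exists2 d : R, 0 < d & forall y y', chordal x y < d -> chordal x y' < d ->
       h y = h y' -> y = y'.

Definition crit_values (R : realType) (h : sphere R -> sphere R) (w : sphere R) : Prop :=
  exists x, critical_point h x /\ h x = w.

Definition has_card (R : realType) (X : sphere R -> Prop) (n : nat) : Prop :=
  exists s : seq (sphere R), [/\ uniq s, size s = n & forall x, X x <-> x \in s].

(** phi1 ~ phi2 in Teich(C^, X): phi2 o phi1^-1 is isotopic rel phi1(X)
    to a Möbius transformation. *)
Definition teich_equiv (R : realType) (X : sphere R -> Prop)
    (phi1 phi2 : sphere R -> sphere R) : Prop :=
  exists M : sphere R -> sphere R, mobius M /\
  exists H : R -> sphere R -> sphere R,
    [/\ isotopy_rel H (fun y => exists2 x, X x & y = phi1 x),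
        forall x, H 0 (phi1 x) = phi2 x
      & forall y, H 1 y = M y].

(** (f, A) is a CTP map: the Thurston pullback map is constant, i.e. the
    Teich(C^,A)-class of any lift phi1 (g o phi1 = phi0 o f, g rational)
    does not depend on phi0. *)
Definition CTP (R : realType) (f : sphere R -> sphere R) (A : sphere R -> Prop) : Prop :=
  forall (phi0 phi0' phi1 phi1' g g' : sphere R -> sphere R),
    orient_pres phi0 -> orient_pres phi0' ->
    orient_pres phi1 -> orient_pres phi1' ->
    rational_map g -> rational_map g' ->
    (forall x, g (phi1 x) = phi0 (f x)) ->
    (forall x, g' (phi1' x) = phi0' (f x)) ->
    teich_equiv A phi1 phi1'.

Definition belyi (R : realType) (s : sphere R -> sphere R) : Prop :=
  (exists2 d, (2 <= d)%N & rational_deg d s) /\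
  exists2 k, (k <= 3)%N & has_card (crit_values s) k.

(* Main.v *)
Require Import Defs.
From HB Require Import structures.
From mathcomp Require Import all_boot all_order all_algebra.
From mathcomp Require Import complex.
From mathcomp Require Import boolp reals.
From mathcomp Require Import mpoly.
From mathcomp Require Import fingroup perm separable cyclotomic.
From mathcomp Require Import ring lra zify.
Set Implicit Arguments. Unset Strict Implicit. Unset Printing Implicit Defensive.
Import Order.TTheory GRing.Theory Num.Theory.
Local Open Scope ring_scope.

(* Move a regular value b = f(a) inside a small disc by a twist and lift the twist
   through f to a homeomorphism close to the identity.  The CTP condition says that
   the lift agrees on A with a Moebius map, so that the points of A above b move
   along branches of the inverse of f while the other points stay fixed, and all
   cross-ratios of A are preserved.

   The functions of the branches considered below live on a compact algebraic
   curve, so that they are constant as soon as they are bounded.  If four moving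
   branches z1, ..., z4 have constant cross-ratio k, then k is real, since at
   infinity the branches point towards roots of unity; hence three branches cannot
   collide without the fourth, (z1 - z2) / (z1 - z3) is bounded, and it is constant.
   If three branches form with a fixed point (possibly infinity) a constant
   cross-ratio, the directions at infinity determine the ratio q of z2 to z1 there,
   so z2 - q z1 is bounded and constant.  With two or more fixed points the relation
   between z1 and z2 is itself a Moebius map preserving f.  In all cases two points
   of A above b are exchanged by an affine symmetry of f.  These symmetries
   are the rotations around a common centre beta, so f = g((z - beta)^r), and every
   point of A is infinity, beta, or in one fibre of s = (z - beta)^r. *)

(** The curve of root tuples is never constructed. A function [g / h] on it is handled through its
    norm: products over all permutations of a root tuple are symmetric, hence polynomials in the
    value [w], and a bound on [g / h] becomes a bound of one polynomial by another, to which a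
    Liouville argument applies. As the curve may be reducible, this yields finitely many values
    rather than one; the relevant one is picked near [a] by the pigeonhole principle. The
    deformation provides only one displaced configuration at each scale. This is enough because the
    displaced points accumulate at [a], so that a polynomial identity tested on them holds
    identically. The delicate estimate is the bound on [(z1 - z2) / (z1 - z3)] at finite critical
    points of [f], where several roots merge. Relative to one of them, the directions of merging
    roots are roots of unity, hence on a circle, while a real [k] would put three of them on a line.
    Relations between limiting directions are exact because roots of unity of a given order are
    finite in number. *)

Notation nm := ComplexField.Normc.normc.

Lemma roots_sub (C : closedFieldType) (f : {poly C}) d w :
  size f = d.+2 -> exists2 r : seq C, size r = d.+1 &
  f - w%:P = lead_coef f *: \prod_(z <- r) ('X - z%:P).
Proof.
move=> sf; have sw : (size (- w%:P) < size f)%N.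
  by rewrite sf size_polyN; apply: leq_ltn_trans (size_polyC_leq1 _) _.
have [r hr] := closed_field_poly_normal (f - w%:P).
rewrite lead_coefDl // in hr; exists r => //.
have := size_polyDl sw; rewrite hr sf size_scale ?size_prod_XsubC; first by case.
by rewrite lead_coef_eq0 -size_poly_eq0 sf.
Qed.

(** * Moduli, continuity of roots, bounded quotients of polynomials *)

Section Modulus.
Variable R : realType.
Local Notation C := R[i].
Implicit Types (x y z u v w : C) (p q f : {poly C}).

Lemma nm0 : nm (0 : C) = 0. Proof. exact: ComplexField.Normc.normc0. Qed.
Lemma nm1 : nm (1 : C) = 1. Proof. exact: ComplexField.Normc.normc1. Qed.
Lemma nmM x y : nm (x * y) = nm x * nm y.
Proof. exact: ComplexField.Normc.normcM. Qed.
Lemma nmV x : nm x^-1 = (nm x)^-1.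
Proof. exact: ComplexField.Normc.normcV. Qed.
Lemma nm_ge0 x : 0 <= nm x. Proof. by case: x => a b /=; exact: sqrtr_ge0. Qed.
Lemma sqnorm_nm x : sqnormc x = nm x ^+ 2.
Proof. by case: x => a b /=; rewrite sqr_sqrtr // addr_ge0 ?sqr_ge0. Qed.
Lemma nm_eq0 x : (nm x == 0) = (x == 0).
Proof.
by apply/eqP/eqP => [/ComplexField.Normc.eq0_normc|->] //; exact: nm0.
Qed.
Lemma nm_gt0 x : (0 < nm x) = (x != 0).
Proof. by rewrite lt_neqAle nm_ge0 andbT eq_sym nm_eq0. Qed.
Lemma nmN x : nm (- x) = nm x.
Proof. by case: x => a b /=; rewrite !sqrrN. Qed.
Lemma nmD x y : nm (x + y) <= nm x + nm y.
Proof.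
have := ler_normD x y; rewrite !normc_def -rmorphD /= lecR.
by case: x => ? ?; case: y.
Qed.
Lemma nmB x y : nm (x - y) <= nm x + nm y.
Proof. by rewrite -(nmN y) nmD. Qed.
Lemma nm_sym x y : nm (x - y) = nm (y - x). Proof. by rewrite -nmN opprB. Qed.
Lemma nm_tri y x z : nm (x - z) <= nm (x - y) + nm (y - z).
Proof. by rewrite (_ : x - z = (x - y) + (y - z)) ?nmD //; ring. Qed.
Lemma nm_ler x y : nm x <= nm y + nm (x - y).
Proof. by rewrite {1}(_ : x = y + (x - y)) ?nmD //; ring. Qed.
Lemma nmX x n : nm (x ^+ n) = nm x ^+ n.
Proof. by elim: n => [|n IH]; rewrite ?nm1 // !exprS nmM IH. Qed.
Lemma nm_real (a : R) : nm (Complex a 0) = `|a|.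
Proof. by rewrite /= expr0n addr0 sqrtr_sqr. Qed.
Lemma nm_unit x n : (0 < n)%N -> x ^+ n = 1 -> nm x = 1.
Proof.
move=> n0 /(congr1 (fun z : C => nm z)); rewrite nmX nm1 => /eqP.
by rewrite pexpr_eq1 ?nm_ge0 // => /eqP.
Qed.
Lemma nm_sum (I : Type) (r : seq I) (P : pred I) (F : I -> C) :
  nm (\sum_(i <- r | P i) F i) <= \sum_(i <- r | P i) nm (F i).
Proof.
elim/big_rec2: _ => [|i y1 y2 _ h]; first by rewrite nm0.
by apply: (le_trans (nmD _ _)); rewrite lerD2l.
Qed.
Lemma nm_prod (I : Type) (r : seq I) (P : pred I) (F : I -> C) :
  nm (\prod_(i <- r | P i) F i) = \prod_(i <- r | P i) nm (F i).
Proof. by elim/big_rec2: _ => [|i y1 y2 _ <-]; rewrite ?nm1 ?nmM. Qed.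

Lemma gap (s : seq C) : exists2 d : R, 0 < d & forall x, x \in s -> x != 0 -> d <= nm x.
Proof.
elim: s => [|a s [d d0 IH]]; first by exists 1.
have [->|a0] := eqVneq a 0.
  by exists d => // x; rewrite inE => /orP[/eqP->|]; [rewrite eqxx|exact: IH].
exists (Num.min d (nm a)); first by rewrite lt_min d0 nm_gt0.
move=> x; rewrite inE => /orP[/eqP->|xs] x0; rewrite ge_min ?lexx ?orbT //.
by rewrite IH.
Qed.

Lemma seq_bound (s : seq C) : exists2 d : R, 0 <= d & forall x, x \in s -> nm x <= d.
Proof.
elim: s => [|a s [d d0 IH]]; first by exists 0.
exists (Num.max d (nm a)); first by rewrite le_max d0.
move=> x; rewrite inE => /orP[/eqP->|xs]; rewrite le_max ?lexx ?orbT //.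
by rewrite IH.
Qed.

Lemma horner_bound p (M : R) :
  exists2 K : R, 0 <= K & forall z, nm z <= M -> nm p.[z] <= K.
Proof.
elim/poly_ind: p => [|p c [K K0 IH]]; first by exists 0 => // z _; rewrite horner0 nm0.
exists (K * Num.max M 0 + nm c).
  by rewrite addr_ge0 ?nm_ge0 // mulr_ge0 // le_max lexx orbT.
move=> z zM; rewrite !hornerE; apply: (le_trans (nmD _ _)); rewrite lerD2r nmM.
by rewrite ler_pM ?nm_ge0 ?IH // le_max zM.
Qed.

Lemma horner_lip p (M : R) : exists2 K : R, 0 <= K &
  forall z z', nm z <= M -> nm z' <= M -> nm (p.[z] - p.[z']) <= K * nm (z - z').
Proof.
elim/poly_ind: p => [|p c [K K0 IH]].
  by exists 0 => // z z' _ _; rewrite !horner0 subr0 nm0 mul0r.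
have [B B0 hB] := horner_bound p M.
exists (K * Num.max M 0 + B).
  by rewrite addr_ge0 ?nm_ge0 // mulr_ge0 // le_max lexx orbT.
move=> z z' zM z'M; rewrite !hornerE.
have -> : p.[z] * z + c - (p.[z'] * z' + c) = (p.[z] - p.[z']) * z + p.[z'] * (z - z').
  by ring.
apply: (le_trans (nmD _ _)); rewrite !nmM mulrDl lerD //.
  rewrite mulrAC ler_pM ?nm_ge0 ?IH // le_max zM //.
by rewrite ler_wpM2r ?nm_ge0 ?hB.
Qed.

Lemma horner_cont p z (e : R) : 0 < e ->
  exists2 d : R, 0 < d & forall z', nm (z' - z) < d -> nm (p.[z'] - p.[z]) < e.
Proof.
move=> e0; have [K K0 hK] := horner_lip p (nm z + 1).
exists (Num.min 1 (e / (K + 1))).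
  by rewrite lt_min ltr01 divr_gt0 // ltr_wpDl.
move=> z'; rewrite lt_min => /andP[h1 h2].
apply: le_lt_trans (hK z' z _ _) _.
- by apply: (le_trans (nm_ler z' z)); lra.
- by lra.
rewrite ltr_pdivlMr ?ltr_wpDl // in h2.
by have := nm_ge0 (z' - z); nra.
Qed.

Lemma seq_argmin (T : eqType) (s : seq T) (F : T -> R) : s != [::] ->
  exists2 z : T, z \in s & forall y : T, y \in s -> F z <= F y.
Proof.
elim: s => // a [|b s] IH _.
  by exists a; rewrite ?inE // => y; rewrite inE => /eqP->.
have [z zs hz] := IH isT; case: (leP (F z) (F a)) => h.
  by exists z; [rewrite inE zs orbT|move=> y; rewrite inE => /orP[/eqP->|/hz]].
exists a; first by rewrite inE eqxx.
by move=> y; rewrite inE => /orP[/eqP->//|/hz]; apply: le_trans; exact: ltW.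
Qed.

Lemma roots_subE f w (r : seq C) z :
  f - w%:P = lead_coef f *: \prod_(z <- r) ('X - z%:P) ->
  f.[z] - w = lead_coef f * \prod_(y <- r) (z - y).
Proof.
move=> /(congr1 (fun p : {poly C} => p.[z])); rewrite !hornerE => ->.
by rewrite horner_prod; congr (_ * _); apply: eq_bigr => i _; rewrite !hornerE.
Qed.

Lemma prod_ge_exp (T : eqType) (s : seq T) (F : T -> R) (a : R) : 0 <= a ->
  (forall i, i \in s -> a <= F i) -> a ^+ size s <= \prod_(i <- s) F i.
Proof.
move=> a0; elim: s => [|b s IH] h; first by rewrite big_nil.
rewrite big_cons exprS ler_pM ?exprn_ge0 //; first by apply: h; rewrite inE eqxx.
by apply: IH => i ys; apply: h; rewrite inE ys orbT.
Qed.

(** At [x] the polynomial [f - w] is the leading coefficient times the product of the differences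
    from [x] to the roots, and the nearest root contributes the smallest factor. This gives
    continuity of roots with a modulus independent of [x] and [w]. *)
Lemma root_near f d x w : size f = d.+2 ->
  exists2 z, f.[z] = w & nm (lead_coef f) * nm (z - x) ^+ d.+1 <= nm (w - f.[x]).
Proof.
move=> sf; have [r sr hr] := roots_sub w sf.
have r0 : r != [::] by case: r sr {hr}.
have [z zr zmin] := seq_argmin (fun z => nm (z - x)) r0.
exists z.
  by apply/eqP; rewrite -subr_eq0 (roots_subE _ hr) (big_rem z) //= subrr mul0r mulr0.
rewrite (nm_sym w) (roots_subE _ hr) nmM ler_wpM2l ?nm_ge0 // nm_prod -sr.
by apply: prod_ge_exp => [|y /zmin h]; rewrite ?nm_ge0 // (nm_sym x).
Qed.

Lemma lead_gt0 f d : size f = d.+2 -> 0 < nm (lead_coef f).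
Proof. by move=> sf; rewrite nm_gt0 lead_coef_eq0 -size_poly_eq0 sf. Qed.

Lemma root_near_lt f d (e : R) : size f = d.+2 -> 0 < e ->
  exists2 e' : R, 0 < e' & forall x w, nm (w - f.[x]) < e' ->
    exists2 z, f.[z] = w & nm (z - x) < e.
Proof.
move=> sf e0; exists (nm (lead_coef f) * e ^+ d.+1).
  by rewrite mulr_gt0 ?exprn_gt0 // (lead_gt0 sf).
move=> x w h; have [z zw hz] := root_near x w sf; exists z => //.
rewrite ltNge; apply/negP => ez; have := le_lt_trans hz h.
rewrite ltr_pM2l ?(lead_gt0 sf) // ltNge => /negP; apply.
by rewrite lerXn2r // nnegrE ?nm_ge0 ?ltW.
Qed.

Lemma horner_proper f d (K : R) : size f = d.+2 ->
  exists M : R, forall z, M < nm z -> K < nm f.[z].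
Proof.
move=> sf; have [r sr hr] := roots_sub 0 sf; have [rho rho0 hrho] := seq_bound r.
have a0 := lead_gt0 sf.
(* Beyond this radius each factor [z - y] has modulus at least [1 + t], where [t] is the last
   summand, and [1 + t] times the modulus of the leading coefficient exceeds [|K|]. *)
exists (rho + 1 + `|K| / nm (lead_coef f)) => z hz.
have := roots_subE z hr; rewrite subr0 => ->.
have t0 : 0 <= `|K| / nm (lead_coef f) by rewrite divr_ge0 ?nm_ge0.
have h : (1 + `|K| / nm (lead_coef f)) ^+ d.+1 <= nm (\prod_(y <- r) (z - y)).
  rewrite nm_prod -sr; apply: prod_ge_exp => [|y /hrho h]; first by lra.
  by have := nm_ler z y; lra.
rewrite nmM; apply: lt_le_trans (ler_wpM2l (ltW a0) h).
have h2 : 1 + `|K| / nm (lead_coef f) <= (1 + `|K| / nm (lead_coef f)) ^+ d.+1.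
  by rewrite exprS ler_peMr ?exprn_ege1 //; lra.
apply: lt_le_trans (ler_wpM2l (ltW a0) h2).
rewrite mulrDr mulr1 mulrCA mulfV ?gt_eqF // mulr1.
by have := ler_norm K; lra.
Qed.

Lemma poly_bounded_const p (M B : R) :
  (forall z, M < nm z -> nm p.[z] <= B) -> (size p <= 1)%N.
Proof.
move=> h; rewrite leqNgt; apply/negP => sp.
have [d sd] : exists d, size p = d.+2 by case: (size p) sp => [|[|d]] // _; exists d.
have [M' h'] := horner_proper B sd.
pose z : C := Complex (`|M| + `|M'| + 1) 0.
have zE : nm z = `|M| + `|M'| + 1 by rewrite nm_real ger0_norm // !addr_ge0.
have a := ler_norm M; have b := ler_norm M'.
have := normr_ge0 M; have := normr_ge0 M' => c c'.
have := h z; have := h' z; rewrite zE; lra.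
Qed.

(** Liouville for the rational function [p / q]: a local bound makes every root of [q] a root of
    [p], and once all linear factors of [q] are cancelled a polynomial bounded near infinity
    remains. The local bounds are on punctured discs because cancelling a factor preserves them away
    from its root only. *)
Lemma poly_ratio_const p q (M B : R) : q != 0 ->
  (forall w0, exists e K : R, 0 < e /\
     forall w, 0 < nm (w - w0) < e -> nm p.[w] <= K * nm q.[w]) ->
  (forall w, M < nm w -> nm p.[w] <= B * nm q.[w]) ->
  exists c, p = c *: q.
Proof.
elim: (size q) {-2}q (leqnn (size q)) p M B => [|n IH] {}q.
  by rewrite leqn0 size_poly_eq0 => /eqP->; rewrite eqxx.
move=> sq p M B q0 hloc hinf.
have [sq1|sq1] := leqP (size q) 1.
  have [c cq] : exists c, q = c%:P by exists q`_0; exact: size1_polyC.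
  have c0 : c != 0 by move: q0; rewrite cq polyC_eq0.
  have sp : (size p <= 1)%N.
    by apply: (@poly_bounded_const p M (B * nm c)) => z /hinf; rewrite cq hornerC.
  exists (p`_0 / c); rewrite cq -mul_polyC -polyCM mulfVK //.
  exact: size1_polyC.
have [w0 [q1 hq]] : exists w0 : C, exists q1 : {poly C}, q = q1 * ('X - w0%:P).
  by have [w0 /factor_theorem[q1 hq]] := closed_rootP q (negbT (gtn_eqF sq1)); exists w0, q1.
have pw0 : root p w0.
  apply/rootP/eqP; rewrite -nm_eq0 eq_le nm_ge0 andbT leNgt; apply/negP => h.
  have [e [K [e0 he]]] := hloc w0.
  have h2 : 0 < nm p.[w0] / 2 by lra.
  have [d1 d10 hd1] := horner_cont p w0 h2.
  have h3 : 0 < nm p.[w0] / 2 / (`|K| + 1) by rewrite divr_gt0 // ltr_wpDl.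
  have [d2 d20 hd2] := horner_cont q w0 h3.
  have qw0 : q.[w0] = 0 by rewrite hq !hornerE subrr mulr0.
  pose t := Num.min e (Num.min d1 d2) / 2.
  have t0 : 0 < t by rewrite divr_gt0 // !lt_min e0 d10.
  have [t1 t2 t3] : [/\ t < e, t < d1 & t < d2].
    have : t * 2 <= e by rewrite /t divfK ?pnatr_eq0 // ge_min lexx.
    have : t * 2 <= d1 by rewrite /t divfK ?pnatr_eq0 // !ge_min lexx orbT.
    have : t * 2 <= d2 by rewrite /t divfK ?pnatr_eq0 // !ge_min lexx !orbT.
    by split; lra.
  pose w := w0 + Complex t 0.
  have wE : nm (w - w0) = t by rewrite /w addrAC subrr add0r nm_real gtr0_norm.
  have := he w; have := hd1 w; have := hd2 w; rewrite wE t0 t1 t2 t3 qw0 subr0.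
  move=> /(_ isT) A1 /(_ isT) A2 /(_ isT) A3.
  have := nm_ler p.[w0] p.[w]; rewrite nm_sym => A4.
  have A5 : K * nm q.[w] <= nm p.[w0] / 2.
    apply: (@le_trans _ _ (`|K| * nm q.[w])); first by rewrite ler_wpM2r ?nm_ge0 ?ler_norm.
    rewrite ltr_pdivlMr ?ltr_wpDl // in A1.
    by have := nm_ge0 q.[w]; have := normr_ge0 K; nra.
  by move: A2 A3 A4 A5 {hq}; lra.
have [p1 hp] := factor_theorem _ _ pw0.
have q10 : q1 != 0 by apply: contraNneq q0 => q10; rewrite hq q10 mul0r.
have sq' : (size q1 <= n)%N.
  by move: sq; rewrite hq size_Mmonic ?monicXsubC // size_XsubC addn2.
have red w (K : R) : w != w0 -> nm p.[w] <= K * nm q.[w] -> nm p1.[w] <= K * nm q1.[w].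
  move=> ww0; rewrite hp hq !hornerM !nmM mulrA ler_pM2r //.
  by rewrite nm_gt0 !hornerE subr_eq0.
have [c hc] : exists c, p1 = c *: q1.
  apply: (IH q1 sq' p1 (Num.max M (nm w0)) B q10) => [w1|w].
    have [e [K [e0 he]]] := hloc w1.
    have [w10|w10] := eqVneq w1 w0.
      exists e, K; split=> // w hw; apply: red; last exact: he.
      by case/andP: hw; rewrite w10 nm_gt0 subr_eq0.
    exists (Num.min e (nm (w0 - w1))), K; split.
      by rewrite lt_min e0 nm_gt0 subr_eq0 eq_sym.
    move=> w; rewrite lt_min => /and3P[h1 h2 h3]; apply: red; last by rewrite he ?h1.
    by apply: contraTneq h3 => ->; rewrite ltxx.
  rewrite gt_max => /andP[h1 h2]; apply: red; last exact: hinf.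
  by apply: contraTneq h2 => ->; rewrite ltxx.
by exists c; rewrite hp hc hq scalerAl.
Qed.
End Modulus.

(** * Pairs of roots near a critical point and near infinity *)

Section Branches.
Variable R : realType.
Local Notation C := R[i].
Implicit Types (x y z u v w : C) (p q f : {poly C}).

Lemma unity_roots n : exists2 s : seq C, uniq (1 :: s) &
  'X^(n.+1) - 1 = \prod_(y <- 1 :: s) ('X - y%:P).
Proof.
have [r] := closed_field_poly_normal ('X^(n.+1) - 1 : {poly C}).
rewrite lead_coefDl ?lead_coefXn ?scale1r; last first.
  by rewrite size_polyN size_poly1 size_polyXn.
move=> hr.
have ur : uniq r.
  by rewrite -separable_prod_XsubC -hr separable_Xn_sub_1 // pnatr_eq0.
have r1 : 1 \in r.
  by rewrite -root_prod_XsubC -hr rootE !hornerE expr1n subrr.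
exists (rem 1 r); first by rewrite -(perm_uniq (perm_to_rem r1)).
by rewrite hr; apply: perm_big; exact: perm_to_rem.
Qed.

(** Divide by [u]: with [y = u' / u], the hypothesis bounds the product of [y - b] over the roots of
    unity [b] other than 1. Only the factor of the nearest one, [eta], can be small, the others
    being at least half the gap [g] between roots of unity. *)
Lemma unity_near n : exists2 K : R, 0 <= K & forall u u' (e : R),
  u != 0 -> u != u' -> e < 1 ->
  nm (u ^+ n.+1 - u' ^+ n.+1) <= e * nm (u - u') * nm u ^+ n ->
  exists eta, [/\ eta ^+ n.+1 = 1, eta != 1 & nm (u' - eta * u) <= K * e * nm u].
Proof.
have [s us hs] := unity_roots n.
have [g g0 hg] := gap [seq a - b | a <- s, b <- s].
exists ((2 / g) ^+ (size s).-1); first by rewrite exprn_ge0 // divr_ge0 // ltW.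
move=> u u' e u0 uu' e1 h.
have nu0 : 0 < nm u by rewrite nm_gt0.
pose y := u' / u; have yu : u' = y * u by rewrite /y mulfVK.
have y1 : y != 1 by apply: contraNneq uu' => y1; rewrite yu y1 mul1r.
have hy : nm (y ^+ n.+1 - 1) <= e * nm (y - 1).
  move: h; rewrite yu exprMn.
  rewrite (_ : u ^+ n.+1 - _ = - ((y ^+ n.+1 - 1) * u ^+ n.+1)); last by ring.
  rewrite (_ : u - _ = - ((y - 1) * u)); last by ring.
  rewrite !nmN !nmM nmX (_ : e * _ * _ = e * nm (y - 1) * nm u ^+ n.+1); last first.
    by rewrite exprS; ring.
  by rewrite ler_pM2r ?exprn_gt0.
have prodE : y ^+ n.+1 - 1 = (y - 1) * \prod_(b <- s) (y - b).
  have := congr1 (fun p : {poly C} => p.[y]) hs.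
  rewrite hornerD hornerN hornerXn hornerC => ->.
  rewrite big_cons hornerM horner_prod hornerXsubC.
  by congr (_ * _); apply: eq_bigr => i _; rewrite hornerXsubC.
have {hy} hy : \prod_(b <- s) nm (y - b) <= e.
  move: hy; rewrite prodE nmM nm_prod mulrC ler_pM2r // nm_gt0 subr_eq0 //.
(* For [n = 0] the product is empty, hence 1, which [e < 1] excludes. *)
have s0 : s != [::].
  by apply: contraTneq hy => ->; rewrite big_nil -ltNge.
have [eta es hmin] := seq_argmin (fun b => nm (y - b)) s0.
have sroot b : b \in 1 :: s -> b ^+ n.+1 = 1.
  rewrite -root_prod_XsubC -hs rootE !hornerE subr_eq0.
  by move/eqP.
exists eta; split.
- by apply: sroot; rewrite inE es orbT.
- by apply: contraTneq us => <-; rewrite /= es.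
rewrite yu -mulrBl nmM ler_pM2r //.
have hge : nm (y - eta) * (g / 2) ^+ (size s).-1 <= e.
  apply: le_trans hy; rewrite (big_rem eta) //= ler_wpM2l ?nm_ge0 //.
  rewrite -(size_rem es); apply: prod_ge_exp; first by rewrite divr_ge0 // ltW.
  move=> b; rewrite mem_rem_uniq; last by case/andP: us.
  case/andP=> be bs.
  have h1 : g <= nm (eta - b).
    apply: hg; last by rewrite subr_eq0 eq_sym.
    by apply/allpairsP; exists (eta, b).
  have h2 := nm_tri y eta b; rewrite (nm_sym eta y) in h2.
  have h3 := hmin b bs; lra.
have g2 : 0 < (g / 2) ^+ (size s).-1 by rewrite exprn_gt0 // divr_gt0.
by rewrite -invf_div exprVn mulrC ler_pdivlMr.
Qed.

(* Unlike in [unity_near], the hypothesis is measured by [m = max (nm u) (nm u')];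
   swapping [u] and [u'] replaces [eta] by its inverse. *)
Lemma unity_near_sym n : exists K e0 : R, [/\ 0 <= K, 0 < e0 & forall u u' (e m : R),
  u != u' -> 0 <= e < e0 -> nm u <= m -> nm u' <= m -> (m = nm u \/ m = nm u') ->
  nm (u ^+ n.+1 - u' ^+ n.+1) <= e * nm (u - u') * m ^+ n ->
  exists eta, [/\ eta ^+ n.+1 = 1, eta != 1,
    nm (u' - eta * u) <= K * e * nm u & m <= 2 * nm u]].
Proof.
have [K K0 hK] := unity_near n.
exists (2 * K), (Num.min 1 (1 / (2 * K + 1))); split.
- by rewrite mulr_ge0.
- by rewrite lt_min ltr01 divr_gt0 //; lra.
move=> u u' e m uu' /andP[e0]; rewrite lt_min ltr_pdivlMr => [|]; last by lra.
case/andP=> e1 e2 um u'm mm h.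
have m0 : 0 < m.
  rewrite lt_neqAle (le_trans (nm_ge0 u) um) andbT eq_sym.
  apply: contraNneq uu' => m0; move: um u'm; rewrite m0 => h1 h2.
  have /eqP : nm u = 0 by apply: le_anti; rewrite h1 nm_ge0.
  have /eqP : nm u' = 0 by apply: le_anti; rewrite h2 nm_ge0.
  by rewrite !nm_eq0 => /eqP -> /eqP ->.
case: mm => mE.
  have u0 : u != 0 by rewrite -nm_gt0 -mE.
  rewrite mE in h; have [eta [h1 h2 h3]] := hK u u' e u0 uu' e1 h.
  exists eta; split => //; last by rewrite mE; have := nm_ge0 u; lra.
  apply: (le_trans h3); rewrite ler_wpM2r ?nm_ge0 // -mulrA ler_peMl ?mulr_ge0 //; lra.
have u0 : u' != 0 by rewrite -nm_gt0 -mE.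
rewrite mE (nm_sym (u ^+ _)) (nm_sym u) in h; rewrite eq_sym in uu'.
have [eta [h1 h2 h3]] := hK u' u e u0 uu' e1 h.
have eta0 : eta != 0.
  by apply: contra_eq_neq h1 => ->; rewrite expr0n /= eq_sym oner_neq0.
have neta : nm eta = 1 by exact: (@nm_unit _ _ n.+1).
have mu : m <= 2 * nm u.
  have := nm_ler (eta * u') u; rewrite nmM neta mul1r nm_sym -mE => h4.
  by move: h3; rewrite -mE; nra.
exists eta^-1; split => //.
- by rewrite exprVn h1 invr1.
- by rewrite -invr1 (inj_eq invr_inj).
rewrite (_ : u' - eta^-1 * u = - eta^-1 * (u - eta * u')); last by field.
rewrite nmM nmN nmV neta invr1 mul1r; apply: (le_trans h3); rewrite -mE.
have Ke : 0 <= K * e by rewrite mulr_ge0.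
by rewrite (_ : 2 * K * e * nm u = K * e * (2 * nm u)) ?ler_wpM2l //; ring.
Qed.

Lemma exp_lip n u u' (m : R) : nm u <= m -> nm u' <= m ->
  nm (u ^+ n.+1 - u' ^+ n.+1) <= n.+1%:R * m ^+ n * nm (u - u').
Proof.
move=> um u'm; have m0 := le_trans (nm_ge0 u) um.
elim: n => [|n IH]; first by rewrite !expr1 expr0 !mul1r.
rewrite (_ : _ - _ = u * (u ^+ n.+1 - u' ^+ n.+1) + (u - u') * u' ^+ n.+1); last first.
  by rewrite (exprS u n.+1) (exprS u' n.+1); ring.
apply: (le_trans (nmD _ _)); rewrite !nmM nmX.
rewrite -(@natr1 R n.+1) mulrDl mulrDl mul1r lerD //.
  rewrite (_ : _ * nm (u - u') = m * (n.+1%:R * m ^+ n * nm (u - u'))).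
    by rewrite ler_pM ?nm_ge0.
  by rewrite exprS; ring.
by rewrite mulrC ler_wpM2r ?nm_ge0 // lerXn2r // nnegrE ?nm_ge0.
Qed.

(* With [f = c_e X^e + ...], the equation [f u = f u'] makes [c_e (u^e - u'^e)]
   equal to the contribution of the other coefficients. *)
Lemma lead_diff f n u u' (m b : R) :
  nm u <= m -> nm u' <= m -> f.[u] = f.[u'] ->
  0 <= b -> (forall i, i.+1 != n -> f`_i.+1 != 0 -> m ^+ i <= b) -> (n < size f)%N -> (0 < n)%N ->
  nm f`_n * nm (u ^+ n - u' ^+ n) <=
    (\sum_(i < size f) nm f`_i * i%:R) * b * nm (u - u').
Proof.
move=> um u'm fe b0 hb ns n0; have m0 := le_trans (nm_ge0 u) um.
have : \sum_(i < size f) f`_i * (u ^+ i - u' ^+ i) = 0.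
  rewrite (eq_bigr (fun i : 'I_(size f) => f`_i * u ^+ i - f`_i * u' ^+ i)).
    by rewrite sumrB -!horner_coef fe subrr.
  by move=> i _; rewrite mulrBr.
rewrite (bigD1 (Ordinal ns)) //= => /eqP; rewrite addr_eq0 => /eqP E.
rewrite -nmM E nmN; apply: (le_trans (nm_sum _ _ _)).
rewrite [X in _ <= X * _ * _](bigD1 (Ordinal ns)) //= mulrDl mulrDl.
rewrite -[leLHS]add0r lerD //; first by rewrite !mulr_ge0 ?nm_ge0 ?ler0n.
rewrite !mulr_suml; apply: ler_sum => -[[|i] hi] /= ne.
  by rewrite !expr0 subrr mulr0 nm0 !mulr0 !mul0r.
rewrite nmM; have [->|fi] := eqVneq f`_i.+1 0; first by rewrite nm0 !mul0r.
rewrite -!mulrA ler_wpM2l ?nm_ge0 //; apply: (le_trans (exp_lip i um u'm)).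
rewrite -mulrA ler_wpM2l ?ler0n // ler_wpM2r ?nm_ge0 // hb //.
Qed.

(** The leading term dominates, with relative error of order [1 / m]. Multiplied by [nm z] this is a
    bounded absolute error, which later makes suitable linear combinations of roots bounded at
    infinity. *)
Lemma pair_infty f d : size f = d.+3 -> exists K M : R, [/\ 0 <= K, 0 <= M & forall z z',
  z != z' -> f.[z] = f.[z'] -> M < nm z -> M < nm z' ->
  exists eta, [/\ eta ^+ d.+2 = 1, eta != 1 & nm (z' - eta * z) <= K]].
Proof.
move=> sf; have [K [e0 [K0 e00 hK]]] := unity_near_sym d.+1.
pose S := \sum_(i < size f) nm f`_i * i%:R.
have S0 : 0 <= S by apply: sumr_ge0 => i _; rewrite mulr_ge0 ?nm_ge0 ?ler0n.
have a0 : 0 < nm f`_d.+2 by have := @lead_gt0 R f d.+1; rewrite lead_coefE sf; apply.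
pose L := S / nm f`_d.+2.
have L0 : 0 <= L by rewrite divr_ge0 // ltW.
have M0 : 0 <= L / e0 by rewrite divr_ge0 // ltW.
exists (K * L), (1 + L / e0); split; [by rewrite mulr_ge0|by lra|].
move=> z z' zz' fz zM z'M.
pose m := Num.max (nm z) (nm z').
have zm : nm z <= m by rewrite le_max lexx.
have z'm : nm z' <= m by rewrite le_max lexx orbT.
have m1 : 1 <= m by lra.
have m0 : 0 < m by lra.
have mm : m = nm z \/ m = nm z' by rewrite /m maxEle; case: ifP; [right|left].
have em : 0 <= L / m < e0.
  have h : L / e0 < m by lra.
  rewrite ltr_pdivrMr // mulrC in h.
  by rewrite divr_ge0 ?(ltW m0) //= ltr_pdivrMr.
have [|eta [h1 h2 h3 h4]] := hK z z' (L / m) m zz' em zm z'm mm.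
  have := @lead_diff f d.+2 z z' m (m ^+ d) zm z'm fz.
  rewrite exprn_ge0 ?(ltW m0) //= => /(_ isT) h.
  rewrite (_ : L / m * _ * _ = S * m ^+ d * nm (z - z') / nm f`_d.+2); last first.
    by rewrite /L exprS; field; rewrite !gt_eqF.
  rewrite ler_pdivlMr // mulrC; apply: h; rewrite ?sf //.
  move=> i ni fi; apply: ler_weXn2l => //; rewrite -ltnS.
  have : (i.+1 < d.+3)%N by rewrite -sf ltnNge; apply: contra fi => /(nth_default 0) ->.
  by rewrite ltnS leq_eqVlt (negPf ni).
exists eta; split => //; apply: (le_trans h3).
rewrite -mulrA -[leRHS]mulr1 -mulrA; apply: ler_wpM2l => //.
by rewrite -mulrA ler_wpM2l // ler_pdivrMl // mulr1.
Qed.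

(** Near [p0] the first nonconstant term of the Taylor expansion, of order [n.+1], dominates. For
    [n = 0] no [eta] exists, and the conclusion expresses local injectivity. *)
Lemma pair_local f d (p0 : C) : size f = d.+2 -> exists n, forall e : R, 0 < e ->
  exists2 r : R, 0 < r & forall z z', z != z' -> f.[z] = f.[z'] ->
    nm (z - p0) < r -> nm (z' - p0) < r ->
  exists eta, [/\ eta ^+ n.+1 = 1, eta != 1 &
    nm (z' - p0 - eta * (z - p0)) <= e * nm (z - p0)].
Proof.
move=> sf0; pose g := f \Po ('X + p0%:P).
have gE u : g.[u] = f.[u + p0] by rewrite horner_comp !hornerE.
have sg : size g = d.+2 by rewrite size_comp_poly2 ?sf0 // size_XaddC.
have [n gn hn] : exists2 n, g`_n.+1 != 0 & forall i, (i < n)%N -> g`_i.+1 = 0.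
  have hex : exists n, g`_n.+1 != 0.
    by exists d; have := @lead_gt0 R g d sg; rewrite lead_coefE sg nm_gt0.
  exists (ex_minn hex); case: ex_minnP => // m hm hmin.
  by move=> i im; apply/eqP/negPn/negP => /hmin; rewrite leqNgt im.
have nsg : (n.+1 < size g)%N by rewrite ltnNge; apply: contra gn => /(nth_default 0) ->.
exists n => e e_gt0; have [K [e0 [K0 e00 hK]]] := unity_near_sym n.
pose S := \sum_(i < size g) nm g`_i * i%:R.
have S0 : 0 <= S by apply: sumr_ge0 => i _; rewrite mulr_ge0 ?nm_ge0 ?ler0n.
have a0 : 0 < nm g`_n.+1 by rewrite nm_gt0.
pose L := S / nm g`_n.+1 + 1.
have L0 : 0 < L by rewrite ltr_wpDl // divr_ge0 // ltW.
exists (Num.min 1 (Num.min (e0 / L) (e / (K * L + 1)))).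
  by rewrite !lt_min ltr01 !divr_gt0 // ltr_wpDl ?mulr_ge0 // ltW.
move=> z z' zz' fz; rewrite !lt_min.
move=> /and3P[z1 z2 z3] /and3P[z'1 z'2 z'3].
set u := z - p0 in z1 z2 z3 *; set u' := z' - p0 in z'1 z'2 z'3 *.
have uu' : u != u' by apply: contraNneq zz' => /addIr ->.
pose m := Num.max (nm u) (nm u').
have zm : nm u <= m by rewrite le_max lexx.
have z'm : nm u' <= m by rewrite le_max lexx orbT.
have mm : m = nm u \/ m = nm u' by rewrite /m maxEle; case: ifP; [right|left].
have m0 : 0 <= m by apply: le_trans zm; exact: nm_ge0.
have [m1 m2 m3] : [/\ m < 1, m < e0 / L & m < e / (K * L + 1)].
  by case: mm => ->.
have em : 0 <= L * m < e0.
  by rewrite mulr_ge0 ?(ltW L0) // mulrC -ltr_pdivlMr.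
have [|eta [h1 h2 h3 h4]] := hK u u' (L * m) m uu' em zm z'm mm.
  have gu : g.[u] = g.[u'] by rewrite !gE !subrK.
  have := @lead_diff g n.+1 u u' m (m * m ^+ n) zm z'm gu.
  rewrite nsg mulr_ge0 ?exprn_ge0 //= => /(_ isT) h.
  have {}h : nm g`_n.+1 * nm (u ^+ n.+1 - u' ^+ n.+1) <= S * (m * m ^+ n) * nm (u - u').
    apply: h => // i ni gi; rewrite -exprS ler_wiXn2l ?(ltW m1) //.
    by rewrite ltn_neqAle eq_sym -eqSS ni leqNgt; apply: contra gi => /hn ->.
  have {}h : nm (u ^+ n.+1 - u' ^+ n.+1) <= S / nm g`_n.+1 * m * nm (u - u') * m ^+ n.
    rewrite (_ : _ * m ^+ n = S * (m * m ^+ n) * nm (u - u') / nm g`_n.+1); last by ring.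
    by rewrite ler_pdivlMr // mulrC.
  apply: (le_trans h); rewrite !ler_wpM2r ?exprn_ge0 ?nm_ge0 // /L; lra.
exists eta; split => //; apply: (le_trans h3); rewrite ler_wpM2r ?nm_ge0 //.
have KL : 0 < K * L + 1 by rewrite ltr_wpDl // mulr_ge0 // ltW.
by move: m3; rewrite ltr_pdivlMr //; nra.
Qed.
End Branches.

(** * Functions of root tuples *)

Section SymmetricSums.
Variables (R : idomainType) (d : nat).

Lemma meval_msym (p : {mpoly R[d]}) (s : 'S_d) (z : 'I_d -> R) :
  (msym s p).@[z] = p.@[fun i => z (s i)].
Proof.
rewrite /msym [in RHS]mevalE /mmap raddf_sum; apply: eq_bigr => m _ /=.
rewrite mevalM mevalC; congr (_ * _); rewrite /mmap1 rmorph_prod.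
by apply: eq_bigr => i _ /=; rewrite rmorphXn /= mevalXU.
Qed.

Lemma msym_prod (I : Type) (r : seq I) (P : pred I) (F : I -> {mpoly R[d]}) (t : 'S_d) :
  msym t (\prod_(i <- r | P i) F i) = \prod_(i <- r | P i) msym t (F i).
Proof. exact: (big_morph _ (msymM t) (msym1 _ t)). Qed.

Lemma meval_prod (I : Type) (r : seq I) (P : pred I) (F : I -> {mpoly R[d]}) z :
  (\prod_(i <- r | P i) F i).@[z] = \prod_(i <- r | P i) (F i).@[z].
Proof. exact: (big_morph _ (mevalM z) (meval1 z)). Qed.

Lemma norm_sym (P : {mpoly R[d]}) : \prod_(s : 'S_d) msym s P \is symmetric.
Proof.
apply/issymP => t; rewrite msym_prod [RHS](reindex_inj (mulIg t)) /=.
by apply: eq_bigr => s _; rewrite msymMm.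
Qed.

(** The coefficient of [T ^ e] in the product over all [s] of [msym s Q + T * msym s P], hence
    symmetric. If exactly [e] conjugates of [P] are nonzero at [z], it gives, up to a nonzero
    factor, the product of [Q] over the permutations of [z] where [P] vanishes: a norm restricted to
    the curve [P = 0]. *)
Definition esum (P Q : {mpoly R[d]}) (e : nat) : {mpoly R[d]} :=
  \sum_(I : {set 'S_d} | #|I| == e)
    (\prod_(s in I) msym s P) * \prod_(s in ~: I) msym s Q.

Lemma esum_sym P Q e : esum P Q e \is symmetric.
Proof.
apply/issymP => t; rewrite /esum raddf_sum /=.
have prodE (I : {set 'S_d}) (T : {mpoly R[d]}) :
    msym t (\prod_(s in I) msym s T) =
    \prod_(s in [set s * t | s in I]%g) msym s T.
  rewrite msym_prod big_imset /=; last by move=> a b _ _; exact: mulIg.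
  by apply: eq_bigr => s _; rewrite msymMm.
have injI : injective (fun I : {set 'S_d} => [set s * t | s in I]%g).
  by apply: imset_inj; exact: mulIg.
rewrite [RHS](reindex_inj injI) /=; apply: eq_big => [I|I _].
  by rewrite card_imset //; exact: mulIg.
rewrite msymM !prodE; congr (_ * _); apply: eq_bigl => s.
rewrite inE; apply/imsetP/idP => [[a]|].
  rewrite inE => aI ->; apply: contra aI => /imsetP[b bI].
  by move/mulIg ->.
move=> h; exists (s * t^-1)%g; last by rewrite mulgKV.
by rewrite inE; apply: contra h => sI; apply/imsetP; exists (s * t^-1)%g; rewrite ?mulgKV.
Qed.

Definition nonvanishing (P : {mpoly R[d]}) (z : 'I_d -> R) :=
  [set s : 'S_d | (msym s P).@[z] != 0].

(** A set of [e] permutations other than [nonvanishing P z] contains, by cardinality, one at which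
    [P] vanishes, so its term is zero. *)
Lemma esum_eval P Q e z : (#|nonvanishing P z| <= e)%N ->
  (esum P Q e).@[z] = if #|nonvanishing P z| == e then
    (\prod_(s in nonvanishing P z) (msym s P).@[z])
    * \prod_(s in ~: nonvanishing P z) (msym s Q).@[z] else 0.
Proof.
move=> he; rewrite /esum raddf_sum /=.
have zeroI (I : {set 'S_d}) : #|I| = e -> I != nonvanishing P z ->
    ((\prod_(s in I) msym s P) * \prod_(s in ~: I) msym s Q).@[z] = 0.
  move=> cI neI; have [s sI sN] : exists2 s, s \in I & s \notin nonvanishing P z.
    apply/subsetPn; apply: contra neI => sub.
    by rewrite eqEcard sub cI.
  rewrite mevalM meval_prod (bigD1 s) //=.
  by move: sN; rewrite inE negbK => /eqP ->; rewrite !mul0r.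
case: ifP => [ce|ce].
  rewrite (bigD1 (nonvanishing P z)) //= [X in _ + X]big1; last first.
    by move=> I /andP[/eqP cI neI]; exact: zeroI.
  by rewrite addr0 mevalM !meval_prod.
apply: big1 => I /eqP cI; apply: zeroI => //.
by apply: contraFneq ce => <-; rewrite cI.
Qed.

End SymmetricSums.

(** * Ordered tuples of roots and their norms *)

Section RootTuples.
Variable C : closedFieldType.
Implicit Types (f : {poly C}) (w : C).

(** Roots are listed with multiplicity, so that symmetric functions of [z] remain polynomials in [w]
    at the critical values. *)
Definition enumerates (f : {poly C}) (w : C) d (z : 'I_d -> C) : Prop :=
  f - w%:P = lead_coef f *: \prod_(i < d) ('X - (z i)%:P).

Lemma enumerates_exists (f : {poly C}) d w :
  size f = d.+2 -> exists z : 'I_d.+1 -> C, enumerates f w z.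
Proof.
move=> sf; have [r /eqP sr hr] := roots_sub w sf; exists (tnth (Tuple sr)).
rewrite /enumerates hr; congr (_ *: _).
by rewrite -[r]/(tval (Tuple sr)) [LHS]big_tuple.
Qed.

Lemma enumerates_perm f w d (z : 'I_d -> C) (s : 'S_d) :
  enumerates f w z -> enumerates f w (fun i => z (s i)).
Proof.
rewrite /enumerates => ->; congr (_ *: _).
by rewrite (reindex_inj (@perm_inj _ s)).
Qed.

Lemma enumerates_root f w d (z : 'I_d -> C) i : enumerates f w z -> f.[z i] = w.
Proof.
move=> /(congr1 (fun p : {poly C} => p.[z i])).
rewrite hornerD hornerN hornerC hornerZ horner_prod (bigD1 i) //= hornerXsubC subrr.
by rewrite mul0r mulr0 => /eqP; rewrite subr_eq0 => /eqP.
Qed.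

Lemma symmetric_polynomial f d (E : {mpoly C[d.+1]}) :
  size f = d.+2 -> E \is symmetric ->
  exists P : {poly C}, forall w z, enumerates f w z -> E.@[z] = P.[w].
Proof.
move=> sf /sym_fundamental[t [<- _]].
have f0 : lead_coef f != 0 by rewrite lead_coef_eq0 -size_poly_eq0 sf.
(* By Vieta, [c i] at [w] is the elementary symmetric function of degree [i.+1]; [w] enters only the
   constant coefficient, where [d.+1 - i.+1 = 0]. *)
pose c (i : 'I_d.+1) : {poly C} := ((-1) ^+ i.+1 / lead_coef f) *:
  ((f`_(d.+1 - i.+1))%:P - 'X *+ (d.+1 - i.+1 == 0)%N).
exists (mmap (@polyC C) c t) => w z hz.
rewrite comp_mpoly_meval mevalE /mmap -horner_evalE raddf_sum.
apply: eq_bigr => m _; rewrite /= horner_evalE hornerM hornerC; congr (_ * _).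
rewrite /mmap1 horner_prod; apply: eq_bigr => i _; rewrite horner_exp; congr (_ ^+ _).
rewrite tnth_mktuple.
have ltk : (i.+1 < d.+2)%N by rewrite ltnS.
have := mroots_coeff [tuple z i | i < d.+1] (Ordinal ltk).
have -> : (\prod_(a <- [tuple z i | i < d.+1]) ('X - a%:P)) = (lead_coef f)^-1 *: (f - w%:P).
  rewrite hz scalerA mulVf // scale1r big_tuple; apply: eq_bigr => j _.
  by rewrite tnth_mktuple.
rewrite /= coefZ coefB coefC.
move=> h; rewrite -(@meval_eq _ _ _ _ _ (fun j => tnth_mktuple z j)).
apply: (mulfI (_ : (-1) ^+ i.+1 != 0)); first by rewrite signr_eq0.
rewrite -h /c hornerZ hornerD hornerN hornerC hornerMn hornerX.
rewrite [RHS]mulrA (mulrA ((-1) ^+ _)) -expr2 sqrr_sign mul1r.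
by case: eqP => _; rewrite ?mulr1n ?mulr0n.
Qed.

Section FiniteValues.
Variables (f : {poly C}) (d : nat).
Hypothesis sf : size f = d.+2.

Definition polyfun (g : ('I_d.+1 -> C) -> C) : Prop :=
  exists p : {mpoly C[d.+1]}, forall z, p.@[z] = g z.

Lemma polyfun_const a : polyfun (fun=> a).
Proof. by exists a%:MP => z; rewrite mevalC. Qed.
Lemma polyfun_var i : polyfun (fun z => z i).
Proof. by exists 'X_i => z; rewrite mevalXU. Qed.
Lemma polyfunB g h : polyfun g -> polyfun h -> polyfun (fun z => g z - h z).
Proof. by move=> [p hp] [q hq]; exists (p - q) => z; rewrite mevalB hp hq. Qed.
Lemma polyfunM g h : polyfun g -> polyfun h -> polyfun (fun z => g z * h z).
Proof. by move=> [p hp] [q hq]; exists (p * q) => z; rewrite mevalM hp hq. Qed.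

Lemma polyroots_seq (p : {poly C}) : p != 0 -> exists F : seq C, forall w, p.[w] = 0 -> w \in F.
Proof.
move=> p0; have [F hF] := closed_field_poly_normal p; exists F => w pw.
by rewrite -root_prod_XsubC -(rootZ _ _ (_ : lead_coef p != 0)) ?lead_coef_eq0 // -hF; apply/rootP.
Qed.

(** The product of all conjugates of the relation is a polynomial in [w]: it is zero or has finitely
    many roots. *)
Lemma relation_dense g : polyfun g ->
  (forall w, exists2 z, enumerates f w z & g z = 0) \/
  (exists F : seq C, forall w z, enumerates f w z -> g z = 0 -> w \in F).
Proof.
case=> P hP; have [Q hQ] := symmetric_polynomial sf (norm_sym P).
have [Q0|/polyroots_seq[F hF]] := eqVneq Q 0.
  left => w; have [z hz] := enumerates_exists w sf.
  have /eqP := hQ w z hz; rewrite Q0 horner0 meval_prod prodf_seq_eq0 => /hasP[s _].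
  rewrite /= meval_msym hP => /eqP h; exists (fun i => z (s i)) => //.
  exact: enumerates_perm.
right; exists F => w z hz Pz; apply: hF; rewrite -(hQ w z hz) meval_prod (bigD1 1%g) //=.
by rewrite msym1m hP Pz mul0r.
Qed.

(* [Q] and [Qx] are the norms, down to the line of values [w], of [h] and of
   [g - x h] restricted to the curve [P = 0] of root tuples, up to the common
   factor [A]. *)
Lemma norm_pair (P g h : ('I_d.+1 -> C) -> C) (F0 : seq C) :
  polyfun P -> polyfun g -> polyfun h -> (exists w, w \notin F0) ->
  (forall w z, w \notin F0 -> enumerates f w z -> P z = 0 -> h z != 0) ->
  exists (Q : {poly C}) (w1 : C) (S : seq C) (k : nat), Q.[w1] != 0 /\
  forall x, exists Qx : {poly C}, [/\ (x \notin S -> Qx.[w1] != 0),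
    (forall w, w \notin F0 -> exists (A : C) (D : {set 'S_d.+1}) (z : 'I_d.+1 -> C),
       [/\ A = 0 \/ #|D| = k, enumerates f w z,
           forall s, s \in D -> P (fun i => z (s i)) = 0,
           Q.[w] = A * \prod_(s in D) h (fun i => z (s i))
         & Qx.[w] = A * \prod_(s in D) (g (fun i => z (s i)) - x * h (fun i => z (s i)))])
  & (forall w z, w \notin F0 -> enumerates f w z -> P z = 0 -> Q.[w] != 0 ->
       x = g z / h z -> Qx.[w] = 0)].
Proof.
move=> [p hp] pg [q hq] exw hne.
(* The largest number [e] of nonvanishing conjugates over admissible [w] is wanted: [esum_eval] then
   applies everywhere, and gives nonzero values at a pair [w1], [z1] where [e] is reached. *)
pose good e := `[< exists w z, [/\ w \notin F0, enumerates f w z & #|nonvanishing p z| = e] >].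
have goodE w z : w \notin F0 -> enumerates f w z -> good #|nonvanishing p z|.
  by move=> h1 h2; apply/asboolP; exists w, z.
have exg : exists e, good e.
  have [w wF] := exw; have [z hz] := enumerates_exists w sf.
  by exists #|nonvanishing p z|; exact: goodE hz.
have ubg e : good e -> (e <= #|'S_d.+1|)%N.
  by move=> /asboolP[w [z [_ _ <-]]]; exact: max_card.
case: (ex_maxnP exg ubg) => e /asboolP[w1 [z1 [w1F hz1 ce1]]] emax {exg ubg}.
have le_e w z : w \notin F0 -> enumerates f w z -> (#|nonvanishing p z| <= e)%N.
  by move=> h1 h2; apply: emax; exact: goodE h2.
have vanish z s : s \in ~: nonvanishing p z -> P (fun i => z (s i)) = 0.
  by rewrite !inE negbK meval_msym hp => /eqP.
have evl t (S : {poly C}) w z :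
    (forall w z, enumerates f w z -> (esum p t e).@[z] = S.[w]) ->
    w \notin F0 -> enumerates f w z -> S.[w] =
    if #|nonvanishing p z| == e then (\prod_(s in nonvanishing p z) (msym s p).@[z])
      * \prod_(s in ~: nonvanishing p z) t.@[fun i => z (s i)] else 0.
  move=> hS h1 h2; rewrite -(hS w z h2) (esum_eval _ (le_e _ _ h1 h2)).
  by case: ifP => // _; congr (_ * _); apply: eq_bigr => s _; rewrite meval_msym.
have [Q hQ] := symmetric_polynomial sf (esum_sym p q e).
have A1 : \prod_(s in nonvanishing p z1) (msym s p).@[z1] != 0.
  by apply/prodf_neq0 => s; rewrite inE.
(* The exceptional [x] are the values of [g / h] at the permutations of [z1] satisfying [P = 0]. *)
exists Q, w1, [seq g (fun i => z1 (s i)) / h (fun i => z1 (s i)) 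
  | s : 'S_d.+1 <- enum (~: nonvanishing p z1)].
exists (#|'S_d.+1| - e)%N; split.
  rewrite (evl _ Q w1 z1 hQ w1F hz1) ce1 eqxx mulf_neq0 //.
  apply/prodf_neq0 => s sN; rewrite hq; apply: hne w1F _ _.
    exact: enumerates_perm.
  exact: vanish.
move=> x; have [t ht] : polyfun (fun z => g z - x * h z).
  apply: polyfunB => //; apply: polyfunM; first exact: polyfun_const.
  by exists q.
have [Qx hQx] := symmetric_polynomial sf (esum_sym p t e).
exists Qx; split.
- rewrite (evl _ Qx w1 z1 hQx w1F hz1) ce1 eqxx => xS.
  rewrite mulf_neq0 //; apply/prodf_neq0 => s sN; rewrite ht subr_eq0.
  apply: contra xS => /eqP E; apply/mapP; exists s; first by rewrite mem_enum.
  rewrite E mulfK //; apply: hne w1F _ _; last exact: vanish.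
  exact: enumerates_perm.
- move=> w wF; have [z hz] := enumerates_exists w sf.
  rewrite (evl _ Q w z hQ wF hz) (evl _ Qx w z hQx wF hz).
  case: eqP => ce; last first.
    exists 0, (~: nonvanishing p z), z; rewrite !mul0r; split => //; first by left.
    exact: vanish.
  exists (\prod_(s in nonvanishing p z) (msym s p).@[z]), (~: nonvanishing p z), z; split => //.
  + by right; rewrite cardsCs setCK ce.
  + exact: vanish.
  + by congr (_ * _); apply: eq_bigr => s _; rewrite hq.
  + by congr (_ * _); apply: eq_bigr => s _; rewrite ht.
move=> w z wF hz Pz; rewrite (evl _ Q w z hQ wF hz) (evl _ Qx w z hQx wF hz).
case: ifP => ce; last by rewrite eqxx.
move=> _ xE.
have hid : (fun i => z ((1%g : 'S_d.+1) i)) =1 z by move=> i; rewrite perm1.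
rewrite [X in _ * X](bigD1 1%g) /=; last by rewrite !inE msym1m hp Pz eqxx.
by rewrite (meval_eq _ hid) ht xE divfK ?subrr ?mul0r ?mulr0 // (hne w z).
Qed.
End FiniteValues.
End RootTuples.

(** * Bounded functions on the curve of root tuples *)

Section BoundedFunctions.
Variable R : realType.
Local Notation C := R[i].
Variables (f : {poly C}) (d : nat).
Hypothesis sf : size f = d.+2.

Lemma nm_prod_le (I : finType) (S : {set I}) (A : C) (g h : I -> C) (B : R) :
  (forall s, s \in S -> nm (g s) <= B * nm (h s)) ->
  nm (A * \prod_(s in S) g s) <= B ^+ #|S| * nm (A * \prod_(s in S) h s).
Proof.
move=> hgh; rewrite !nmM mulrCA ler_wpM2l ?nm_ge0 // !nm_prod -prodr_const -big_split /=.
by apply: ler_prod => s sS; rewrite nm_ge0 hgh.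
Qed.

Lemma avoid (F : seq C) (w0 : C) : exists2 e : R, 0 < e &
  forall w, 0 < nm (w - w0) < e -> w \notin F.
Proof.
have [e e0 he] := gap [seq a - w0 | a <- F]; exists e => // w /andP[h1 h2].
apply/negP => wF; move: h2; rewrite ltNge he //.
  by apply/mapP; exists w.
by rewrite -nm_gt0.
Qed.

Lemma avoid_infty (F : seq C) : exists M : R, forall w, M < nm w -> w \notin F.
Proof.
have [M _ hM] := seq_bound F; exists M => w h; apply/negP => /hM.
by rewrite leNgt h.
Qed.

Lemma outside (F : seq C) : exists w, w \notin F.
Proof.
have [M hM] := avoid_infty F; exists (Complex (`|M| + 1) 0); apply: hM.
rewrite nm_real ger0_norm ?addr_ge0 //.
by have := ler_norm M; lra.
Qed.

(* [g / h] is a function on the (possibly reducible) algebraic curve of root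
   tuples satisfying [P = 0]; being bounded near every point of the compactified
   curve, it is constant on each component. *)
Lemma bounded_finite_values (P g h : ('I_d.+1 -> C) -> C) (F0 : seq C) :
  polyfun P -> polyfun g -> polyfun h ->
  (forall w z, w \notin F0 -> enumerates f w z -> P z = 0 -> h z != 0) ->
  (forall w0, exists e K : R, 0 < e /\ forall w z, 0 < nm (w - w0) < e ->
     w \notin F0 -> enumerates f w z -> P z = 0 -> nm (g z) <= K * nm (h z)) ->
  (exists M K : R, forall w z, M < nm w ->
     w \notin F0 -> enumerates f w z -> P z = 0 -> nm (g z) <= K * nm (h z)) ->
  exists S F : seq C, forall w z, w \notin F -> enumerates f w z -> P z = 0 ->
    g z / h z \in S.
Proof.
move=> pP pg ph hne hloc hinf.
have [Q [w1 [S [k [Qw1 hQ]]]]] := norm_pair sf pP pg ph (outside F0) hne.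
have Q0 : Q != 0 by apply: contraNneq Qw1 => ->; rewrite horner0.
have [F1 hF1] := polyroots_seq Q0.
exists S, (F0 ++ F1) => w z; rewrite mem_cat negb_or => /andP[wF0 wF1] hz Pz.
(* For this [x], [Qx] vanishes at [w] while [Q] does not, so that proportionality of [Qx] to [Q]
   forces [Qx = 0]; by [hS] this puts [x] in [S]. *)
have [Qx [hS hA h0]] := hQ (g z / h z).
set x := g z / h z in hS hA h0 *.
(* Each factor [g - x * h] is at most [K + nm x] times [h]. The number of factors is [k] unless the
   common factor [A] is zero, so the exponent does not depend on [w']. *)
have bnd w' (K : R) : w' \notin F0 ->
    (forall z, enumerates f w' z -> P z = 0 -> nm (g z) <= K * nm (h z)) ->
    nm Qx.[w'] <= (K + nm x) ^+ k * nm Q.[w'].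
  move=> w'F hK; have [A [D [z' [hk hz' PD -> ->]]]] := hA w' w'F.
  case: hk => [->|<-]; first by rewrite !mul0r nm0 mulr0.
  apply: nm_prod_le => s sD.
  apply: (le_trans (nmB _ _)); rewrite nmM mulrDl lerD2r.
  by apply: hK; [exact: enumerates_perm|exact: PD].
have [c hc] : exists c, Qx = c *: Q.
  have [M [K hMK]] := hinf; have [M' hM'] := avoid_infty F0.
  apply: (@poly_ratio_const R Qx Q (Num.max M M') ((K + nm x) ^+ k) Q0).
    move=> w0; have [e' [K' [e'0 he']]] := hloc w0; have [e'' e''0 he''] := avoid F0 w0.
    exists (Num.min e' e''), ((K' + nm x) ^+ k); split.
      by rewrite lt_min e'0.
    move=> w'; rewrite lt_min => /and3P[h1 h2 h3].
    have w'F : w' \notin F0 by apply: he''; rewrite h1.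
    by apply: bnd => // z'; apply: he'; rewrite ?h1.
  move=> w'; rewrite gt_max => /andP[h1 h2]; have w'F := hM' _ h2.
  by apply: bnd => // z'; apply: hMK.
have Qw : Q.[w] != 0 by apply: contra wF1 => /eqP /hF1.
have Qxw := h0 w z wF0 hz Pz Qw erefl.
have c0 : c = 0.
  by move: Qxw; rewrite hc hornerZ => /eqP; rewrite mulf_eq0 (negPf Qw) orbF => /eqP.
apply: contraT => /hS; rewrite hc c0 scale0r horner0 eqxx //.
Qed.
End BoundedFunctions.

(** * Directions of the roots at infinity *)

Section RootGeometry.
Variable R : realType.
Local Notation C := R[i].
Implicit Types (x y z u v w k t a b : C) (p q f : {poly C}).

Lemma mul_conjc z : z * (z^*)%C = Complex (nm z ^+ 2) 0.
Proof.
rewrite -sqnorm_nm; case: z => a b; rewrite /= .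
by apply/eqP; rewrite eq_complex /= !mulrN opprK !expr2 eqxx /= mulrC addNr.
Qed.

Lemma conjc_unit z : nm z = 1 -> (z^*)%C = z^-1.
Proof.
move=> z1; have z0 : z != 0 by rewrite -nm_gt0 z1.
by apply: (mulfI z0); rewrite mulfV // mul_conjc z1 expr1n.
Qed.

Lemma unit_neq0 z : nm z = 1 -> z != 0.
Proof. by move=> z1; rewrite -nm_gt0 z1. Qed.

(* A triangle inscribed in the unit circle is determined by its shape up to a
   rotation. *)
Lemma unit_triangle k : exists q : C, forall z w, nm z = 1 -> nm w = 1 -> z != 1 -> w != 1 ->
  k != 1 -> 1 - z = k * (1 - w) -> z = q.
Proof.
(* Conjugation inverts unit complex numbers; comparing the relation with its conjugate gives
   [z = k / k' * w], where [k'] is the conjugate of [k]. The relation, now linear in [w], determines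
   [w]. *)
exists (k / (k^*)%C * ((k - 1) / (k - k / (k^*)%C))) => z w z1 w1 zn wn k1 E.
have z0 := unit_neq0 z1; have w0 := unit_neq0 w1.
have k0 : k != 0 by apply: contraNneq zn => k0; move/eqP: E; rewrite k0 mul0r subr_eq0 eq_sym.
have kc0 : (k^*)%C != 0 by rewrite conjc_eq0.
have E2 : 1 - z^-1 = (k^*)%C * (1 - w^-1).
  by rewrite -(conjc_unit z1) -(conjc_unit w1) -[1]conjc1 -!rmorphB -rmorphM /= E.
have zE : z = k / (k^*)%C * w.
  have : (1 - w) * (k * w) = (1 - w) * ((k^*)%C * z).
    have -> : (1 - w) * (k * w) = (k * (1 - w)) * w by ring.
    rewrite -E; have -> : (1 - z) * w = - (1 - z^-1) * (z * w) by field.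
    by rewrite E2; field.
  have w10 : 1 - w != 0 by rewrite subr_eq0 eq_sym.
  by move/(mulfI w10) => h; rewrite mulrAC h mulrC mulKf.
suff wE : w = (k - 1) / (k - k / (k^*)%C) by rewrite {1}zE {1}wE.
have h : w * (k - k / (k^*)%C) = k - 1.
  rewrite (_ : w * _ = k - k * (1 - w) - k / (k^*)%C * w); last by ring.
  by rewrite -E -zE; ring.
apply: (canRL (mulfK _)) => //.
by apply: contraNneq k1 => h0; move/eqP: h; rewrite h0 mulr0 eq_sym subr_eq0.
Qed.

(* A line meets the unit circle in at most two points. *)
Lemma unit_chord k z w : nm z = 1 -> nm w = 1 -> z != 1 -> w != 1 -> (k^*)%C = k ->
  k != 0 -> z - w != - k * (1 - z).
Proof.
move=> z1 w1 zn wn kr k0; apply/eqP => E.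
have z0 := unit_neq0 z1; have w0 := unit_neq0 w1.
have E2 : z^-1 - w^-1 = - k * (1 - z^-1).
  rewrite -(conjc_unit z1) -(conjc_unit w1) -[1]conjc1 -[in RHS]kr.
  by rewrite -!rmorphB -rmorphN -rmorphM /= E.
have wE : w = z + k * (1 - z) by rewrite -[w](subKr z) E; ring.
have wE2 : w^-1 = z^-1 + k * (1 - z^-1) by rewrite -[w^-1](subKr z^-1) E2; ring.
have : k * (1 - z) * (1 - z^-1) * (k - 1) = 0.
  have := mulfV w0; rewrite {1}wE wE2 => h.
  have -> : k * (1 - z) * (1 - z^-1) * (k - 1) = (z + k * (1 - z)) * (z^-1 + k * (1 - z^-1)) - 1.
    by field.
  by rewrite h subrr.
move/eqP; rewrite !mulf_eq0 (negPf k0) !subr_eq0 /= => /orP[/orP[]|].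
- by rewrite eq_sym (negPf zn).
- by rewrite -{1}invr1 (inj_eq invr_inj) eq_sym (negPf zn).
by move=> /eqP k1; move: wn; rewrite wE k1 mul1r addrC subrK eqxx.
Qed.

(** On the unit circle conjugation is inversion, which preserves cross-ratios. *)
Lemma unit_cross_ratio_real k z w t : nm z = 1 -> nm w = 1 -> nm t = 1 -> w != 1 -> z != t ->
  (1 - z) * (w - t) = k * ((1 - w) * (z - t)) -> (k^*)%C = k.
Proof.
move=> z1 w1 t1 wn zt E.
have z0 := unit_neq0 z1; have w0 := unit_neq0 w1; have t0 := unit_neq0 t1.
have E2 : (1 - z^-1) * (w^-1 - t^-1) = (k^*)%C * ((1 - w^-1) * (z^-1 - t^-1)).
  rewrite -(conjc_unit z1) -(conjc_unit w1) -(conjc_unit t1) -[1]conjc1.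
  by rewrite -!rmorphB -!rmorphM /= E.
have nz : (1 - w) * (z - t) != 0 by rewrite mulf_neq0 // subr_eq0 // eq_sym.
apply: (mulIf nz); rewrite -E.
have -> : (1 - z) * (w - t) = (1 - z^-1) * (w^-1 - t^-1) * (z * w * t).
  by field; rewrite ?z0 ?w0 ?t0.
by rewrite E2; field; rewrite ?z0 ?w0 ?t0.
Qed.

Lemma simple_values f d : size f = d.+2 -> exists F : seq C, forall w (z : 'I_d.+1 -> C),
  w \notin F -> enumerates f w z -> injective z.
Proof.
move=> sf; have f'0 : f^`() != 0.
  apply/eqP => /(congr1 (fun p : {poly C} => p`_d)); rewrite coef_deriv coef0 => /eqP.
  rewrite mulrn_eq0 /= => /eqP h.
  by have := lead_gt0 sf; rewrite lead_coefE sf h nm0 ltxx.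
have [F hF] := polyroots_seq f'0; exists [seq f.[r] | r <- F] => w z wF hz i j zij.
apply/eqP; apply: contraNT wF => ij; apply/mapP; exists (z i); last first.
  by rewrite (enumerates_root i hz).
apply: hF; have := congr1 (fun p : {poly C} => p^`().[z i]) hz.
rewrite derivB derivC subr0 => ->.
rewrite (bigD1 i) //= (bigD1 j) //=; last by rewrite eq_sym.
rewrite -zij derivZ hornerZ !derivM derivXsubC !hornerE subrr.
by rewrite !(mul0r, mulr0, addr0, mul1r, add0r).
Qed.

(** Puts a few given points of a fibre at the first positions of a root tuple, so that results about
    tuples apply to them. *)
Lemma extend_roots f d w (s : seq C) : size f = d.+2 -> uniq s ->
  (forall z, z \in s -> f.[z] = w) ->
  (size s <= d.+1)%N /\ exists2 z : 'I_d.+1 -> C, enumerates f w z &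
    forall i : 'I_d.+1, (i < size s)%N -> z i = s`_i.
Proof.
move=> sf us hs.
have sw : (size (- w%:P) < size f)%N.
  by rewrite sf size_polyN; apply: leq_ltn_trans (size_polyC_leq1 _) _.
have lf : lead_coef f != 0 by rewrite lead_coef_eq0 -size_poly_eq0 sf.
have [q hq] : exists q, f - w%:P = q * \prod_(a <- s) ('X - a%:P).
  apply: uniq_roots_prod_XsubC; last by rewrite uniq_rootsE.
  by apply/allP => z /hs h; rewrite rootE !hornerE h subrr.
have [r hr] := closed_field_poly_normal q.
have hsr : f - w%:P = lead_coef f *: \prod_(a <- s ++ r) ('X - a%:P).
  rewrite big_cat /= mulrC scalerAl.
  have -> : lead_coef f = lead_coef q.
    rewrite -(lead_coefDl sw) hq lead_coef_Mmonic //; exact: monic_prod_XsubC.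
  by rewrite -hr -hq.
have ssr : size (s ++ r) = d.+1.
  have := size_polyDl sw; rewrite hsr sf size_scale ?size_prod_XsubC //.
  by case.
split; first by rewrite -ssr size_cat leq_addr.
move/eqP: (ssr) => sz; exists (tnth (Tuple sz)).
  rewrite /enumerates hsr; congr (_ *: _).
  by rewrite -[s ++ r]/(tval (Tuple sz)) [LHS]big_tuple.
by move=> i hi; rewrite (tnth_nth 0) /= nth_cat hi.
Qed.

Lemma root_large f (M : R) : exists M' : R, forall z, M' < nm f.[z] -> M < nm z.
Proof.
have [K _ hK] := horner_bound f M; exists K => z h.
by rewrite ltNge; apply/negP => /hK; rewrite leNgt h.
Qed.

Lemma root_bounded f d (K : R) : size f = d.+2 ->
  exists2 M : R, 0 <= M & forall z, nm f.[z] <= K -> nm z <= M.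
Proof.
move=> sf; have [M hM] := horner_proper K sf; exists `|M| => // z h.
rewrite leNgt; apply/negP => h2.
by have := hM z (le_lt_trans (ler_norm M) h2); rewrite ltNge h.
Qed.

Lemma unity_seq n : exists U : seq C, forall z, z ^+ n.+1 = 1 -> z \in U.
Proof.
have [s _ hs] := unity_roots R n; exists (1 :: s) => z zn.
by rewrite -root_prod_XsubC -hs rootE !hornerE zn subrr.
Qed.

(** On roots of unity [Phi] has finitely many values, so a relation between limiting directions is
    exact once it holds approximately. *)
Lemma unity_gap n (Phi : C -> C -> C -> C) : exists2 g : R, 0 < g & forall x y z,
  x ^+ n.+1 = 1 -> y ^+ n.+1 = 1 -> z ^+ n.+1 = 1 -> nm (Phi x y z) < g -> Phi x y z = 0.
Proof.
have [U hU] := unity_seq n.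
have [g g0 hg] := gap [seq Phi c.1 c.2 z | c <- [seq (x, y) | x <- U, y <- U], z <- U].
exists g => // x y z /hU hx /hU hy /hU hz; apply: contraTeq => h.
rewrite -leNgt; apply: hg => //; apply/allpairsP; exists ((x, y), z); split=> //=.
by apply/allpairsP; exists (x, y).
Qed.

(** Divided by [z ord0], the roots approach distinct roots of unity [t i]. The absolute bound [K] is
    chosen before [e]: it serves to bound functions, the relative error [e] to obtain relations
    between directions. *)
Lemma directions f d : size f = d.+3 -> exists2 K : R, 0 <= K &
  forall e : R, 0 < e -> exists M : R, forall w (z : 'I_d.+2 -> C), M < nm w ->
    enumerates f w z -> injective z -> exists t : 'I_d.+2 -> C,
    [/\ injective t, t ord0 = 1, forall i, t i ^+ d.+2 = 1,
        forall i, nm (z i / z ord0 - t i) <= e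
      & [/\ z ord0 != 0, (nm (z ord0))^-1 <= e & forall i, nm (z i - t i * z ord0) <= K]].
Proof.
move=> sf; have [K [M0 [K0 M00 hK]]] := pair_infty sf.
have [g g0 hg] := unity_gap d.+1 (fun x _ _ => 1 - x).
exists K => // e e0.
(* The summands provide in turn for [pair_infty], a large [z ord0], relative error [e], and
   distinctness of the [t i]. *)
have [M hM] := root_large f (M0 + 1 + 1 / e + K / e + 3 * K / g).
exists M => w z Mw hz iz.
have [e1 e2 e3] : [/\ 0 <= 1 / e, 0 <= K / e & 0 <= 3 * K / g].
  by rewrite !divr_ge0 ?mulr_ge0 // ltW.
have zl i : M0 + 1 + 1 / e + K / e + 3 * K / g < nm (z i).
  by apply: hM; rewrite (enumerates_root i hz).
have z0 : 0 < nm (z ord0) by apply: le_lt_trans (zl ord0); lra.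
have ex i : exists t, [/\ t ^+ d.+2 = 1, nm (z i - t * z ord0) <= K & i = ord0 -> t = 1].
  have [->|i0] := eqVneq i ord0.
    by exists 1; rewrite expr1n mul1r subrr nm0.
  have zi : z ord0 != z i by apply: contraNneq i0 => /iz ->.
  have [|||t [t1 _ t2]] := hK _ _ zi; rewrite ?(enumerates_root _ hz) //.
  - by have := zl ord0; lra.
  - by have := zl i; lra.
  by exists t; split => // i00; rewrite i00 eqxx in i0.
pose t i := projT1 (cid (ex i)).
have tP i : [/\ t i ^+ d.+2 = 1, nm (z i - t i * z ord0) <= K & i = ord0 -> t i = 1].
  by rewrite /t; case: (cid (ex i)).
exists t; split.
(* If [t i = t j], then [z i] and [z j] are within [2 * K] of each other, yet [z j] is also within
   [K] of [u * z i] with [u != 1]; this bounds [z i]. *)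
- move=> i j tij; apply/eqP; apply: contraT => ij.
  have zij : z i != z j by apply: contraNneq ij => /iz ->.
  have [|||u [u1 u2 u3]] := hK _ _ zij; rewrite ?(enumerates_root _ hz) //.
  + by have := zl i; lra.
  + by have := zl j; lra.
  have [_ h1 _] := tP i; have [_ h2 _] := tP j.
  have h3 : nm ((1 - u) * z i) <= 3 * K.
    rewrite (_ : (1 - u) * z i = (z i - t i * z ord0) - (z j - t i * z ord0) + (z j - u * z i)).
      apply: (le_trans (nmD _ _)); have := nmB (z i - t i * z ord0) (z j - t i * z ord0).
      by rewrite -tij in h2; lra.
    by ring.
  have h4 : nm (1 - u) < g.
    have zi : 3 * K / g < nm (z i) by have := zl i; lra.
    rewrite ltr_pdivrMr // in zi.
    rewrite nmM in h3; rewrite ltNge; apply/negP => h4.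
    by have := nm_ge0 (z i); nra.
  by move: (hg u u u u1 u1 u1 h4) => /eqP; rewrite subr_eq0 eq_sym (negPf u2).
- by have [_ _ ->] := tP ord0.
- by move=> i; have [] := tP i.
- move=> i; have [_ h _] := tP i.
  have z0' : z ord0 != 0 by rewrite -nm_gt0.
  rewrite (_ : _ - _ = (z i - t i * z ord0) / z ord0); last by field.
  rewrite nmM nmV ler_pdivrMr //; apply: (le_trans h).
  rewrite mulrC -ler_pdivrMr //; have := zl ord0; lra.
split; first by rewrite -nm_gt0.
  rewrite -[e]invrK lef_pV2 ?posrE ?invr_gt0 //.
  by have := zl ord0; rewrite !mul1r; lra.
by move=> i; have [] := tP i.
Qed.

Lemma nm_sub1 x y (e : R) : nm (x - y) <= e -> nm ((1 - x) - (1 - y)) <= e.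
Proof. by rewrite (_ : _ - (1 - y) = - (x - y)) ?nmN //; ring. Qed.

Lemma nm_sub2 x y z t (e : R) : nm (x - y) <= e -> nm (z - t) <= e ->
  nm ((x - z) - (y - t)) <= 2 * e.
Proof.
move=> h1 h2; rewrite (_ : _ - (y - t) = (x - y) - (z - t)); last by ring.
by have := nmB (x - y) (z - t); lra.
Qed.

Lemma nm_diff_units x y : nm x = 1 -> nm y = 1 -> nm (x - y) <= 2.
Proof. by move=> h1 h2; have := nmB x y; lra. Qed.

(** Passage to the limit in a relation between products. The factor 5 is [3 + 2]: a number within 1
    of one of modulus at most 2 has modulus at most 3. *)
Lemma close_products k a b a' b' x y x' y' (e : R) :
  nm (a - a') <= e -> nm (b - b') <= e -> nm (x - x') <= e -> nm (y - y') <= e ->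
  nm a' <= 2 -> nm b' <= 2 -> nm x' <= 2 -> nm y' <= 2 -> e <= 1 ->
  a * b = k * (x * y) -> nm (a' * b' - k * (x' * y')) <= e * (5 * (1 + nm k)).
Proof.
move=> ha hb hx hy ha' hb' hx' hy' e1 E.
have aux c c' g g' : nm (c - c') <= e -> nm (g - g') <= e -> nm c' <= 2 -> nm g' <= 2 ->
    nm (c' * g' - c * g) <= 5 * e.
  move=> hc hg hc' hg'.
  rewrite (_ : _ - _ = - ((c - c') * g + c' * (g - g'))); last by ring.
  rewrite nmN; apply: (le_trans (nmD _ _)); rewrite !nmM.
  have h : nm g <= 3 by have := nm_ler g g'; lra.
  have := nm_ge0 (c - c'); have := nm_ge0 (g - g'); have := nm_ge0 c'; have := nm_ge0 g.
  by nra.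
rewrite (_ : _ - _ = (a' * b' - a * b) - k * (x' * y' - x * y)); last first.
  by rewrite E; ring.
apply: (le_trans (nmB _ _)); rewrite nmM.
have := aux _ _ _ _ ha hb ha' hb'; have := aux _ _ _ _ hx hy hx' hy'.
by have := nm_ge0 k; nra.
Qed.

Lemma pigeonhole (S : seq C) (Q : C -> R -> Prop) :
  (forall s e e', e <= e' -> Q s e -> Q s e') ->
  (forall e, 0 < e -> exists2 s, s \in S & Q s e) ->
  exists s, forall e, 0 < e -> Q s e.
Proof.
move=> mono; elim: S => [|a S IH] h; first by have [] := h 1 ltr01.
have [ha|/existsNP[e1 /not_implyP[e10 hn]]] := pselect (forall e, 0 < e -> Q a e).
  by exists a.
apply: IH => e e0.
have [|s] := h (Num.min e e1); first by rewrite lt_min e0.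
rewrite inE => /orP[/eqP->|sS] hs.
  by case: hn; apply: mono hs; rewrite ge_min lexx orbT.
by exists s => //; apply: mono hs; rewrite ge_min lexx.
Qed.

Lemma poly_eq0_near p (a : C) :
  (forall e : R, 0 < e -> exists z, [/\ nm (z - a) < e, z != a & p.[z] = 0]) -> p = 0.
Proof.
move=> h; apply/eqP; apply: contraT => /polyroots_seq[F hF].
have [e e0 he] := avoid F a; have [z [h1 h2 h3]] := h e e0.
by have := he z; rewrite nm_gt0 subr_eq0 h2 h1 (hF z h3) => /(_ isT).
Qed.

Lemma small_eq x y (K : R) : (forall e : R, 0 < e -> nm (x - y) <= K * e) -> x = y.
Proof.
move=> h; apply/eqP; rewrite -subr_eq0 -nm_eq0 eq_le nm_ge0 andbT leNgt; apply/negP => h0.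
have K0 : 0 < `|K| + 1 by rewrite ltr_wpDl.
have := h (nm (x - y) / (`|K| + 1) / 2).
rewrite !divr_gt0 // => /(_ isT); rewrite leNgt => /negP; apply.
apply: le_lt_trans (ler_wpM2r _ (ler_norm K)) _; first by rewrite !divr_ge0 // ltW.
rewrite mulrA ltr_pdivrMr // mulrA ltr_pdivrMr //.
by have := normr_ge0 K; nra.
Qed.
End RootGeometry.

(** * Three moving roots and a fixed point *)

Section ThreeRoots.
Variable R : realType.
Local Notation C := R[i].
Implicit Types (x y z u v w k t a c : C) (p f : {poly C}).

(* [L] is the linear form vanishing at the fixed point of the configuration:
   constant for the point at infinity. *)
Definition point_form (L : C -> C) : Prop :=
  L = (fun=> 1) \/ exists c, L = (fun z => z - c).

(** At infinity the relation becomes [1 - t1 = k * (1 - t2)] when [L] is constant, and the same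
    relation between the inverses of [t1] and [t2] when [L] vanishes at [c]. By [unit_triangle] it
    determines [t1], respectively its inverse. *)
Lemma triangle_direction f d L k (i1 i2 : 'I_d.+2) :
  size f = d.+3 -> point_form L -> k != 1 -> i1 != ord0 -> i2 != ord0 ->
  exists (q : C) (K M : R), forall w (z : 'I_d.+2 -> C), M < nm w ->
    enumerates f w z -> injective z ->
    (z ord0 - z i1) * L (z i2) = k * ((z ord0 - z i2) * L (z i1)) ->
    nm (z i1 - q * z ord0) <= K.
Proof.
move=> sf hL k1 i10 i20.
have [K K0 hK] := directions sf; have [q hq] := unit_triangle k.
have k5 : 0 < 5 * (1 + nm k) by have := nm_ge0 k; lra.
have tn (t : 'I_d.+2 -> C) i : injective t -> t ord0 = 1 -> i != ord0 -> t i != 1.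
  by move=> it <- i0; apply: contraNneq i0 => /it ->.
have n2 z : nm z = 1 -> nm (1 - z) <= 2 by apply: nm_diff_units; rewrite nm1.
case: hL => [->|[c ->]].
  have [g g0 hg] := unity_gap d.+1 (fun x y _ => (1 - x) * 1 - k * ((1 - y) * 1)).
  pose e := Num.min 1 (g / (5 * (1 + nm k)) / 2).
  have e0 : 0 < e by rewrite lt_min ltr01 !divr_gt0.
  have e1 : e <= 1 by rewrite ge_min lexx.
  have eg : e * (5 * (1 + nm k)) < g.
    have : e <= g / (5 * (1 + nm k)) / 2 by rewrite ge_min lexx orbT.
    by rewrite -mulrA -invfM ler_pdivlMr ?mulr_gt0 //; nra.
  have [M hM] := hK e e0; exists q, K, M => w z wM hz iz rel.
  have [t [it t0 tU tc [z0 z0e tK]]] := hM w z wM hz iz.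
  have tn1 i : nm (t i) = 1 by exact: (@nm_unit _ _ d.+2).
  suff <- : t i1 = q by exact: tK.
  apply: (hq (t i1) (t i2)); rewrite ?tn //.
  apply/eqP; rewrite -subr_eq0 -[X in X - _]mulr1 -[X in _ - _ * X]mulr1.
  rewrite (hg (t i1) (t i2) 1) ?expr1n //; apply: le_lt_trans eg.
  apply: (@close_products _ _ (1 - z i1 / z ord0) 1 _ _ (1 - z i2 / z ord0) 1).
  - exact: nm_sub1.
  - by rewrite subrr nm0 ltW.
  - exact: nm_sub1.
  - by rewrite subrr nm0 ltW.
  - exact: n2.
  - by rewrite nm1 ler1n.
  - exact: n2.
  - by rewrite nm1 ler1n.
  - exact: e1.
  rewrite (_ : 1 - z i1 / z ord0 = (z ord0 - z i1) / z ord0); last by field.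
  rewrite (_ : 1 - z i2 / z ord0 = (z ord0 - z i2) / z ord0); last by field.
  rewrite /= !mulr1 in rel; rewrite rel; ring.
have [g g0 hg] := unity_gap d.+1 (fun x y _ => (1 - x) * y - k * ((1 - y) * x)).
have c0 : 0 < 1 + nm c by have := nm_ge0 c; lra.
pose e := Num.min (1 / (1 + nm c)) (g / (5 * (1 + nm k)) / 2 / (1 + nm c)).
have e0 : 0 < e by rewrite lt_min !divr_gt0.
(* Replacing [z i] by [z i - c] adds [c / z ord0] to the relative error, at most [nm c * e]. *)
pose e' := (1 + nm c) * e.
have ee' : e <= e' by rewrite /e' mulrDl mul1r lerDl mulr_ge0 ?nm_ge0 ?ltW.
have e1 : e' <= 1 by rewrite /e' mulrC -ler_pdivlMr // ge_min lexx.
have eg : e' * (5 * (1 + nm k)) < g.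
  have : e' <= g / (5 * (1 + nm k)) / 2 by rewrite /e' mulrC -ler_pdivlMr // ge_min lexx orbT.
  by rewrite -mulrA -invfM ler_pdivlMr ?mulr_gt0 //; nra.
have [M hM] := hK e e0; exists q^-1, K, M => w z wM hz iz rel.
have [t [it t0 tU tc [z0 z0e tK]]] := hM w z wM hz iz.
have tn1 i : nm (t i) = 1 by exact: (@nm_unit _ _ d.+2).
have tne i : t i != 0 by exact: unit_neq0.
have shift i : nm (z i / z ord0 - c / z ord0 - t i) <= e'.
  rewrite addrAC; apply: (le_trans (nmB _ _)); rewrite nmM nmV /e' mulrDl mul1r lerD //.
  by rewrite ler_wpM2l ?nm_ge0.
have le' i : nm ((1 - z i / z ord0) - (1 - t i)) <= e'.
  by apply: nm_sub1; apply: le_trans ee'.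
suff <- : (t i1)^-1 = q by rewrite invrK; exact: tK.
apply: (hq (t i1)^-1 (t i2)^-1); rewrite ?nmV ?tn1 ?invr1 ?invr_eq1 ?tn //.
have : (1 - t i1) * t i2 - k * ((1 - t i2) * t i1) = 0.
  rewrite (hg (t i1) (t i2) 1) ?expr1n //; apply: le_lt_trans eg.
  apply: (@close_products _ _ (1 - z i1 / z ord0) (z i2 / z ord0 - c / z ord0) _ _
    (1 - z i2 / z ord0) (z i1 / z ord0 - c / z ord0)); rewrite ?n2 ?tn1 ?ler1n //.
  have -> : (1 - z i1 / z ord0) * (z i2 / z ord0 - c / z ord0) =
      (z ord0 - z i1) * (z i2 - c) / z ord0 ^+ 2 by field.
  by rewrite rel; field.
move/eqP; rewrite subr_eq0 => /eqP h.
have -> : 1 - (t i1)^-1 = - ((1 - t i1) * t i2) / (t i1 * t i2) by field; rewrite ?tne.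
by rewrite h; field; rewrite ?tne.
Qed.

(** Roots are bounded over bounded [w], and [triangle_direction] controls infinity, so [z2 - q * z1]
    takes finitely many values over all but finitely many [w]. One of them, [s], occurs arbitrarily
    near [a], so that [q * z + s] preserves [f] at infinitely many points [z]. *)
Lemma affine_symmetry3 f d L k a x : size f = d.+3 -> point_form L -> k != 1 ->
  (forall e : R, 0 < e -> exists z1 z2 z3 : C,
     [/\ uniq [:: z1; z2; z3], f.[z2] = f.[z1] /\ f.[z3] = f.[z1], f.[z1] != f.[a],
         nm (z1 - a) < e /\ nm (z2 - x) < e
       & (z1 - z2) * L z3 = k * ((z1 - z3) * L z2)]) ->
  exists q s : C, f \Po (q *: 'X + s%:P) = f /\ x = q * a + s.
Proof.
move=> sf hL k1 H.
have inS z1 z2 z3 : f.[z2] = f.[z1] /\ f.[z3] = f.[z1] ->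
    forall z, z \in [:: z1; z2; z3] -> f.[z] = f.[z1].
  by move=> [h2 h3] z; rewrite !inE => /or3P[]/eqP->.
case: d sf => [|d] sf.
  have [z1 [z2 [z3 [uz fz _ _ _]]]] := H 1 ltr01.
  by have [] := extend_roots sf uz (inS _ _ _ fz).
pose i1 : 'I_d.+3 := Ordinal (isT : (1 < d.+3)%N).
pose i2 : 'I_d.+3 := Ordinal (isT : (2 < d.+3)%N).
have [F0 hF0] := simple_values sf.
have [q [K [M hq]]] := triangle_direction sf hL k1 (isT : i1 != ord0) (isT : i2 != ord0).
pose P (z : 'I_d.+3 -> C) := (z ord0 - z i1) * L (z i2) - k * ((z ord0 - z i2) * L (z i1)).
pose g (z : 'I_d.+3 -> C) := z i1 - q * z ord0.
have pL i : polyfun (fun z : 'I_d.+3 -> C => L (z i)).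
  case: hL => [->|[c ->]]; first exact: polyfun_const.
  by apply: polyfunB; [exact: polyfun_var|exact: polyfun_const].
have pP : polyfun P.
  apply: polyfunB; first by apply: polyfunM => //; apply: polyfunB; exact: polyfun_var.
  apply: polyfunM; first exact: polyfun_const.
  by apply: polyfunM => //; apply: polyfunB; exact: polyfun_var.
have pg : polyfun g.
  apply: polyfunB; first exact: polyfun_var.
  by apply: polyfunM; [exact: polyfun_const|exact: polyfun_var].
have [|w0||S [F hSF]] := bounded_finite_values sf pP pg (polyfun_const _ 1) (F0 := F0).
- by move=> *; rewrite oner_neq0.
- have [B B0 hB] := root_bounded (nm w0 + 1) sf.
  exists 1, (B + nm q * B); split => // w z /andP[_ ww0] _ hz _.
  have zB i : nm (z i) <= B.
    apply: hB; rewrite (enumerates_root i hz).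
    by have := nm_ler w w0; lra.
  rewrite nm1 mulr1; apply: (le_trans (nmB _ _)); rewrite nmM lerD // ler_wpM2l ?nm_ge0 //.
- exists M, K => w z wM wF hz /eqP; rewrite subr_eq0 => /eqP rel.
  by rewrite nm1 mulr1; apply: hq wM hz (hF0 _ _ wF hz) rel.
have [e0 e00 he0] := avoid (F0 ++ F) f.[a].
have [e1 e10 he1] := horner_cont f a e00.
pose Q s e := exists z1 z2 : C, [/\ nm (z1 - a) < e, nm (z2 - x) < e, z1 != a,
  f.[z2] = f.[z1] & z2 = q * z1 + s].
have [|e e_gt0|s hs] := @pigeonhole R S Q.
- move=> s e e' ee' [z1 [z2 [h1 h2 h3 h4 h5]]]; exists z1, z2; split => //.
    exact: lt_le_trans h1 ee'.
  exact: lt_le_trans h2 ee'.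
- have [|z1 [z2 [z3 [uz fz fa []]]]] := H (Num.min e e1); first by rewrite lt_min e_gt0.
  rewrite !lt_min => /andP[za zae1] /andP[zx _] rel.
  have [_ [z hz zE]] := extend_roots sf uz (inS _ _ _ fz).
  have E0 : z ord0 = z1 by rewrite zE.
  have E1 : z i1 = z2 by rewrite zE.
  have E2 : z i2 = z3 by rewrite zE.
  have wF : f.[z1] \notin F0 ++ F by apply: he0; rewrite he1 // nm_gt0 subr_eq0 fa.
  rewrite mem_cat negb_or in wF; case/andP: wF => wF0 wF.
  exists (z2 - q * z1).
    have := hSF _ _ wF hz; rewrite /P /g E0 E1 E2 rel subrr divr1; exact.
  exists z1, z2; split => //; first by apply: contraNneq fa => ->.
    by case: fz.
  by rewrite addrCA subrr addr0.
exists q, s; split.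
  apply/eqP; rewrite -subr_eq0; apply/eqP/(@poly_eq0_near R _ a) => e e_gt0.
  have [z1 [z2 [h1 _ h3 h4 h5]]] := hs e e_gt0; exists z1; split => //.
  by rewrite hornerD hornerN horner_comp !hornerE -h5 h4 subrr.
apply: (@small_eq R _ _ (1 + nm q)) => e e_gt0.
have [z1 [z2 [h1 h2 _ _ h5]]] := hs e e_gt0.
rewrite (_ : x - _ = - (z2 - x) + q * (z1 - a)); last by rewrite h5; ring.
apply: (le_trans (nmD _ _)); rewrite nmN nmM.
by have := nm_ge0 q; nra.
Qed.
End ThreeRoots.

(** * Four moving roots *)

Section FourRoots.
Variable R : realType.
Local Notation C := R[i].
Implicit Types (x y z u v w k t a c : C) (p f : {poly C}).

(** The difference of [z0] and another root near [p] is comparable to [z0 - p], which settles the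
    case of [z1] near [p]. When [z1] is far, the relation is contradictory: if [z3] is far too, its
    left side is bounded below and its right side small; if [z3] is near, the directions [1], [t2],
    [t3] of the three merging roots satisfy [t2 - t3 = - k * (1 - t2)], against [unit_chord] as [k]
    is real. *)
Lemma cross_ratio_local f d k (p : C) (g B : R) : size f = d.+2 -> (k^*)%C = k -> k != 0 ->
  0 < g -> 0 <= B -> exists r K : R, 0 < r /\ forall z0 z1 z2 z3 : C,
    uniq [:: z0; z1; z2; z3] -> f.[z1] = f.[z0] -> f.[z2] = f.[z0] -> f.[z3] = f.[z0] ->
    nm z1 <= B -> nm z3 <= B -> nm (z0 - p) < r -> nm (z2 - p) < r ->
    nm (z1 - p) < r \/ g <= nm (z1 - p) -> nm (z3 - p) < r \/ g <= nm (z3 - p) ->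
    (z0 - z1) * (z2 - z3) = k * ((z0 - z2) * (z1 - z3)) ->
    nm (z0 - z1) <= K * nm (z0 - z2).
Proof.
move=> sf kr k0 g0 B0; have [n hn] := pair_local p sf.
have [G G0 hG] := unity_gap n (fun x _ _ => 1 - x : C).
have [G2 G20 hG2] := unity_gap n (fun x y _ => (x - y) + k * (1 - x) : C).
have kap := nm_ge0 k; have [kp kpE] : exists kp, nm k = kp by exists (nm k).
rewrite kpE in kap.
have kB : 0 <= kp * B by rewrite mulr_ge0.
pose e := Num.min 1 (Num.min (G / 2) (G2 / (3 * (2 + kp)))).
have k2 : 0 < 3 * (2 + kp) by lra.
have e0 : 0 < e by rewrite !lt_min ltr01 !divr_gt0.
have [e1 e2 e3] : [/\ e <= 1, e <= G / 2 & e * (3 * (2 + kp)) <= G2].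
  by split; rewrite -?(ler_pdivlMr _ _ k2) /e !ge_min lexx ?orbT.
clearbody e; have [r r0 hr] := hn e e0.
have kB' : 0 < 16 * (kp * B + 1) by lra.
have k36 : 0 < 36 * (kp + 1) by lra.
(* The last two bounds exclude a far [z1] when [z3] is respectively far and near. *)
pose rho := Num.min r (Num.min (g / 2)
  (Num.min (g ^+ 2 / (16 * (kp * B + 1))) (G2 * g / (36 * (kp + 1))))).
have rho0 : 0 < rho.
  by rewrite !lt_min r0 !(divr_gt0 _ kB', divr_gt0 _ k36, divr_gt0) ?exprn_gt0 // mulr_gt0.
have [r1 r2 r3 r4] : [/\ rho <= r, rho <= g / 2, rho * (16 * (kp * B + 1)) <= g ^+ 2
    & rho * (36 * (kp + 1)) <= G2 * g].
  by split; rewrite -?(ler_pdivlMr _ _ kB') -?(ler_pdivlMr _ _ k36) /rho !ge_min lexx ?orbT.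
clearbody rho; exists rho, (6 / G); split => // z0 z1 z2 z3 uz f1 f2 f3 zB1 zB3 h0 h2 h1 h3 rel.
have [z01 z02 z03] : [/\ z0 != z1, z0 != z2 & z0 != z3].
  by move: uz; rewrite /= !inE !negb_or => /and4P[/and3P[]].
have near z : z0 != z -> f.[z] = f.[z0] -> nm (z - p) < rho ->
    exists eta : C, [/\ eta ^+ n.+1 = 1, nm eta = 1, eta != 1 &
      nm (z - p - eta * (z0 - p)) <= e * nm (z0 - p)].
  move=> zz fz zr; have [|||eta [t1 t2 t3]] := hr z0 z zz; rewrite ?fz //.
  - exact: lt_le_trans h0 r1.
  - exact: lt_le_trans zr r1.
  by exists eta; split => //; exact: (@nm_unit _ _ n.+1).
have [t2 [t2n t2u t21 t2e]] := near z2 z02 f2 h2.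
have [u0 u0E] : exists u0 : C, u0 = z0 - p by exists (z0 - p).
rewrite -u0E in h0 near t2e.
have u00 : 0 < nm u0.
  rewrite nm_gt0; apply: contraNneq z02 => u00; move: t2e; rewrite u00 mulr0 nm0 mulr0 subr0.
  move=> h; have /eqP : nm (z2 - p) = 0 by apply: le_anti; rewrite h nm_ge0.
  by rewrite nm_eq0 subr_eq0 => /eqP ->; move/eqP: u00; rewrite u0E subr_eq0.
have tG : G <= nm (1 - t2).
  rewrite leNgt; apply: contra t21 => h.
  by have := hG t2 t2 t2 t2n t2n t2n h => /eqP; rewrite subr_eq0 eq_sym.
have low : G / 2 * nm u0 <= nm (z0 - z2).
  have := nm_ler ((1 - t2) * u0) (z0 - z2).
  rewrite (_ : _ - (z0 - z2) = (z2 - p) - t2 * u0); last by rewrite u0E; ring.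
  by rewrite nmM; move: tG t2e e2 u00 G0; clear; nra.
have up z t : nm t = 1 -> nm (z - p - t * u0) <= e * nm u0 -> nm (z0 - z) <= 3 * nm u0.
  move=> t1 h; rewrite (_ : z0 - z = (1 - t) * u0 - (z - p - t * u0)); last by rewrite u0E; ring.
  apply: (le_trans (nmB _ _)); rewrite nmM.
  have : nm (1 - t) <= 2 by apply: nm_diff_units; rewrite ?nm1.
  by move: h e1 u00; clear; nra.
case: h1 => [h1|h1].
  have [t1 [t1n t1u t11 t1e]] := near z1 z01 f1 h1.
  have := up _ _ t1u t1e.
  by rewrite mulrAC ler_pdivlMr //; move: low G0; clear; nra.
exfalso.
have D0 : g / 2 <= nm (z0 - z1).
  have := nm_ler (z1 - p) (- (z0 - z1)); rewrite nmN.
  by rewrite (_ : z1 - p - - _ = u0); [move: h1 h0 r2; clear; lra|rewrite u0E; ring].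
have z02r : nm (z0 - z2) <= 2 * rho.
  rewrite (_ : z0 - z2 = u0 - (z2 - p)); last by rewrite u0E; ring.
  by have := nmB u0 (z2 - p); move: h0 h2; clear; lra.
have relN : nm (z0 - z1) * nm (z2 - z3) = kp * (nm (z0 - z2) * nm (z1 - z3)).
  by rewrite -kpE -!nmM rel.
case: h3 => [h3|h3]; last first.
  have h4 : g / 2 <= nm (z2 - z3).
    have := nm_ler (z3 - p) (- (z2 - z3)); rewrite nmN.
    by rewrite (_ : z3 - p - - _ = z2 - p); [move: h3 h2 r2; clear; lra|ring].
  have h5 : nm (z1 - z3) <= 2 * B by have := nmB z1 z3; move: zB1 zB3; clear; lra.
  have h6 : g / 2 * (g / 2) <= nm (z0 - z1) * nm (z2 - z3) by rewrite ler_pM // divr_ge0 // ltW.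
  have h7 : nm (z0 - z2) * nm (z1 - z3) <= 2 * rho * (2 * B) by rewrite ler_pM ?nm_ge0.
  have h8 : kp * (nm (z0 - z2) * nm (z1 - z3)) <= kp * (2 * rho * (2 * B)) by rewrite ler_wpM2l.
  rewrite relN in h6; have h9 := le_trans h6 h8.
  rewrite expr2 in r3.
  by move: r3 h9 rho0 g0; clear; nra.
have [t3 [t3n t3u t31 t3e]] := near z3 z03 f3 h3.
(* Adding [k * (z0 - z1) * (z0 - z2)] to both sides leaves [z0 - z1], bounded below, as a factor on
   the left and only differences of nearby roots on the right. *)
have rel2 : (z0 - z1) * ((z2 - z3) + k * (z0 - z2)) = k * ((z0 - z2) * (z0 - z3)).
  by rewrite mulrDr rel; ring.
have z03r : nm (z0 - z3) <= 2 * rho.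
  rewrite (_ : z0 - z3 = u0 - (z3 - p)); last by rewrite u0E; ring.
  by have := nmB u0 (z3 - p); move: h0 h3; clear; lra.
have E : nm ((z2 - z3) + k * (z0 - z2)) <= 12 * kp * rho / g * nm u0.
  rewrite -(ler_pM2l (_ : 0 < g / 2)) ?divr_gt0 //.
  apply: le_trans (ler_wpM2r (nm_ge0 _) D0) _.
  rewrite -nmM rel2 nmM nmM kpE.
  have -> : g / 2 * (12 * kp * rho / g * nm u0) = kp * (3 * nm u0 * (2 * rho)).
    by field; rewrite gt_eqF.
  by rewrite ler_wpM2l // ler_pM ?nm_ge0 //; apply: up t2u t2e.
have small : nm ((t2 - t3) + k * (1 - t2)) < G2.
  rewrite -(ltr_pM2r u00) -nmM.
  rewrite (_ : _ * u0 = (z2 - z3 + k * (z0 - z2)) + (z3 - p - t3 * u0)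
    - (1 - k) * (z2 - p - t2 * u0)); last by rewrite u0E; ring.
  apply: le_lt_trans (nmB _ _) _.
  have b1 := nmD (z2 - z3 + k * (z0 - z2)) (z3 - p - t3 * u0).
  have b2 : nm ((1 - k) * (z2 - p - t2 * u0)) <= (1 + kp) * (e * nm u0).
    by rewrite nmM ler_pM ?nm_ge0 //; have := nmB 1 k; rewrite nm1 kpE.
  have b3 : 12 * kp * rho / g <= G2 / 3.
    by rewrite ler_pdivrMr //; move: r4 rho0 kap; clear; nra.
  have b4 : 12 * kp * rho / g * nm u0 <= G2 / 3 * nm u0 by rewrite ler_wpM2r ?nm_ge0.
  by move: b1 b2 b4 E t3e e3 u00 e0 kap G20; clear; nra.
have := hG2 t2 t3 t2 t2n t3n t2n small => /eqP; rewrite addr_eq0 -mulNr.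
by apply/negP; exact: unit_chord.
Qed.

Lemma uniform_radius (r : seq C) (P : C -> R -> R -> Prop) :
  (forall (c : C) e K e' K', e' <= e -> K <= K' -> P c e K -> P c e' K') ->
  (forall c : C, c \in r -> exists e K : R, 0 < e /\ P c e K) ->
  exists e K : R, 0 < e /\ forall c : C, c \in r -> P c e K.
Proof.
move=> mono; elim: r => [|a r IH] h; first by exists 1, 0.
have [c cr|e1 [K1 [e10 h1]]] := IH; first by apply: h; rewrite inE cr orbT.
have [|e2 [K2 [e20 h2]]] := h a; first by rewrite inE eqxx.
exists (Num.min e1 e2), (Num.max K1 K2); split; first by rewrite lt_min e10.
move=> c; rewrite inE => /orP[/eqP->|/h1 h3].
  by apply: mono h2; rewrite ?ge_min ?le_max lexx orbT.
by apply: mono h3; rewrite ?ge_min ?le_max lexx.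
Qed.

(** Roots over nearby [w] lie near points of the fibre over [w0]. If [z0] and [z2] are near the same
    point, [cross_ratio_local] applies, every other root being near that point or far from it;
    otherwise [z0 - z2] is bounded below. *)
Lemma cross_ratio_bounded f d k w0 : size f = d.+2 -> (k^*)%C = k -> k != 0 ->
  exists e K : R, 0 < e /\ forall w (z0 z1 z2 z3 : C), nm (w - w0) < e ->
    uniq [:: z0; z1; z2; z3] -> f.[z0] = w -> f.[z1] = w -> f.[z2] = w -> f.[z3] = w ->
    (z0 - z1) * (z2 - z3) = k * ((z0 - z2) * (z1 - z3)) ->
    nm (z0 - z1) <= K * nm (z0 - z2).
Proof.
move=> sf kr k0; have [B B0 hB] := root_bounded (nm w0 + 1) sf.
have [r sr hr] := roots_sub w0 sf.
have rP z : f.[z] = w0 -> z \in r.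
  move=> fz; have := roots_subE z hr; rewrite fz subrr => /esym/eqP.
  rewrite mulf_eq0 lead_coef_eq0 -size_poly_eq0 sf /= prodf_seq_eq0 => /hasP[y yr].
  by rewrite /= subr_eq0 => /eqP ->.
have [g g0 hg] := gap [seq a - b | a <- r, b <- r].
have hg' a b : a \in r -> b \in r -> a != b -> g <= nm (a - b).
  move=> ar br ab; apply: hg; last by rewrite subr_eq0.
  by apply/allpairsP; exists (a, b).
pose Loc (p : C) (rho K : R) := forall z0 z1 z2 z3 : C,
    uniq [:: z0; z1; z2; z3] -> f.[z1] = f.[z0] -> f.[z2] = f.[z0] -> f.[z3] = f.[z0] ->
    nm z1 <= B -> nm z3 <= B -> nm (z0 - p) < rho -> nm (z2 - p) < rho ->
    nm (z1 - p) < rho \/ g / 2 <= nm (z1 - p) -> nm (z3 - p) < rho \/ g / 2 <= nm (z3 - p) ->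
    (z0 - z1) * (z2 - z3) = k * ((z0 - z2) * (z1 - z3)) ->
    nm (z0 - z1) <= K * nm (z0 - z2).
have g20 : 0 < g / 2 by rewrite divr_gt0.
have [|c _|rho [K [rho0 hrho]]] := @uniform_radius r Loc.
- move=> p e K e' K' ee KK hL z0 z1 z2 z3 uz f1 f2 f3 B1 B3 h0 h2 h1 h3 rel.
  apply: (@le_trans _ _ (K * nm (z0 - z2))); last by rewrite ler_wpM2r ?nm_ge0.
  apply: (hL z0 z1 z2 z3) => //; try exact: lt_le_trans ee.
    by case: h1 => h1; [left; exact: lt_le_trans ee|right].
  by case: h3 => h3; [left; exact: lt_le_trans ee|right].
- exact: (cross_ratio_local c sf kr k0 g20 B0).
pose rh := Num.min rho (g / 4).
have g40 : 0 < g / 4 by rewrite divr_gt0.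
have rh0 : 0 < rh by rewrite lt_min rho0.
have [rh1 rh2] : rh <= rho /\ rh <= g / 4 by rewrite !ge_min !lexx orbT.
have [e e0 he] := root_near_lt sf rh0.
exists (Num.min e 1), (Num.max K (4 * B / g)); split; first by rewrite lt_min e0 ltr01.
move=> w z0 z1 z2 z3; rewrite lt_min => /andP[we w1] uz f0 f1 f2 f3 rel.
have near z : f.[z] = w -> exists p : C, [/\ p \in r, nm (z - p) < rh & nm z <= B].
  move=> fz; have [|p pw0 hp] := he z w0; first by rewrite fz nm_sym.
  exists p; split; [exact: rP|by rewrite nm_sym|].
  by apply: hB; rewrite fz; have := nm_ler w w0; move: w1; clear; lra.
have [p0 [p0r h0 B0']] := near z0 f0; have [p1 [p1r h1 B1]] := near z1 f1.
have [p2 [p2r h2 B2]] := near z2 f2; have [p3 [p3r h3 B3]] := near z3 f3.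
have far (y q1 q2 : C) : q1 \in r -> q2 \in r -> q1 != q2 ->
    nm (y - q1) < rh -> 3 * g / 4 <= nm (y - q2).
  move=> q1r q2r q12 yq; have := hg' _ _ q1r q2r q12.
  have := nm_tri y q1 q2; rewrite (nm_sym q1 y).
  by move: yq rh2; clear; lra.
have [p02|p02] := eqVneq p0 p2; last first.
  apply: (@le_trans _ _ (4 * B / g * nm (z0 - z2))); last first.
    by rewrite ler_wpM2r ?nm_ge0 // le_max lexx orbT.
  have h5 : g / 2 <= nm (z0 - z2).
    have := far z0 p0 p2 p0r p2r p02 h0; have := nm_tri z2 z0 p2.
    by move: h2 rh2; clear; lra.
  have h6 := nmB z0 z1.
  rewrite mulrAC ler_pdivlMr //.
  by move: h5 h6 B0' B1 g0 B0 (nm_ge0 (z0 - z1)); clear; nra.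
apply: (@le_trans _ _ (K * nm (z0 - z2))); last first.
  by rewrite ler_wpM2r ?nm_ge0 // le_max lexx.
have dich y q : q \in r -> nm (y - q) < rh -> nm (y - p0) < rho \/ g / 2 <= nm (y - p0).
  move=> qr yq; have [qp|qp] := eqVneq q p0; first by left; rewrite -qp; exact: lt_le_trans rh1.
  by right; have := far y q p0 qr p0r qp yq; move: g0; clear; lra.
apply: (hrho p0 p0r z0 z1 z2 z3) => //; rewrite ?f0 //.
- exact: lt_le_trans rh1.
- by rewrite p02; exact: lt_le_trans rh1.
- exact: dich h1.
- exact: dich h3.
Qed.

Definition cross_relation d (i1 i2 i3 : 'I_d.+2) k (z : 'I_d.+2 -> C) : C :=
  (z ord0 - z i1) * (z i2 - z i3) - k * ((z ord0 - z i2) * (z i1 - z i3)).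

(** One value [w] of large modulus suffices: there the relation holds exactly between the
    directions, which lie on the unit circle. *)
Lemma cross_ratio_real f d (i1 i2 i3 : 'I_d.+2) k : size f = d.+3 -> uniq [:: ord0; i1; i2; i3] ->
  (forall w, exists2 z, enumerates f w z & cross_relation i1 i2 i3 k z = 0) -> (k^*)%C = k.
Proof.
move=> sf ui H; have [F0 hF0] := simple_values sf; have [K K0 hK] := directions sf.
have [g g0 hg] := unity_gap d.+1
  (fun x y z => (1 - x) * (y - z) - k * ((1 - y) * (x - z)) : C).
have k5 : 0 < 2 * (5 * (1 + nm k)) by have := nm_ge0 k; lra.
pose e := Num.min (1 / 2) (g / (2 * (5 * (1 + nm k))) / 2).
have e0 : 0 < e by rewrite lt_min !divr_gt0.
have e1 : 2 * e <= 1 by rewrite mulrC -ler_pdivlMr // ge_min lexx.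
have eg : 2 * e * (5 * (1 + nm k)) < g.
  have : e <= g / (2 * (5 * (1 + nm k))) / 2 by rewrite ge_min lexx orbT.
  by rewrite -mulrA -invfM ler_pdivlMr ?mulr_gt0 //; move: e0 k5 g0; clear; nra.
have [M hM] := hK e e0; have [M' hM'] := avoid_infty F0.
have [w wM wF] : exists2 w, M < nm w & w \notin F0.
  exists (Complex (`|M| + `|M'| + 1) 0); last apply: hM'; rewrite nm_real ger0_norm ?addr_ge0 //.
    by have := ler_norm M; have := normr_ge0 M'; lra.
  by have := ler_norm M'; have := normr_ge0 M; lra.
have [z hz /eqP] := H w; rewrite subr_eq0 => /eqP rel.
have iz := hF0 _ _ wF hz.
have [t [it t0 tU tc [z0 _ _]]] := hM w z wM hz iz.
have tn1 i : nm (t i) = 1 by exact: (@nm_unit _ _ d.+2).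
have [i20 i13] : t i2 != 1 /\ t i1 != t i3.
  move: ui; rewrite /= !inE !negb_or -t0 => /and4P[/and3P[_ h2 _] /andP[_ h3] _ _].
  by split; [apply: contraNneq h2 => /it ->|apply: contraNneq h3 => /it ->].
apply: (@unit_cross_ratio_real _ _ (t i1) (t i2) (t i3)) => //.
apply/eqP; rewrite -subr_eq0; apply/eqP; apply: (hg (t i1) (t i2) (t i3)) => //.
apply: le_lt_trans eg.
have le2 (x : R) : x <= e -> x <= 2 * e by move: e0; clear; lra.
apply: (@close_products _ _ (1 - z i1 / z ord0) (z i2 / z ord0 - z i3 / z ord0) _ _
  (1 - z i2 / z ord0) (z i1 / z ord0 - z i3 / z ord0)) => //;
  rewrite ?nm_sub2 ?nm_diff_units ?nm1 ?subrr ?nm0 ?(ltW e0) //.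
have -> : (1 - z i1 / z ord0) * (z i2 / z ord0 - z i3 / z ord0) =
    (z ord0 - z i1) * (z i2 - z i3) / z ord0 ^+ 2 by field.
by rewrite rel; field.
Qed.

(** At infinity the directions are distinct, so every difference of roots is comparable to [z ord0];
    the constant is 3 divided by [g / 2]. *)
Lemma cross_ratio_infty f d (i1 i2 i3 : 'I_d.+2) : size f = d.+3 ->
  uniq [:: ord0; i1; i2; i3] -> exists M K : R, forall w (z : 'I_d.+2 -> C), M < nm w ->
  enumerates f w z -> injective z -> nm (z ord0 - z i1) <= K * nm (z ord0 - z i2).
Proof.
move=> sf ui; have [K K0 hK] := directions sf.
have [g g0 hg] := unity_gap d.+1 (fun x _ _ => 1 - x : C).
pose e := Num.min 1 (g / 2).
have e0 : 0 < e by rewrite lt_min ltr01 divr_gt0.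
have [e1 e2] : e <= 1 /\ e <= g / 2 by rewrite !ge_min !lexx orbT.
have [M hM] := hK e e0; exists M, (6 / g) => w z wM hz iz.
have [t [it t0 tU tc [z0 _ _]]] := hM w z wM hz iz.
have tn1 i : nm (t i) = 1 by exact: (@nm_unit _ _ d.+2).
have i20 : t i2 != 1.
  move: ui; rewrite /= !inE !negb_or -t0 => /and4P[/and3P[_ h2 _] _ _ _].
  by apply: contraNneq h2 => /it ->.
have z00 : 0 < nm (z ord0) by rewrite nm_gt0.
have -> : z ord0 - z i1 = (1 - z i1 / z ord0) * z ord0 by field.
have -> : z ord0 - z i2 = (1 - z i2 / z ord0) * z ord0 by field.
rewrite !nmM mulrA ler_pM2r // mulrAC ler_pdivlMr //.
have h1 : nm (1 - z i1 / z ord0) <= 3.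
  have := nm_ler (1 - z i1 / z ord0) (1 - t i1); have := nm_sub1 (tc i1).
  have : nm (1 - t i1) <= 2 by apply: nm_diff_units; rewrite ?nm1.
  by move: e1; clear; lra.
have h2 : g / 2 <= nm (1 - z i2 / z ord0).
  have h3 : g <= nm (1 - t i2).
    rewrite leNgt; apply: contra i20 => h.
    by have := hg (t i2) (t i2) (t i2) (tU _) (tU _) (tU _) h => /eqP; rewrite subr_eq0 eq_sym.
  have := nm_ler (1 - t i2) (1 - z i2 / z ord0); rewrite nm_sym.
  have := nm_sub1 (tc i2); rewrite nm_sym nm_sym.
  by move: h3 e2; clear; lra.
by move: h1 h2 g0; clear; nra.
Qed.

(** A constant value [s] of [(z1 - z2) / (z1 - z3)] is a relation between three moving points and
    infinity, which reduces the claim to [affine_symmetry3] with the constant form. *)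
Lemma affine_symmetry4 f d k a x : size f = d.+3 -> k != 0 ->
  (forall e : R, 0 < e -> exists z1 z2 z3 z4 : C,
     [/\ uniq [:: z1; z2; z3; z4], [/\ f.[z2] = f.[z1], f.[z3] = f.[z1] & f.[z4] = f.[z1]],
         f.[z1] != f.[a], nm (z1 - a) < e /\ nm (z2 - x) < e
       & (z1 - z2) * (z3 - z4) = k * ((z1 - z3) * (z2 - z4))]) ->
  exists q s : C, f \Po (q *: 'X + s%:P) = f /\ x = q * a + s.
Proof.
move=> sf k0 H.
have inS z1 z2 z3 z4 : [/\ f.[z2] = f.[z1], f.[z3] = f.[z1] & f.[z4] = f.[z1]] ->
    forall z, z \in [:: z1; z2; z3; z4] -> f.[z] = f.[z1].
  by move=> [h2 h3 h4] z; rewrite !inE => /or4P[]/eqP->.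
have [d' dE] : exists d', d = d'.+2.
  have [z1 [z2 [z3 [z4 [uz fz _ _ _]]]]] := H 1 ltr01.
  have [] := extend_roots sf uz (inS _ _ _ _ fz).
  by case: d {sf} => [|[|d']] // _ _; exists d'.
move: sf; rewrite dE => {d dE} sf.
pose i1 : 'I_d'.+4 := Ordinal (isT : (1 < d'.+4)%N).
pose i2 : 'I_d'.+4 := Ordinal (isT : (2 < d'.+4)%N).
pose i3 : 'I_d'.+4 := Ordinal (isT : (3 < d'.+4)%N).
have ui : uniq [:: ord0; i1; i2; i3] by [].
have [F0 hF0] := simple_values sf.
pose P := cross_relation i1 i2 i3 k.
have pP : polyfun P.
  apply: polyfunB; first by apply: polyfunM; apply: polyfunB; exact: polyfun_var.
  apply: polyfunM; first exact: polyfun_const.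
  by apply: polyfunM; apply: polyfunB; exact: polyfun_var.
have pg i : polyfun (fun z : 'I_d'.+4 -> C => z ord0 - z i).
  by apply: polyfunB; exact: polyfun_var.
have enum e (F : seq C) : 0 < e -> exists z1 z2 z3 z4 : C, exists z : 'I_d'.+4 -> C,
    [/\ uniq [:: z1; z2; z3; z4], [/\ f.[z2] = f.[z1], f.[z3] = f.[z1] & f.[z1] != f.[a]],
        f.[z1] \notin F, nm (z1 - a) < e /\ nm (z2 - x) < e &
        [/\ enumerates f f.[z1] z, P z = 0, z ord0 = z1, z i1 = z2 & z i2 = z3]].
  move=> e_gt0; have [e0 e00 he0] := avoid F f.[a].
  have [e1 e10 he1] := horner_cont f a e00.
  have [|z1 [z2 [z3 [z4 [uz fz fa []]]]]] := H (Num.min e e1); first by rewrite lt_min e_gt0.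
  rewrite !lt_min => /andP[za zae1] /andP[zx _] rel.
  have [_ [z hz zE]] := extend_roots sf uz (inS _ _ _ _ fz).
  exists z1, z2, z3, z4, z; split => //.
  - by case: fz.
  - by apply: he0; rewrite he1 // nm_gt0 subr_eq0 fa.
  - by split; rewrite ?/P /cross_relation ?zE //= rel subrr.
(* The relation is solvable over values accumulating at [f.[a]], hence by [relation_dense] over
   every [w], in particular near infinity. *)
have kr : (k^*)%C = k.
  have [H0|[F HF]] := relation_dense sf pP; first exact: (cross_ratio_real sf ui H0).
  have [z1 [z2 [z3 [z4 [z [_ _ zF _ [hz Pz _ _ _]]]]]]] := enum 1 F ltr01.
  by rewrite (HF _ _ hz Pz) in zF.
have inj4 w (z : 'I_d'.+4 -> C) : injective z -> uniq [:: z ord0; z i1; z i2; z i3].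
  by move=> iz; have := ui; rewrite -(map_inj_uniq iz).
have [w z wF hz Pz|w0||S [F hSF]] := bounded_finite_values sf pP (pg i1) (pg i2) (F0 := F0).
- rewrite subr_eq0; have := inj4 w z (hF0 _ _ wF hz).
  by rewrite /= !inE !negb_or => /andP[/and3P[]].
- have [e [K [e0 hK]]] := cross_ratio_bounded w0 sf kr k0.
  exists e, K; split => // w z /andP[_ we] wF hz /eqP; rewrite subr_eq0 => /eqP rel.
  apply: (hK w _ _ _ (z i3) we) rel; rewrite ?(enumerates_root _ hz) //.
  exact: inj4 w z (hF0 _ _ wF hz).
- have [M [K hM]] := cross_ratio_infty sf ui; exists M, K => w z wM wF hz _.
  exact: hM wM hz (hF0 _ _ wF hz).
pose Q s e := exists z1 z2 z3 : C,
  [/\ uniq [:: z1; z2; z3], f.[z2] = f.[z1] /\ f.[z3] = f.[z1], f.[z1] != f.[a],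
      nm (z1 - a) < e /\ nm (z2 - x) < e & (z1 - z2) * 1 = s * ((z1 - z3) * 1)].
have [|e e_gt0|s hs] := @pigeonhole R S Q.
- move=> s e e' ee' [z1 [z2 [z3 [h1 h2 h3 [h4 h5] h6]]]]; exists z1, z2, z3; split => //.
  by split; apply: lt_le_trans ee'.
- have [z1 [z2 [z3 [z4 [z [uz [f2 f3 fa] zF [za zx] [hz Pz E0 E1 E2]]]]]]] := enum e F e_gt0.
  have := hSF _ _ zF hz Pz; rewrite E0 E1 E2 => sS; exists ((z1 - z2) / (z1 - z3)) => //.
  have u3 : uniq [:: z1; z2; z3].
    have := uz; rewrite -[[:: z1; z2; z3; z4]]/([:: z1; z2; z3] ++ [:: z4]) cat_uniq.
    by case/and3P.
  exists z1, z2, z3; split => //; rewrite !mulr1 divfK // subr_eq0.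
  by move: u3; rewrite /= !inE !negb_or => /andP[/andP[]].
have s1 : s != 1.
  have [z1 [z2 [z3 [u3 _ _ _ E]]]] := hs 1 ltr01.
  apply: contraTneq u3 => s1; move: E; rewrite s1 mul1r !mulr1 => /addrI /oppr_inj ->.
  by rewrite /= !inE eqxx !andbF.
exact: (affine_symmetry3 sf (or_introl (erefl (fun=> 1))) s1 hs).
Qed.
End FourRoots.

(** * Isotopies of the sphere *)

Section Sphere.
Variable R : realType.
Local Notation C := R[i].
Local Notation S2 := (sphere R).
Implicit Types (z w c : C) (x y : S2).

Lemma sqrt_ge1 (a : R) : 0 <= a -> 1 <= Num.sqrt (1 + a).
Proof. by move=> a0; rewrite -{1}[1](@sqrtr1 R) ler_sqrt; lra. Qed.

Lemma chordalE z w : chordal (Some z) (Some w) =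
  2 * nm (z - w) / (Num.sqrt (1 + nm z ^+ 2) * Num.sqrt (1 + nm w ^+ 2)).
Proof.
rewrite /= !sqnorm_nm sqrtr_sqr ger0_norm ?nm_ge0 // sqrtrM //.
by rewrite addr_ge0 // exprn_ge0 // nm_ge0.
Qed.

Lemma chordal_le z w : chordal (Some z) (Some w) <= 2 * nm (z - w).
Proof.
rewrite chordalE; have h1 := sqrt_ge1 (sqr_ge0 (nm z)); have h2 := sqrt_ge1 (sqr_ge0 (nm w)).
rewrite ler_pdivrMr; last by rewrite mulr_gt0 //; lra.
rewrite ler_peMr ?mulr_ge0 ?nm_ge0 //.
by move: h1 h2; set a := Num.sqrt _; set b := Num.sqrt _; nra.
Qed.

Lemma chordal_near z (e : R) : 0 < e -> exists2 d : R, 0 < d & forall y, chordal (Some z) y < d ->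
  exists2 w, y = Some w & nm (w - z) < e.
Proof.
move=> e0; have N1 := sqrt_ge1 (sqr_ge0 (nm z)); set N := Num.sqrt _ in N1.
have N2 : N ^+ 2 = 1 + nm z ^+ 2 by rewrite sqr_sqrtr // addr_ge0 // sqr_ge0.
have N0 : 0 < N by lra.
have Ne : 0 < N * (N + e) by rewrite mulr_gt0 //; lra.
(* Infinity lies at distance [2 / N], which excludes it. For finite [w] at Euclidean distance [u]
   the chordal distance is at least [2 * u / (N * (N + u))], increasing in [u]. *)
exists (Num.min (2 / N) (2 * e / (N * (N + e)))).
  by rewrite lt_min !divr_gt0 // mulr_gt0.
case=> [w|]; last by rewrite /= sqnorm_nm -/N lt_min ltxx.
rewrite chordalE -/N lt_min => /andP[_ h]; exists w => //.
rewrite nm_sym ltNge; apply/negP => he; move: h; rewrite ltNge => /negP; apply.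
have W1 := sqrt_ge1 (sqr_ge0 (nm w)); set W := Num.sqrt _ in W1 *.
have W0 : 0 < W by lra.
have u0 := nm_ge0 (z - w).
have WN : W <= N + nm (z - w).
  have W2 : W ^+ 2 = 1 + nm w ^+ 2 by rewrite sqr_sqrtr // addr_ge0 // sqr_ge0.
  rewrite -(@ler_pXn2r _ 2) ?nnegrE ?(ltW W0) ?addr_ge0 ?(ltW N0) //.
  have := nm_ler w z; rewrite nm_sym.
  have zN : nm z <= N by rewrite -(@ler_pXn2r _ 2) ?nnegrE ?nm_ge0 ?(ltW N0) // N2; lra.
  rewrite W2 (_ : (N + _) ^+ 2 = 1 + nm z ^+ 2 + 2 * N * nm (z - w) + nm (z - w) ^+ 2); last first.
    by rewrite -N2; ring.
  move=> h.
  by move: h zN u0 (nm_ge0 w) (nm_ge0 z); clear; nra.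
rewrite ler_pdivlMr ?mulr_gt0 // mulrAC ler_pdivrMr //.
have h1 : e * W <= nm (z - w) * (N + e) by move: WN he e0 N0; clear; nra.
by move: h1 N0; clear; nra.
Qed.

Lemma chordal_infty (M : R) : exists2 d : R, 0 < d & forall y, chordal None y < d ->
  y = None \/ exists2 w, y = Some w & M < nm w.
Proof.
have N1 := sqrt_ge1 (sqr_ge0 M); set N := Num.sqrt _ in N1.
have N0 : 0 < N by lra.
exists (2 / N); first by rewrite divr_gt0.
case=> [w|] h; [right|by left]; exists w => //; rewrite ltNge; apply/negP => wM.
move: h; rewrite /= sqnorm_nm ltNge => /negP; apply.
have W1 := sqrt_ge1 (sqr_ge0 (nm w)).
rewrite ler_pM2l // lef_pV2 ?posrE //; last by lra.
rewrite ler_sqrt ?lerD2l; last by have := sqr_ge0 M; lra.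
by rewrite lerXn2r // nnegrE ?(le_trans (nm_ge0 w) wM) ?nm_ge0.
Qed.

Lemma chordal_infty_small (e : R) : 0 < e -> exists M : R, forall w, M < nm w ->
  chordal None (Some w) < e.
Proof.
move=> e0; exists (2 / e) => w h; rewrite /= sqnorm_nm.
have W1 := sqrt_ge1 (sqr_ge0 (nm w)).
have e20 : 0 < 2 / e by rewrite divr_gt0.
rewrite ltr_pdivrMr; last by lra.
rewrite mulrC -ltr_pdivrMr //; apply: (lt_le_trans h).
rewrite -{1}(ger0_norm (nm_ge0 w)) -sqrtr_sqr ler_sqrt.
  by lra.
by have := sqr_ge0 (nm w); lra.
Qed.

Definition lift (K : C -> C) x : S2 := if x is Some z then Some (K z) else None.

Definition jcont (K : R -> C -> C) : Prop := forall t z (e : R), 0 < e ->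
  exists2 d : R, 0 < d & forall t' z', `|t - t'| < d -> nm (z' - z) < d ->
    nm (K t' z' - K t z) < e.

Lemma lift_cont (K : R -> C -> C) (M : R) : jcont K -> (forall t z, M < nm z -> K t z = z) ->
  forall t x (e : R), 0 < e -> exists2 d : R, 0 < d & forall t' y,
    `|t - t'| < d -> chordal x y < d -> chordal (lift (K t) x) (lift (K t') y) < e.
Proof.
move=> cK hM t [z|] e e0.
  have e2 : 0 < e / 2 by rewrite divr_gt0.
  have [d d0 hd] := cK t z (e / 2) e2.
  have [d' d'0 hd'] := chordal_near z d0; exists (Num.min d d'); first by rewrite lt_min d0.
  move=> t' y; rewrite !lt_min => /andP[td _] /andP[_ /hd'[w -> wz]].
  apply: (le_lt_trans (chordal_le _ _)); rewrite nm_sym.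
  by have := hd t' w td wz; lra.
have [d d0 hd] := chordal_infty M; exists (Num.min d e); first by rewrite lt_min d0.
move=> t' y _; rewrite lt_min => /andP[/hd[->//|[w -> wM]] he].
by rewrite /= hM.
Qed.

Lemma lift_orient_pres (K K' : R -> C -> C) (M : R) (t : R) : jcont K -> jcont K' ->
  (forall t z, M < nm z -> K t z = z) -> (forall t z, M < nm z -> K' t z = z) ->
  (forall t, cancel (K t) (K' t)) -> (forall t, cancel (K' t) (K t)) ->
  (forall z, K 0 z = z) -> orient_pres (lift (K t)).
Proof.
move=> cK cK' hM hM' KK' K'K K0.
have homeo s : sph_homeo (lift (K s)).
  split.
    move=> x e e0; have [d d0 hd] := lift_cont cK hM s x e0; exists d => // y.
    by apply: hd; rewrite subrr normr0.
  exists (lift (K' s)); split; first by case=> //= z; rewrite KK'.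
    by case=> //= z; rewrite K'K.
  move=> x e e0; have [d d0 hd] := lift_cont cK' hM' s x e0; exists d => // y.
  by apply: hd; rewrite subrr normr0.
(* Running the parameter from [t] back to 0 is an isotopy to the identity. *)
split=> //; exists (fun s => lift (K (t * (1 - s)))); split.
- split=> // [s x e _ e0].
  have [d d0 hd] := lift_cont cK hM (t * (1 - s)) x e0.
  have t0 : 0 < `|t| + 1 by rewrite ltr_wpDl.
  exists (Num.min d (d / (`|t| + 1))); first by rewrite lt_min d0 divr_gt0.
  move=> s' y _; rewrite !lt_min => /andP[_ ss] /andP[xy _]; apply: hd => //.
  rewrite (_ : t * (1 - s) - _ = - (t * (s - s'))) ?normrN ?normrM; last by ring.
  rewrite ltr_pdivlMr // in ss.
  by move: ss; have := normr_ge0 (s - s'); have := normr_ge0 t; clear; nra.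
- by case=> //= z; rewrite subr0 mulr1.
- by case=> //= z; rewrite subrr mulr0 K0.
Qed.

Lemma orient_pres_id : orient_pres (fun x : S2 => x).
Proof.
have jc : jcont (fun _ z => z) by move=> t z e e0; exists e.
have h := @lift_orient_pres (fun _ z => z) (fun _ z => z) 0 0 jc jc (fun _ _ _ => erefl)
  (fun _ _ _ => erefl) (fun _ _ => erefl) (fun _ _ => erefl) (fun _ => erefl).
by rewrite (_ : (fun x : S2 => x) = lift (fun z => z)) //; apply: funext; case.
Qed.

(** The Cayley parametrisation [(1 + i s) / (1 - i s)] of the unit circle: rational in [s],
    Lipschitz, with inverse rotation at [- s]. *)
Definition rot (s : R) : C := Complex 1 s / Complex 1 (- s).

Lemma rot_den (s : R) : Complex 1 s != 0 :> C.
Proof. by rewrite eq_complex /= oner_eq0. Qed.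

Lemma nm_rot_den (s : R) : 1 <= nm (Complex 1 s : C).
Proof. by rewrite /= expr1n sqrt_ge1 // sqr_ge0. Qed.

Lemma nm_rot s : nm (rot s) = 1.
Proof.
rewrite /rot nmM nmV /= sqrrN divff // expr1n gt_eqF //.
by have := sqrt_ge1 (sqr_ge0 s); lra.
Qed.

Lemma rotN s : rot (- s) * rot s = 1.
Proof. by rewrite /rot opprK; field; rewrite !rot_den. Qed.

Lemma rot0 : rot 0 = 1.
Proof. by rewrite /rot oppr0 divff ?rot_den. Qed.

Lemma rot_neq1 s : s != 0 -> rot s != 1.
Proof.
move=> s0; rewrite /rot; apply/eqP => h.
have : Complex 1 s = Complex 1 (- s) :> C by rewrite -[LHS](divfK (rot_den (- s))) h mul1r.
by case=> /eqP; rewrite -addr_eq0 -mulr2n mulrn_eq0 /= (negPf s0).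
Qed.

Lemma rot_lip s s' : nm (rot s - rot s') <= 2 * `|s - s'|.
Proof.
rewrite (_ : rot s - rot s' = Complex 0 (2 * (s - s')) / (Complex 1 (- s) * Complex 1 (- s'))).
  rewrite nmM nmV nmM.
  have -> : nm (Complex 0 (2 * (s - s')) : C) = 2 * `|s - s'|.
    by rewrite /= expr0n add0r sqrtr_sqr normrM ger0_norm.
  have h1 := nm_rot_den (- s); have h2 := nm_rot_den (- s').
  rewrite ler_pdivrMr; last by rewrite mulr_gt0 //; lra.
  rewrite ler_peMr ?mulr_ge0 //.
  by move: h1 h2; set a := nm _; set b := nm _; nra.
have -> : rot s - rot s' = (Complex 1 s * Complex 1 (- s') - Complex 1 s' * Complex 1 (- s))
   / (Complex 1 (- s) * Complex 1 (- s')) by rewrite /rot; field; rewrite !rot_den.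
by congr (_ / _); apply/eqP; rewrite eq_complex /=; apply/andP; split; apply/eqP; ring.
Qed.

(** A tent: 1 at the centre, 1/2 at [rho], 0 from [2 * rho] on. *)
Definition bump (rho : R) (r : R) : R := Num.max 0 (1 - r / (2 * rho)).

Lemma bump_lip rho r r' : 0 < rho -> `|bump rho r - bump rho r'| <= `|r - r'| / (2 * rho).
Proof.
move=> rho0; have rr : 0 < 2 * rho by rewrite mulr_gt0.
have E : `|r - r'| / (2 * rho) = `|r / (2 * rho) - r' / (2 * rho)|.
  by rewrite -mulrBl normrM [X in _ = _ * X]ger0_norm // invr_ge0 ltW.
rewrite E /bump; set u := r / _; set v := r' / _.
have n1 := ler_norm (u - v); have n2 := ler_norm (v - u); rewrite distrC in n2.
rewrite !maxEle; case: (leP 0 (1 - u)) => h1; case: (leP 0 (1 - v)) => h2.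
all: by rewrite ler_norml; apply/andP; split; lra.
Qed.

Lemma bump_bounds rho r : 0 < rho -> 0 <= r -> 0 <= bump rho r <= 1.
Proof.
move=> rho0 r0; rewrite /bump le_max lexx /= ge_max ler01 /= lerBlDr lerDl.
by rewrite divr_ge0 // mulr_ge0 // ltW.
Qed.

Lemma bump_out rho r : 0 < rho -> 2 * rho <= r -> bump rho r = 0.
Proof.
move=> rho0 h; apply/max_idPl; rewrite subr_le0 ler_pdivlMr ?mul1r //.
by rewrite mulr_gt0.
Qed.

(** The angle depends only on the distance to [c], which a rotation about [c] preserves; hence the
    inverse is the twist of parameter [- t]. *)
Definition twist c (rho t : R) z : C := c + rot (t * bump rho (nm (z - c))) * (z - c).

Lemma nm_twist c rho t z : nm (twist c rho t z - c) = nm (z - c).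
Proof. by rewrite /twist addrAC subrr add0r nmM nm_rot mul1r. Qed.

Lemma twistK c rho t : cancel (twist c rho t) (twist c rho (- t)).
Proof.
move=> z; rewrite {1}/twist nm_twist /twist addrAC subrr add0r mulrA mulNr rotN mul1r.
by rewrite addrC subrK.
Qed.

Lemma twist0 c rho z : twist c rho 0 z = z.
Proof. by rewrite /twist mul0r rot0 mul1r addrC subrK. Qed.

Lemma twist_out c rho t z : 0 < rho -> 2 * rho <= nm (z - c) -> twist c rho t z = z.
Proof. by move=> r0 h; rewrite /twist bump_out // mulr0 rot0 mul1r addrC subrK. Qed.

Lemma twist_near c rho t z : 0 < rho -> nm (twist c rho t z - z) <= 4 * rho.
Proof.
move=> r0; case: (leP (2 * rho) (nm (z - c))) => h.
  by rewrite twist_out // subrr nm0 mulr_ge0 // ltW.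
have := nm_tri c (twist c rho t z) z; rewrite nm_twist (nm_sym c).
by lra.
Qed.

Lemma twist_jcont c rho : 0 < rho -> jcont (twist c rho).
Proof.
move=> r0 t z e e0; have N0 := nm_ge0 (z - c); set N := nm (z - c) in N0.
pose L := 1 + 2 * N * (1 + (`|t| + 1) / (2 * rho)).
have t0 := normr_ge0 t.
have q0 : 0 <= (`|t| + 1) / (2 * rho) by rewrite divr_ge0 ?mulr_ge0 ?(ltW r0) //; lra.
have L0 : 1 <= L by rewrite /L lerDl !mulr_ge0 //; lra.
exists (Num.min 1 (e / L)); first by rewrite lt_min ltr01 divr_gt0 //; lra.
move=> t' z'; rewrite !lt_min => /andP[t1 te] /andP[_ ze].
set d := e / L in te ze.
rewrite /twist; set s := t * _; set s' := t' * _.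
rewrite (_ : _ - _ = rot s' * (z' - z) + (rot s' - rot s) * (z - c)); last by ring.
apply: (le_lt_trans (nmD _ _)); rewrite (nmM (rot s')) (nmM (rot s' - rot s)) nm_rot mul1r -/N.
have hs : `|s' - s| <= `|t - t'| + (`|t| + 1) / (2 * rho) * nm (z' - z).
  rewrite /s /s'; set B := bump _ N; set B' := bump _ _.
  rewrite (_ : _ - _ = - ((t - t') * B) + t' * (B' - B)); last by ring.
  apply: (le_trans (ler_normD _ _)); rewrite normrN !normrM lerD //.
    rewrite ler_piMr //; have /andP[b0 b1] := bump_bounds r0 N0.
    by rewrite ger0_norm.
  have ht' : `|t'| <= `|t| + 1.
    have := ler_normB t (t - t'); rewrite opprB addrC subrK; move: t1; clear; lra.
  rewrite (_ : (_ + 1) / _ * _ = (`|t| + 1) * (nm (z' - z) / (2 * rho))); last by ring.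
  apply: ler_pM => //; apply: (le_trans (bump_lip _ _ r0)).
  rewrite ler_wpM2r ?invr_ge0 ?mulr_ge0 ?(ltW r0) //.
  rewrite ler_norml; apply/andP; split.
    have := nm_ler (z - c) (z' - c); rewrite (_ : z - c - _ = z - z'); last by ring.
    by rewrite (nm_sym z z') /N; clear; lra.
  have := nm_ler (z' - c) (z - c); rewrite (_ : z' - c - (z - c) = z' - z); last by ring.
  by rewrite /N; clear; lra.
have h1 := rot_lip s' s.
have h2 : nm (rot s' - rot s) * N <= 2 * (`|t - t'| + (`|t| + 1) / (2 * rho) * nm (z' - z)) * N.
  by rewrite ler_wpM2r //; move: h1 hs; clear; lra.
have dL : d * L = e by rewrite /d divfK // gt_eqF //; lra.
have h3 : (`|t| + 1) / (2 * rho) * nm (z' - z) <= (`|t| + 1) / (2 * rho) * d.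
  by rewrite ler_wpM2l // ltW.
apply: (@lt_le_trans _ _ (d + 2 * (d + (`|t| + 1) / (2 * rho) * d) * N)).
  apply: ltr_leD => //; apply: (le_trans h2); rewrite ler_wpM2r // ler_wpM2l //.
  by rewrite lerD // ltW.
by rewrite -dL /L le_eqVlt; apply/orP; left; apply/eqP; ring.
Qed.
End Sphere.

(** * Lifting a local twist through a polynomial *)

Section Deformation.
Variable R : realType.
Local Notation C := R[i].
Local Notation S2 := (sphere R).
Implicit Types (z w c a b : C) (x y : S2) (p q f : {poly C}).

Lemma rat_eval1 f z : rat_eval f 1 (Some z) = Some f.[z].
Proof. by rewrite /rat_eval hornerC oner_eq0 divr1. Qed.

Lemma rat_eval1_infty f d : size f = d.+2 -> rat_eval f 1 None = None.
Proof. by move=> sf; rewrite /rat_eval size_poly1 sf. Qed.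

(** A large value outside the finite list of [simple_values] has at least two preimages, all near
    infinity. As infinity is its own image, a point of the regular set must be finite. *)
Lemma infinity_critical f d : size f = d.+3 -> critical_point (rat_eval f 1) None.
Proof.
move=> sf [e e0 he]; have [M hM] := chordal_infty_small e0.
have [M' hM'] := root_large f M; have [F hF] := simple_values sf.
have [M'' hM''] := avoid_infty F.
pose w : C := Complex (`|M'| + `|M''| + 1) 0.
have wE : nm w = `|M'| + `|M''| + 1 by rewrite nm_real ger0_norm // !addr_ge0.
have n1 := ler_norm M'; have n2 := ler_norm M''.
have n3 := normr_ge0 M'; have n4 := normr_ge0 M''.
have wF : w \notin F by apply: hM''; rewrite wE; move: n2 n3; clear; lra.
have [z hz] := enumerates_exists w sf; have iz := hF w z wF hz.
have zi i : f.[z i] = w by exact: enumerates_root hz.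
have zl i : chordal None (Some (z i)) < e.
  by apply/hM/hM'; rewrite zi wE; move: n1 n4; clear; lra.
have := he _ _ (zl ord0) (zl (inord 1)); rewrite !rat_eval1 !zi.
by move=> /(_ erefl) [] /iz /(congr1 val); rewrite /= inordK.
Qed.

Lemma regular_injective f (z : C) : ~ critical_point (rat_eval f 1) (Some z) ->
  exists2 r : R, 0 < r & forall z1 z2 : C, nm (z1 - z) < r -> nm (z2 - z) < r ->
    f.[z1] = f.[z2] -> z1 = z2.
Proof.
rewrite /critical_point => /contrapT[e e0 he]; exists (e / 2); first by rewrite divr_gt0.
have small z1 : nm (z1 - z) < e / 2 -> chordal (Some z) (Some z1) < e.
  move=> h; apply: (le_lt_trans (chordal_le _ _)); rewrite nm_sym.
  by move: h; clear; lra.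
move=> z1 z2 /small h1 /small h2 fz; apply: Some_inj.
by apply: he h1 h2 _; rewrite !rat_eval1 fz.
Qed.

(** Roots over values near [b] stay near the finitely many points over [b], at each of which [f] is
    locally injective. *)
Lemma fibre_separation f d b : size f = d.+2 ->
  (forall z, f.[z] = b -> ~ critical_point (rat_eval f 1) (Some z)) ->
  exists e k : R, [/\ 0 < e, 0 < k & forall z z', nm (f.[z] - b) < e -> nm (z - z') < k ->
    f.[z] = f.[z'] -> z = z'].
Proof.
move=> sf reg; have [r sr hr] := roots_sub b sf.
have rP z : f.[z] = b -> z \in r.
  move=> fz; have := roots_subE z hr; rewrite fz subrr => /esym/eqP.
  rewrite mulf_eq0 lead_coef_eq0 -size_poly_eq0 sf /= prodf_seq_eq0 => /hasP[y yr].
  by rewrite /= subr_eq0 => /eqP ->.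
pose Inj (z0 : C) (e K : R) := f.[z0] = b -> forall z1 z2 : C, nm (z1 - z0) < e ->
  nm (z2 - z0) < e -> f.[z1] = f.[z2] -> z1 = z2.
have [||e [K [e0 hI]]] := @uniform_radius R r Inj.
- by move=> c e K e' K' ee _ h fc z1 z2 h1 h2; apply: h => //; exact: lt_le_trans ee.
- move=> c _; have [fc|fc] := pselect (f.[c] = b); last by exists 1, 0; split => // /fc.
  by have [e e0 he] := regular_injective (reg c fc); exists e, 0; split=> // _.
have e20 : 0 < e / 2 by rewrite divr_gt0.
have [e' e'0 he'] := root_near_lt sf e20.
exists e', (e / 2); split => // z z' zb zz' fz.
have [|z0 fz0 h0] := he' z b; first by rewrite nm_sym.
apply: (hI z0 (rP _ fz0) fz0) => //; first by rewrite nm_sym; move: h0 e20; clear; lra.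
have := nm_tri z z' z0; rewrite (nm_sym z' z) (nm_sym z z0).
by move: h0 zz'; clear; lra.
Qed.

Section BranchLift.
Variables (f : {poly C}) (d : nat) (b c : C) (del k e rho : R).
Hypotheses (sf : size f = d.+2) (rho0 : 0 < rho) (e0 : 0 < e).
Hypothesis sep : forall z z', nm (f.[z] - b) < del -> nm (z - z') < k ->
  f.[z] = f.[z'] -> z = z'.
Hypotheses (ek : 2 * e <= k) (rd : 3 * rho < del) (bc : nm (b - c) = rho).
Hypothesis near : forall z w, nm (w - f.[z]) <= 4 * rho -> exists2 z', f.[z'] = w & nm (z' - z) < e.

Local Notation h := (twist c rho).

(** The lift of the twist, as a root close to [z]. Closeness singles out a root only over the disc
    around [b] where fibres are separated; outside it the last clause imposes the identity,
    consistently since the twist is trivial there. *)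
Definition branch_spec (t : R) z z' : Prop :=
  [/\ f.[z'] = h t f.[z], nm (z' - z) < e & del <= nm (f.[z] - b) -> z' = z].

Lemma far_from_center w : del <= nm (w - b) -> 2 * rho < nm (w - c).
Proof.
move=> hw; have := nm_tri c w b; rewrite (nm_sym c b) bc.
by move: hw rd; lra.
Qed.

Lemma twist_disc t w : nm (w - b) < del -> nm (h t w - b) < del.
Proof.
move=> wb; case: (leP (2 * rho) (nm (w - c))) => hw; first by rewrite twist_out.
have := nm_tri c (h t w) b; rewrite nm_twist (nm_sym c b) bc.
by move: hw rd; lra.
Qed.

Lemma branch_exists t z : exists z', branch_spec t z z'.
Proof.
have [|z' fz' zz'] := near (z := z) (w := h t f.[z]); first exact: twist_near.
case: (leP del (nm (f.[z] - b))) => hz; last first.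
  by exists z'; split => // /(lt_le_trans hz); rewrite ltxx.
exists z; split => //; last by rewrite subrr nm0.
by rewrite twist_out // ltW // far_from_center.
Qed.

Lemma branch_unique t z z1 z2 : branch_spec t z z1 -> branch_spec t z z2 -> z1 = z2.
Proof.
move=> [f1 n1 o1] [f2 n2 o2]; case: (leP del (nm (f.[z] - b))) => hz.
  by rewrite o1 // o2.
apply: sep; rewrite ?f1 ?f2 ?twist_disc //.
have := nm_tri z z1 z2; rewrite (nm_sym z z2).
by move: n1 n2 ek; lra.
Qed.

Definition branch t z : C := projT1 (cid (branch_exists t z)).

Lemma branchP t z : branch_spec t z (branch t z).
Proof. by rewrite /branch; case: (cid _). Qed.

Lemma branch_id t z : h t f.[z] = f.[z] -> branch t z = z.
Proof.
move=> hz; apply: branch_unique (branchP t z) _.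
by split; rewrite ?hz // subrr nm0.
Qed.

Lemma branchK t : cancel (branch t) (branch (- t)).
Proof.
move=> z; apply: branch_unique (branchP _ _) _; have [fz n o] := branchP t z; split.
- by rewrite fz twistK.
- by rewrite nm_sym.
rewrite fz => hz; apply/esym/o; rewrite leNgt; apply/negP => /(twist_disc t).
by rewrite ltNge hz.
Qed.

(** No branch of the inverse is followed: a nearby root exists by [root_near_lt] and is recognised
    as the lift by [branch_unique]. *)
Lemma branch_jcont : jcont branch.
Proof.
move=> t z e1 e10.
case: (leP del (nm (f.[z] - b))) => hz; last first.
  have [fz n _] := branchP t z; set z0 := branch t z in fz n *.
  (* Half of the room left in [nm (z0 - z) < e]: one half for the change of the root, one for that
     of [z]. *)
  pose s := (e - nm (z0 - z)) / 2.
  have s0 : 0 < s by rewrite divr_gt0 // subr_gt0.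
  have m0 : 0 < Num.min e1 s by rewrite lt_min e10.
  have [e2 e20 h2] := root_near_lt sf m0.
  have [e3 e30 h3] := twist_jcont c rho0 t f.[z] e20.
  have hz' : 0 < del - nm (f.[z] - b) by rewrite subr_gt0.
  have m1 : 0 < Num.min e3 (del - nm (f.[z] - b)) by rewrite lt_min e30.
  have [e4 e40 h4] := horner_cont f z m1.
  exists (Num.min e3 (Num.min e4 s)); first by rewrite !lt_min e30 e40.
  move=> t' z'; rewrite !lt_min => /andP[tt _] /and3P[_ z4 zs].
  have := h4 z' z4; rewrite lt_min => /andP[f3 fd].
  have fw : nm (h t' f.[z'] - f.[z0]) < e2 by rewrite fz; exact: h3.
  have [z1 f1] := h2 z0 _ fw; rewrite lt_min => /andP[n1 n2].
  suff -> : branch t' z' = z1 by [].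
  apply: branch_unique (branchP t' z') _; split => //.
    have := nm_tri z0 z1 z'; have := nm_tri z z0 z'; rewrite (nm_sym z z').
    by move: n2 zs; rewrite /s; lra.
  have := nm_tri f.[z] f.[z'] b => h5 h6.
  by exfalso; move: h5 h6 fd; lra.
have fz := far_from_center hz.
have m0 : 0 < nm (f.[z] - c) - 2 * rho by rewrite subr_gt0.
have [e2 e20 h2] := horner_cont f z m0.
exists (Num.min e1 e2); first by rewrite lt_min e10.
move=> t' z'; rewrite !lt_min => _ /andP[z1 z2].
rewrite !branch_id //; first by rewrite twist_out // ltW.
rewrite twist_out //.
have := h2 z' z2; have := nm_tri f.[z'] f.[z] c; rewrite (nm_sym f.[z] f.[z']).
by lra.
Qed.

Lemma branch_orient_pres t : orient_pres (lift (branch t)).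
Proof.
have [M hM] := horner_proper (nm b + del) sf.
have out s z : M < nm z -> branch s z = z.
  move=> /hM hz; apply: branch_id; rewrite twist_out // ltW // far_from_center //.
  by have := nm_ler f.[z] b; move: hz; lra.
apply: (@lift_orient_pres R branch (fun t => branch (- t)) M) => //.
- exact: branch_jcont.
- move=> s z e1 e10; have [e2 e20 h2] := branch_jcont (- s) z e10.
  by exists e2 => // s' z' hs; apply: h2; rewrite opprK addrC distrC.
- by move=> s z /out.
- by move=> s; exact: branchK.
- by move=> s z; have := branchK (- s) z; rewrite opprK.
by move=> z; apply: branch_id; rewrite twist0.
Qed.

End BranchLift.

(** The CTP condition compares two lifts, both with [f] itself as the rational map: the identity
    over the identity, and the lifted twist over the twist. The isotopy is constant on [A], so its
    end, a Moebius map, agrees there with the lifted twist. *)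
Lemma CTP_deformation f d (A : S2 -> Prop) n b : size f = d.+3 -> has_card A n ->
  CTP (rat_eval f 1) A ->
  (forall z, f.[z] = b -> ~ critical_point (rat_eval f 1) (Some z)) ->
  forall e : R, 0 < e -> exists (T : C -> C) (w : C) (M : S2 -> S2),
    [/\ mobius M, injective T, w != b,
        forall z, A (Some z) -> [/\ M (Some z) = Some (T z),
          f.[z] = b -> nm (T z - z) < e /\ f.[T z] = w & f.[z] != b -> T z = z]
      & A None -> M None = None].
Proof.
move=> sf [s [_ _ As]] ctp reg e e_gt0.
have [del [k [del0 k0 sep]]] := fibre_separation sf reg.
pose e' := Num.min e (k / 2).
have e'0 : 0 < e' by rewrite lt_min e_gt0 divr_gt0.
have [e'e e'k] : e' <= e /\ 2 * e' <= k.
  split; first by rewrite ge_min lexx.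
  by rewrite mulrC -ler_pdivlMr // ge_min lexx orbT.
have [eta eta0 heta] := root_near_lt sf e'0.
(* The default 0 for infinity only adds one number to the list and is harmless. *)
have [g g0 hg] := gap [seq f.[odflt 0 x] - b | x <- s].
(* In turn: the twist stays in the disc where fibres are separated, its displacement of at most
   [4 * rho] lifts to one below [e'], and it fixes the values other than [b] of [f] on [A]. *)
pose rho := Num.min (del / 4) (Num.min (eta / 5) (g / 4)).
have rho0 : 0 < rho by rewrite !lt_min !divr_gt0.
have [r1 r2 r3] : [/\ rho <= del / 4, rho <= eta / 5 & rho <= g / 4].
  by rewrite !ge_min !lexx !orbT.
(* The centre is at distance [rho] from [b], since a twist about [b] would not move [b]. *)
pose c : C := b - Complex rho 0.
have bc : nm (b - c) = rho by rewrite /c opprB addrC subrK nm_real gtr0_norm.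
have rd : 3 * rho < del by move: r1 rho0; clear; lra.
have near z w : nm (w - f.[z]) <= 4 * rho -> exists2 z', f.[z'] = w & nm (z' - z) < e'.
  by move=> hw; apply: heta; apply: le_lt_trans hw _; move: r2 rho0; clear; lra.
pose T := branch rho0 e'0 rd bc near.
have TP := branchP rho0 e'0 rd bc near.
have opH : orient_pres (lift (twist c rho 1)).
  apply: (@lift_orient_pres R (twist c rho) (fun t => twist c rho (- t)) (nm c + 2 * rho)).
  - exact: twist_jcont.
  - move=> t z e1 e10; have [e2 e20 h2] := twist_jcont c rho0 (- t) z e10.
    by exists e2 => // s' z' hs; apply: h2; rewrite opprK addrC distrC.
  - move=> t z hz; apply: twist_out => //; have := nm_ler z c.
    by move: hz; clear; lra.
  - move=> t z hz; apply: twist_out => //; have := nm_ler z c.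
    by move: hz; clear; lra.
  - by move=> t; exact: twistK.
  - by move=> t z; have := twistK c rho (- t) z; rewrite opprK.
  by move=> z; exact: twist0.
have opT : orient_pres (lift (T 1)) by exact: (branch_orient_pres sf rho0 e'0 sep e'k).
have rf : rational_map (rat_eval f 1).
  by exists (maxn (size f) (size (1 : {poly C}))).-1, f, 1; split => //; exact: coprimep1.
have id_op := orient_pres_id R.
have [|x|M [hM [H [[_ _ H3] H0 H1]]]] := ctp _ _ _ _ _ _ id_op opH id_op opT rf rf.
- by [].
- case: x => [z|]; last by rewrite [lift (T 1) _]/= (rat_eval1_infty sf).
  by rewrite [lift (T 1) _]/= !rat_eval1 /=; have [-> _ _] := TP 1 z.
exists (T 1), (twist c rho 1 b), M; split => //.
- have := branchK rho0 e'0 sep e'k rd bc near 1 => K; exact: can_inj K.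
- rewrite /twist bc; apply/eqP => h.
  have : rot (1 * bump rho rho) * (b - c) = 1 * (b - c).
    by rewrite [RHS]mul1r; apply: (addrI c); rewrite [LHS]h subrKC.
  have bc0 : b - c != 0 by rewrite -nm_gt0 bc.
  move/(mulIf bc0)/eqP; apply/negP; apply: rot_neq1; rewrite mul1r /bump.
  rewrite invfM mulrCA divff ?gt_eqF // mulr1.
  have half : (0 : R) < 1 - 2^-1 by clear; lra.
  by rewrite maxEle (ltW half).
- move=> z Az; split.
  + rewrite -H1 -[RHS]/(lift (T 1) (Some z)) -H0; apply: H3; first by rewrite ler01 lexx.
    by exists (Some z).
  + move=> fz; have [f1 n1 _] := TP 1 z; split; first exact: lt_le_trans e'e.
    by rewrite f1 fz.
  + move=> fz; apply: (branch_id rho0 e'0 sep e'k); rewrite twist_out //.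
    have h1 : g <= nm (f.[z] - b).
      apply: hg; last by rewrite subr_eq0.
      by apply/mapP; exists (Some z) => //; apply/As.
    have := nm_tri c f.[z] b; rewrite (nm_sym c b) bc.
    by move: h1 r3 g0; clear; lra.
move=> An; rewrite -H1 -[RHS]/(lift (T 1) None) -H0; apply: H3; first by rewrite ler01 lexx.
by exists None.
Qed.
End Deformation.

(** * Configurations rigid under the deformation *)

Section Mobius.
Variable R : realType.
Local Notation C := R[i].
Implicit Types (M : sphere R -> sphere R).

Lemma mobiusE M : mobius M -> exists p0 p1 q0 q1 : C,
  (forall z w : C, M (Some z) = Some w -> q0 + q1 * z != 0 /\ w = (p0 + p1 * z) / (q0 + q1 * z))
  /\ (M None = None -> q1 = 0).
Proof.
move=> [p [q [_ /esym pq hM]]]; exists p`_0, p`_1, q`_0, q`_1.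
have [sp sq] : (size p <= 2)%N /\ (size q <= 2)%N.
  by move: pq; case: (size p) (size q) => [|[|[|m]]] [|[|[|k]]] //=; lia.
have lin (r : {poly C}) z : (size r <= 2)%N -> r.[z] = r`_0 + r`_1 * z.
  move=> sr; rewrite (horner_coef_wide _ sr) !big_ord_recl big_ord0 /=.
  by rewrite expr0 expr1 mulr1 addr0.
split.
  move=> z w; rewrite hM /rat_eval -!lin //.
  by case: (eqVneq q.[z] 0) => // qz [<-].
rewrite hM /rat_eval; case: ltnP => [h _|h]; last by case: ifP.
by apply: nth_default; rewrite -ltnS; exact: leq_trans sp.
Qed.

Lemma mobius_cross M (z1 z2 z3 z4 w1 w2 w3 w4 : C) : mobius M ->
  M (Some z1) = Some w1 -> M (Some z2) = Some w2 ->
  M (Some z3) = Some w3 -> M (Some z4) = Some w4 ->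
  (w1 - w2) * (w3 - w4) * ((z1 - z3) * (z2 - z4)) =
  (w1 - w3) * (w2 - w4) * ((z1 - z2) * (z3 - z4)).
Proof.
move=> /mobiusE[p0 [p1 [q0 [q1 [h _]]]]].
by move=> /h[n1 ->] /h[n2 ->] /h[n3 ->] /h[n4 ->]; field; rewrite n1 n2 n3 n4.
Qed.

Lemma mobius_affine M (z1 z2 z3 w1 w2 w3 : C) : mobius M -> M None = None ->
  M (Some z1) = Some w1 -> M (Some z2) = Some w2 -> M (Some z3) = Some w3 ->
  (w1 - w2) * (z1 - z3) = (w1 - w3) * (z1 - z2).
Proof.
move=> /mobiusE[p0 [p1 [q0 [q1 [h hn]]]]] /hn q10; rewrite {}q10 in h.
move=> /h[n1 ->] /h[n2 ->] /h[n3 ->]; rewrite !mul0r !addr0 in n1 n2 n3 *.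
by field.
Qed.
End Mobius.

(** * Affine symmetries of a polynomial *)

Section Symmetry.
Variable R : realType.
Local Notation C := R[i].
Variables (f : {poly C}) (d : nat).
Hypothesis sf : size f = d.+3.
Implicit Types (q s z u x a : C).

Lemma lead_neq0 : f`_d.+2 != 0.
Proof. by have := lead_gt0 sf; rewrite lead_coefE sf nm_gt0. Qed.

(* The barycentre of the fibres: the root of the derivative of order [deg f - 1]. *)
Lemma center_exists : exists b : C, forall q s, f \Po (q *: 'X + s%:P) = f -> s = b * (1 - q).
Proof.
pose L := f^`(d.+1).
have L1 : L`_1 != 0.
  rewrite coef_derivn addn1 -mulr_natr mulf_neq0 ?lead_neq0 //.
  by rewrite pnatr_eq0 -lt0n ffact_gt0.
have sL : (size L <= 2)%N.
  apply/leq_sizeP => j j2; rewrite coef_derivn nth_default ?mul0rn // sf.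
  by rewrite -[d.+3]/((d.+1).+2) -addn2 leq_add2l.
have linL z : L.[z] = L`_0 + L`_1 * z.
  rewrite (horner_coef_wide _ sL) !big_ord_recl big_ord0 /=.
  by rewrite expr0 expr1 mulr1 addr0.
exists (- L`_0 / L`_1) => q s fE.
have q0 : q != 0.
  apply: contraTneq isT => q0; move: fE; rewrite q0 scale0r add0r comp_polyCr => fE.
  by have := sf; rewrite -fE; case: eqP (size_polyC f.[s]) => //= _ ->.
have dE k : f^`(k) = q ^+ k *: (f^`(k) \Po (q *: 'X + s%:P)).
  elim: k => [|k IH]; first by rewrite expr0 scale1r fE.
  rewrite derivnS {1}IH derivZ deriv_comp derivD derivZ derivX derivC addr0.
  by rewrite -scalerAr mulr1 scalerA -exprSr.
have E z : L.[z] = q ^+ d.+1 * L.[q * z + s].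
  by rewrite {1}/L dE hornerZ horner_comp !hornerE.
have := E (- L`_0 / L`_1); rewrite linL mulrCA divff // mulr1 subrr.
move=> /esym/eqP; rewrite mulf_eq0 expf_eq0 (negPf q0) andbF /= linL => /eqP h.
move: (L`_0) (L`_1) L1 h => l0 l1 l10 h.
have hs : s = (l0 + l1 * (q * (- l0 / l1) + s)) / l1 - l0 / l1 - q * (- l0 / l1) by field.
by rewrite hs h; field.
Qed.

Definition symmetric_point a x : Prop :=
  exists q s, f \Po (q *: 'X + s%:P) = f /\ x = q * a + s.

Lemma symmetryE q s z : f \Po (q *: 'X + s%:P) = f -> f.[q * z + s] = f.[z].
Proof. by move=> fE; rewrite -{2}fE horner_comp !hornerE. Qed.

Lemma affine_symmetry_near q s a :
  (forall e : R, 0 < e -> exists z, [/\ nm (z - a) < e, z != a & f.[q * z + s] = f.[z]]) ->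
  f \Po (q *: 'X + s%:P) = f.
Proof.
move=> h; apply/eqP; rewrite -subr_eq0; apply/eqP/(@poly_eq0_near R _ a) => e e0.
have [z [h1 h2 h3]] := h e e0; exists z; split => //.
by rewrite hornerD hornerN horner_comp !hornerE h3 subrr.
Qed.

(* A Moebius map with a finite pole cannot preserve the fibres of a polynomial. *)
Lemma no_finite_pole (a n0 n1 d0 d1 : C) : d1 != 0 -> n1 * d0 - n0 * d1 != 0 ->
  (forall e : R, 0 < e -> exists z w : C,
     [/\ nm (z - a) < e, z != a, f.[w] = f.[z] & w * (d0 + d1 * z) = n0 + n1 * z]) -> False.
Proof.
move=> d10 det h; pose num : {poly C} := n0%:P + n1 *: 'X; pose den : {poly C} := d0%:P + d1 *: 'X.
have numE z : num.[z] = n0 + n1 * z by rewrite /num !hornerE.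
have denE z : den.[z] = d0 + d1 * z by rewrite /den !hornerE.
(* The difference of [f] at [num / den] and [f], multiplied by [den ^+ d.+2]. At the zero of [den]
   only the leading term survives, so [num] would vanish there too, against the determinant. *)
pose P := \sum_(i < d.+3) f`_i *: (num ^+ i * den ^+ (d.+2 - i)) - f * den ^+ d.+2.
have PE z : P.[z] = \sum_(i < d.+3) f`_i * ((n0 + n1 * z) ^+ i * (d0 + d1 * z) ^+ (d.+2 - i))
    - f.[z] * (d0 + d1 * z) ^+ d.+2.
  rewrite /P hornerD hornerN hornerM horner_exp denE; congr (_ - _).
  rewrite horner_sum; apply: eq_bigr => i _.
  by rewrite hornerZ hornerM !horner_exp numE denE.
have P0 : P = 0.
  apply: (@poly_eq0_near R _ a) => e e0; have [z [w [h1 h2 h3 h4]]] := h e e0.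
  exists z; split => //; rewrite PE -h4 -h3 (horner_coef f) sf mulr_suml -sumrB.
  apply: big1 => i _; rewrite exprMn -!mulrA -exprD.
  by rewrite subnKC ?subrr // -ltnS ltn_ord.
have dz : d0 + d1 * (- d0 / d1) = 0 by field.
have := PE (- d0 / d1); rewrite P0 horner0 dz expr0n mulr0 subr0.
rewrite (bigD1 ord_max) //= subnn expr0 mulr1 big1.
  rewrite addr0 => /esym/eqP; rewrite mulf_eq0 (negPf lead_neq0) expf_eq0 /= => /eqP E.
  move/eqP: det; apply; rewrite -[RHS](mulr0 (- d1)) -E; field; exact: d10.
move=> i ni; rewrite expr0n subn_eq0 leqNgt.
have -> : (i < d.+2)%N.
  rewrite ltn_neqAle -ltnS ltn_ord andbT.
  by apply: contra ni => /eqP h'; apply/eqP/val_inj.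
by rewrite /= !mulr0.
Qed.

End Symmetry.

(** * Distribution of the points of [A] between moving and fixed ones *)

Section Configurations.
Variable R : realType.
Local Notation C := R[i].
Variables (f : {poly C}) (d : nat).
Hypothesis sf : size f = d.+3.
Variables (A : sphere R -> Prop) (a beta : C).
Implicit Types (q s z u x y v w : C).
Hypothesis Aa : A (Some a).
Hypothesis deform : forall e : R, 0 < e -> exists (T : C -> C) (w : C) (M : sphere R -> sphere R),
  [/\ mobius M, injective T, w != f.[a],
      forall z, A (Some z) -> [/\ M (Some z) = Some (T z),
        f.[z] = f.[a] -> nm (T z - z) < e /\ f.[T z] = w & f.[z] != f.[a] -> T z = z]
    & A None -> M None = None].
Hypothesis inj : forall z, f.[z] = f.[a] -> exists2 r : R, 0 < r &
  forall z1 z2 : C, nm (z1 - z) < r -> nm (z2 - z) < r -> f.[z1] = f.[z2] -> z1 = z2.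
Hypothesis center : forall q s, f \Po (q *: 'X + s%:P) = f -> s = beta * (1 - q).

Local Notation fib x := (f.[x] = f.[a]).
Local Notation Sym x := (symmetric_point f a x).

Lemma sub_neq0 x y : x != y -> x - y != 0. Proof. by rewrite subr_eq0. Qed.

Lemma sym_infty x y : A None -> A (Some x) -> A (Some y) -> uniq [:: a; x; y] ->
  fib x -> fib y -> Sym x.
Proof.
move=> An Ax Ay u fx fy.
have [ax ay xy] : [/\ a != x, a != y & x != y].
  by move: u; rewrite /= !inE !negb_or => /and3P[/andP[]].
have ay0 := sub_neq0 ay.
apply: (affine_symmetry3 sf (or_introl (erefl (fun=> 1))) (k := (a - x) / (a - y))).
  apply: contraNneq xy => h; have := divfK ay0 (a - x); rewrite h mul1r => h'.
  by apply/eqP/oppr_inj/(addrI a).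
move=> e e0; have [T [w [M [mM iT wb hA hN]]]] := deform e0.
have [Ma na _] := hA a Aa; have [Mx nx _] := hA x Ax; have [My ny _] := hA y Ay.
have [na1 na2] := na erefl; have [nx1 nx2] := nx fx; have [ny1 ny2] := ny fy.
exists (T a), (T x), (T y); split; rewrite ?na2 ?nx2 ?ny2 //.
  by rewrite -[[:: _; _; _]]/(map T [:: a; x; y]) map_inj_uniq.
have := mobius_affine mM (hN An) Ma Mx My; rewrite !mulr1 => h.
by apply: (mulIf ay0); rewrite h mulrAC divfK // mulrC.
Qed.

Lemma sym_finite x y v : A (Some x) -> A (Some y) -> A (Some v) -> uniq [:: a; x; y; v] ->
  fib x -> fib y -> f.[v] != f.[a] -> Sym x.
Proof.
move=> Ax Ay Av u fx fy fv.
have [[ax ay av] [xy xv yv]] : [/\ a != x, a != y & a != v] /\ [/\ x != y, x != v & y != v].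
  by move: u; rewrite /= !inE !negb_or => /and4P[/and3P[? ? ?] /andP[? ?] ? _].
have n1 := sub_neq0 ay; have n2 := sub_neq0 xv.
pose k := (a - x) * (y - v) / ((a - y) * (x - v)).
apply: (affine_symmetry3 sf (L := fun z => z - v) (k := k)); first by right; exists v.
  apply/eqP => k1; have E : (a - v) * (y - x) = 0.
    have -> : (a - v) * (y - x) = (a - x) * (y - v) - (a - y) * (x - v) by ring.
    by rewrite -[X in X - _](divfK (mulf_neq0 n1 n2)) -/k k1 mul1r subrr.
  by move/eqP: E; rewrite mulf_eq0 !subr_eq0 (negPf av) eq_sym (negPf xy).
move=> e e0; have [T [w [M [mM iT wb hA _]]]] := deform e0.
have [Ma na _] := hA a Aa; have [Mx nx _] := hA x Ax; have [My ny _] := hA y Ay.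
have [Mv _ nv] := hA v Av; rewrite nv // in Mv.
have [na1 na2] := na erefl; have [nx1 nx2] := nx fx; have [ny1 ny2] := ny fy.
exists (T a), (T x), (T y); split; rewrite ?na2 ?nx2 ?ny2 //.
  by rewrite -[[:: _; _; _]]/(map T [:: a; x; y]) map_inj_uniq //
    (subseq_uniq _ u) ?(prefix_subseq [:: a; x; y] [:: v]).
have h := mobius_cross mM Ma Mx My Mv.
have n3 := mulf_neq0 n1 n2.
apply: (mulIf n3); rewrite h /k; field; rewrite ?n1 ?n2 //.
Qed.

Lemma sym_four x y v : A (Some x) -> A (Some y) -> A (Some v) -> uniq [:: a; x; y; v] ->
  fib x -> fib y -> fib v -> Sym x.
Proof.
move=> Ax Ay Av u fx fy fv.
have [[ax ay av] [xy xv yv]] : [/\ a != x, a != y & a != v] /\ [/\ x != y, x != v & y != v].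
  by move: u; rewrite /= !inE !negb_or => /and4P[/and3P[? ? ?] /andP[? ?] ? _].
have n1 := sub_neq0 ay; have n2 := sub_neq0 xv.
pose k := (a - x) * (y - v) / ((a - y) * (x - v)).
apply: (affine_symmetry4 sf (k := k)).
  by rewrite mulf_neq0 ?invr_eq0 ?mulf_neq0 ?sub_neq0.
move=> e e0; have [T [w [M [mM iT wb hA _]]]] := deform e0.
have [Ma na _] := hA a Aa; have [Mx nx _] := hA x Ax; have [My ny _] := hA y Ay.
have [Mv nv _] := hA v Av.
have [na1 na2] := na erefl; have [nx1 nx2] := nx fx; have [ny1 ny2] := ny fy.
have [nv1 nv2] := nv fv.
exists (T a), (T x), (T y), (T v); split; rewrite ?na2 ?nx2 ?ny2 ?nv2 //.
  by rewrite -[[:: _; _; _; _]]/(map T [:: a; x; y; v]) map_inj_uniq.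
have h := mobius_cross mM Ma Mx My Mv.
have n3 := mulf_neq0 n1 n2.
apply: (mulIf n3); rewrite h /k; field; rewrite ?n1 ?n2 //.
Qed.

Lemma move_neq (T : C -> C) w : w != f.[a] -> f.[T a] = w -> T a != a.
Proof. by move=> wb fw; apply: contraNneq wb => h; rewrite -fw h. Qed.

(** A Moebius map fixing infinity and [y] is a homothety about [y], so [T x] is an affine function
    of [T a] that does not depend on the deformation. This function is a symmetry of [f] fixing [y],
    which must be the centre. *)
Lemma sym_fixed x y : A None -> A (Some x) -> A (Some y) -> uniq [:: a; x; y] ->
  fib x -> f.[y] != f.[a] -> Sym x /\ y = beta.
Proof.
move=> An Ax Ay u fx fy.
have [ax ay xy] : [/\ a != x, a != y & x != y].
  by move: u; rewrite /= !inE !negb_or => /and3P[/andP[]].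
have ay0 := sub_neq0 ay.
pose k := (a - x) / (a - y).
have k0 : k != 0 by rewrite mulf_neq0 ?invr_eq0 ?sub_neq0.
have fE : f \Po ((1 - k) *: 'X + (k * y)%:P) = f.
  apply: (affine_symmetry_near (a := a)) => e e0.
  have [T [w [M [mM iT wb hA hN]]]] := deform e0.
  have [Ma na _] := hA a Aa; have [Mx nx _] := hA x Ax; have [My _ ny] := hA y Ay.
  have [na1 na2] := na erefl; have [nx1 nx2] := nx fx; rewrite ny // in My.
  exists (T a); split => //; first exact: move_neq wb na2.
  suff -> : (1 - k) * T a + k * y = T x by rewrite nx2 na2.
  have h := mobius_affine mM (hN An) Ma Mx My.
  have E : T x = T a - k * (T a - y).
    rewrite -[LHS](subKr (T a)); congr (_ - _); apply: (mulIf ay0).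
    by rewrite h /k mulrAC divfK // mulrC.
  by rewrite E; ring.
have xE : x = (1 - k) * a + k * y by rewrite /k; field.
split; first by exists (1 - k), (k * y).
by apply: (mulfI k0); rewrite (center fE) subKr mulrC.
Qed.

Lemma none_infty x y : A None -> A (Some x) -> A (Some y) -> uniq [:: a; x; y] ->
  f.[x] != f.[a] -> f.[y] != f.[a] -> False.
Proof.
move=> An Ax Ay u fx fy.
have [ax ay xy] : [/\ a != x, a != y & x != y].
  by move: u; rewrite /= !inE !negb_or => /and3P[/andP[]].
have [T [w [M [mM iT wb hA hN]]]] := deform ltr01.
have [Ma na _] := hA a Aa; have [Mx _ nx] := hA x Ax; have [My _ ny] := hA y Ay.
rewrite nx // in Mx; rewrite ny // in My; have [na1 na2] := na erefl.
have h := mobius_affine mM (hN An) Ma Mx My.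
have : (T a - a) * (x - y) = 0.
  have -> : (T a - a) * (x - y) = (T a - x) * (a - y) - (T a - y) * (a - x) by ring.
  by rewrite h subrr.
move/eqP; rewrite mulf_eq0 !subr_eq0 (negPf xy) orbF; apply/negP.
exact: move_neq wb na2.
Qed.

Lemma none_finite x y v : A (Some x) -> A (Some y) -> A (Some v) -> uniq [:: a; x; y; v] ->
  f.[x] != f.[a] -> f.[y] != f.[a] -> f.[v] != f.[a] -> False.
Proof.
move=> Ax Ay Av u fx fy fv.
have [[ax ay av] [xy xv yv]] : [/\ a != x, a != y & a != v] /\ [/\ x != y, x != v & y != v].
  by move: u; rewrite /= !inE !negb_or => /and4P[/and3P[? ? ?] /andP[? ?] ? _].
have [T [w [M [mM iT wb hA hN]]]] := deform ltr01.
have [Ma na _] := hA a Aa; have [Mx _ nx] := hA x Ax; have [My _ ny] := hA y Ay.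
have [Mv _ nv] := hA v Av.
rewrite nx // in Mx; rewrite ny // in My; rewrite nv // in Mv; have [na1 na2] := na erefl.
have h := mobius_cross mM Ma Mx My Mv.
have : (T a - a) * ((x - y) * (y - v) * (x - v)) = 0.
  have -> : (T a - a) * ((x - y) * (y - v) * (x - v)) =
    (T a - x) * (y - v) * ((a - y) * (x - v)) - (T a - y) * (x - v) * ((a - x) * (y - v)) by ring.
  by rewrite h subrr.
move/eqP; rewrite !mulf_eq0 !subr_eq0 (negPf xy) (negPf xv) (negPf yv) !orbF; apply/negP.
exact: move_neq wb na2.
Qed.

(** With two finite fixed points [y] and [v], solving the cross-ratio relation for [T x] makes it a
    homographic function of [T a] with a finite pole, and this function would preserve the fibres of
    [f]. *)
Lemma one_finite x y v : A (Some x) -> A (Some y) -> A (Some v) -> uniq [:: a; x; y; v] ->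
  fib x -> f.[y] != f.[a] -> f.[v] != f.[a] -> False.
Proof.
move=> Ax Ay Av u fx fy fv.
have [[ax ay av] [xy xv yv]] : [/\ a != x, a != y & a != v] /\ [/\ x != y, x != v & y != v].
  by move: u; rewrite /= !inE !negb_or => /and4P[/and3P[? ? ?] /andP[? ?] ? _].
pose K1 := (a - y) * (x - v); pose K2 := (a - x) * (y - v).
have K10 : K1 != 0 by rewrite mulf_neq0 ?sub_neq0.
have K20 : K2 != 0 by rewrite mulf_neq0 ?sub_neq0.
have K12 : K1 - K2 != 0.
  rewrite (_ : K1 - K2 = - ((a - v) * (y - x))); last by rewrite /K1 /K2; ring.
  by rewrite oppr_eq0 mulf_neq0 ?sub_neq0 // eq_sym.
apply: (@no_finite_pole R f d sf a (- (K2 * y * v)) ((y - v) * K1 + K2 * v)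
  ((y - v) * K1 - K2 * y) K2 K20).
  have -> : ((y - v) * K1 + K2 * v) * ((y - v) * K1 - K2 * y) - - (K2 * y * v) * K2 =
    (y - v) ^+ 2 * (K1 * (K1 - K2)) by ring.
  apply: mulf_neq0; last exact: mulf_neq0.
  by rewrite expf_neq0 ?sub_neq0.
move=> e e0; have [T [w [M [mM iT wb hA hN]]]] := deform e0.
have [Ma na _] := hA a Aa; have [Mx nx _] := hA x Ax; have [My _ ny] := hA y Ay.
have [Mv _ nv] := hA v Av.
rewrite ny // in My; rewrite nv // in Mv; have [na1 na2] := na erefl; have [nx1 nx2] := nx fx.
have h := mobius_cross mM Ma Mx My Mv.
exists (T a), (T x); split; rewrite ?nx2 ?na2 //; first exact: move_neq wb na2.
move: h; rewrite -/K1 -/K2 => h.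
have E : T x * ((y - v) * K1 - K2 * y + K2 * T a) -
    (- (K2 * y * v) + ((y - v) * K1 + K2 * v) * T a) =
   (T a - y) * (T x - v) * K2 - (T a - T x) * (y - v) * K1 by ring.
by apply/eqP; rewrite -subr_eq0 E h subrr.
Qed.

(** By [sym_finite], [x] and [y] are images of [a] under symmetries centred at [beta], of factors
    [q] and [p]. Local injectivity gives the same for the displaced points, so the cross-ratio
    relation becomes a quadratic equation in [T a - beta] with zeros accumulating at [a]. Its
    coefficients vanish, and [v != beta] would force [p = q], hence [x = y]. *)
Lemma center_finite x y v : A (Some x) -> A (Some y) -> A (Some v) -> uniq [:: a; x; y; v] ->
  fib x -> fib y -> f.[v] != f.[a] -> v = beta.
Proof.
move=> Ax Ay Av u fx fy fv.
have [[ax ay av] [xy xv yv]] : [/\ a != x, a != y & a != v] /\ [/\ x != y, x != v & y != v].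
  by move: u; rewrite /= !inE !negb_or => /and4P[/and3P[? ? ?] /andP[? ?] ? _].
have [q [s [qE xE]]] := sym_finite Ax Ay Av u fx fy fv.
have u' : uniq [:: a; y; x; v].
  by rewrite /= !inE !negb_or ax ay av (eq_sym y) xy yv xv.
have [p [t [pE yE]]] := sym_finite Ay Ax Av u' fy fx fv.
have sE := center qE; have tE := center pE.
pose K1 := (a - y) * (x - v); pose K2 := (a - x) * (y - v).
have K10 : K1 != 0 by rewrite mulf_neq0 ?sub_neq0.
pose c2 := (1 - q) * p * K1 - (1 - p) * q * K2.
pose c1 := (beta - v) * ((1 - q) * K1 - (1 - p) * K2).
pose P : {poly C} := c2 *: ('X - beta%:P) ^+ 2 + c1 *: ('X - beta%:P).
have PE z : P.[z] = c2 * (z - beta) ^+ 2 + c1 * (z - beta).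
  by rewrite /P hornerD !hornerZ horner_exp hornerXsubC.
have P0 : P = 0.
  apply: (@poly_eq0_near R _ a) => e e0.
  have [r1 r10 h1] := inj fx; have [r2 r20 h2] := inj fy.
  have n0 : 0 < 1 + nm q + nm p by rewrite -addrA ltr_wpDr // addr_ge0 ?nm_ge0.
  pose r := Num.min r1 r2.
  have r0 : 0 < r by rewrite lt_min r10.
  have e'0 : 0 < Num.min e (r / (1 + nm q + nm p)) by rewrite lt_min e0 divr_gt0.
  have [T [w [M [mM iT wb hA hN]]]] := deform e'0.
  have [Ma na _] := hA a Aa; have [Mx nx _] := hA x Ax; have [My ny _] := hA y Ay.
  have [Mv _ nv] := hA v Av; rewrite nv // in Mv.
  have [na1 na2] := na erefl; have [nx1 nx2] := nx fx; have [ny1 ny2] := ny fy.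
  have small (m n : R) : 0 <= n -> n <= 1 + nm q + nm p ->
      m < Num.min e (r / (1 + nm q + nm p)) -> 0 <= m -> n * m < r.
    move=> n0' nn; rewrite lt_min => /andP[_]; rewrite ltr_pdivlMr // => mr m0.
    apply: le_lt_trans mr; rewrite mulrC; exact: ler_wpM2l.
  have [rr1 rr2] : r <= r1 /\ r <= r2 by rewrite !ge_min !lexx orbT.
  have q0 := nm_ge0 q; have p0 := nm_ge0 p.
  have TxE : T x = q * T a + s.
    apply: h1; last by rewrite (symmetryE _ qE) nx2 na2.
      rewrite -[X in X < _]mul1r; apply: lt_le_trans rr1; apply: small nx1 (nm_ge0 _) => //.
      by rewrite -addrA lerDl addr_ge0.
    rewrite [X in _ - X]xE (_ : _ - _ = q * (T a - a)); last by ring.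
    rewrite nmM; apply: lt_le_trans rr1; apply: small na1 (nm_ge0 _) => //.
    by rewrite addrAC lerDr addr_ge0.
  have TyE : T y = p * T a + t.
    apply: h2; last by rewrite (symmetryE _ pE) ny2 na2.
      rewrite -[X in X < _]mul1r; apply: lt_le_trans rr2; apply: small ny1 (nm_ge0 _) => //.
      by rewrite -addrA lerDl addr_ge0.
    rewrite [X in _ - X]yE (_ : _ - _ = p * (T a - a)); last by ring.
    rewrite nmM; apply: lt_le_trans rr2; apply: small na1 (nm_ge0 _) => //.
    by rewrite lerDr addr_ge0.
  exists (T a); split; first by move: na1; rewrite lt_min => /andP[].
    exact: move_neq wb na2.
  have h := mobius_cross mM Ma Mx My Mv; rewrite -/K1 -/K2 in h.
  rewrite PE -(subrr ((T a - T x) * (T y - v) * K1)) {2}h TxE TyE sE tE /c2 /c1; ring.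
apply/eqP; apply: contraT => vb.
have bv : beta - v != 0 by rewrite subr_eq0 eq_sym.
have c2c1 : c2 = 0 /\ c1 = 0.
  have := PE (beta + 1); have := PE (beta - 1); rewrite P0 !horner0.
  rewrite [beta + 1 - beta]addrAC [beta - 1 - beta]addrAC subrr !add0r sqrrN expr1n !mulr1 mulrN1.
  move=> h1 h2; have c20 : c2 = 0.
    have : c2 *+ 2 = 0 by rewrite -[RHS]addr0 {1}h1 h2 mulr2n; ring.
    by move/eqP; rewrite mulrn_eq0 /= => /eqP.
  by split=> //; rewrite h2 c20 add0r.
have [c20 /eqP] := c2c1; rewrite mulf_eq0 (negPf bv) /= subr_eq0 => /eqP c10.
have q1 : 1 - q != 0.
  rewrite subr_eq0 eq_sym; apply: contraNneq ax => q1.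
  by rewrite xE sE q1 subrr mulr0 addr0 mul1r.
have : (1 - q) * K1 * (p - q) = 0.
  have -> : (1 - q) * K1 * (p - q) = c2 + q * ((1 - p) * K2 - (1 - q) * K1) by rewrite /c2; ring.
  by rewrite c20 c10 subrr mulr0 addr0.
move/eqP; rewrite mulf_eq0 (mulf_eq0 (1 - q)) (negPf q1) (negPf K10) /= subr_eq0 => /eqP pq.
by move: xy; rewrite xE yE sE tE pq eqxx.
Qed.

Lemma pair_infty_case x y : A None -> A (Some x) -> A (Some y) -> uniq [:: a; x; y] ->
  (fib x /\ Sym x) \/ x = beta.
Proof.
move=> An Ax Ay u.
have u' : uniq [:: a; y; x].
  by move: u; rewrite /= !inE !negb_or (eq_sym y) => /and3P[/andP[-> ->] ->].
have [fx|fx] := eqVneq f.[x] f.[a]; have [fy|fy] := eqVneq f.[y] f.[a].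
- by left; split=> //; exact: sym_infty Ay u fx fy.
- by left; split=> //; have [] := sym_fixed An Ax Ay u fx fy.
- by right; have [] := sym_fixed An Ay Ax u' fy fx.
- by case: (none_infty An Ax Ay u fx fy).
Qed.

Lemma triple_case x y v : A (Some x) -> A (Some y) -> A (Some v) -> uniq [:: a; x; y; v] ->
  (fib x /\ Sym x) \/ x = beta.
Proof.
move=> Ax Ay Av u.
have perm (l : seq C) : perm_eq l [:: a; x; y; v] -> uniq l by move/perm_uniq => ->.
have u1 : uniq [:: a; x; v; y] by apply: perm; rewrite !perm_cons (perm_catC [:: v] [:: y]).
have u2 : uniq [:: a; y; v; x].
  by apply: perm; rewrite perm_cons (perm_catC [:: y; v] [:: x]).
have u3 : uniq [:: a; y; x; v].
  by apply: perm; rewrite perm_cons (perm_catCA [:: y] [:: x] [:: v]).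
have u4 : uniq [:: a; v; x; y].
  by apply: perm; rewrite perm_cons (perm_catC [:: v] [:: x; y]).
have [fx|fx] := eqVneq f.[x] f.[a]; have [fy|fy] := eqVneq f.[y] f.[a];
  have [fv|fv] := eqVneq f.[v] f.[a].
- by left; split=> //; exact: sym_four Ay Av u fx fy fv.
- by left; split=> //; exact: sym_finite Ay Av u fx fy fv.
- by left; split=> //; exact: sym_finite Av Ay u1 fx fv fy.
- by case: (one_finite Ax Ay Av u fx fy fv).
- by right; exact: center_finite Ay Av Ax u2 fy fv fx.
- by case: (one_finite Ay Ax Av u3 fy fx fv).
- by case: (one_finite Av Ax Ay u4 fv fx fy).
- by case: (none_finite Ax Ay Av u fx fy fv).
Qed.

Lemma pick_other (l l' : seq (sphere R)) : uniq l -> (size l' < size l)%N ->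
  exists2 y : sphere R, y \in l & y \notin l'.
Proof.
move=> ul sl; have [/hasP[y yl yl']|] := boolP (has (fun y : sphere R => y \notin l') l).
  by exists y.
move=> /hasPn h; move: sl; rewrite ltnNge uniq_leq_size // => y /h.
by rewrite negbK.
Qed.

(** Besides [a] and [x] there are two more points of [A]; if one is infinity, [pair_infty_case]
    applies to the other. *)
Lemma configuration n x : has_card A n -> (4 <= n)%N -> A (Some x) -> x != a ->
  (fib x /\ Sym x) \/ x = beta.
Proof.
move=> [l [ul sl lA]] n4 Ax xa; rewrite -sl in n4.
have [y yl] := @pick_other l [:: Some a; Some x] ul (ltnW n4).
have [v vl] := @pick_other l [:: Some a; Some x; y] ul n4.
move: yl vl => /lA Ay /lA Av; rewrite !inE !negb_or.
case: y Ay => [y|] Ay; case: v Av => [v|] Av //.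
- move=> /and3P[va vx vy] /andP[ya yx].
  apply: triple_case Ay Av _ => //.
  by rewrite /= !inE !negb_or eq_sym xa (eq_sym a) ya (eq_sym a) va
    (eq_sym x) yx (eq_sym x) vx eq_sym vy.
- move=> _ /andP[ya yx]; apply: pair_infty_case Ay _ => //.
  by rewrite /= !inE !negb_or eq_sym xa (eq_sym a) ya (eq_sym x) yx.
- move=> /and3P[va vx _] _; apply: pair_infty_case Av _ => //.
  by rewrite /= !inE !negb_or eq_sym xa (eq_sym a) va (eq_sym x) vx.
Qed.

(** One of four points differs from [a], infinity and [beta]. Its symmetry makes the exponent of the
    power map at least 2. *)
Lemma exists_symmetric n : has_card A n -> (4 <= n)%N ->
  exists x, [/\ x != a, f.[x] = f.[a] & Sym x].
Proof.
move=> hA n4; have [l [ul sl lA]] := hA; rewrite -sl in n4.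
have [y yl] := @pick_other l [:: Some a; None; Some beta] ul n4.
move: yl => /lA; case: y => [y|] Ay; rewrite !inE !negb_or ?andbF // => /and3P[ya _ yb].
have {}n4 : (4 <= n)%N by rewrite -sl.
have [[fy sy]|yb'] := configuration hA n4 Ay ya; first by exists y.
by move: yb; rewrite yb' eqxx.
Qed.
End Configurations.

(** * Power maps *)

Section Power.
Variable R : realType.
Local Notation C := R[i].
Local Notation S2 := (sphere R).
Implicit Types (z u q a c : C) (f g : {poly C}).

Lemma expr_gcd (z : C) m n : z ^+ m = 1 -> z ^+ n = 1 -> z ^+ gcdn m n = 1.
Proof.
case: (posnP m) => [->|m0] zm zn; first by rewrite gcd0n.
have [km kn h _] := egcdnP n m0.
have : z ^+ (km * m) = 1 by rewrite mulnC exprM zm expr1n.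
by rewrite h exprD mulnC exprM zn expr1n mul1r.
Qed.

Lemma coef_comp_scale g q k : (g \Po (q *: 'X))`_k = g`_k * q ^+ k.
Proof.
rewrite coef_comp_poly; have E i : g`_i * ((q *: 'X) ^+ i)`_k = g`_i * (q ^+ i * (k == i)%:R).
  by rewrite exprZn coefZ coefXn.
case: (ltnP k (size g)) => hk.
  rewrite (bigD1 (Ordinal hk)) //= E eqxx mulr1 big1 ?addr0 // => i ik.
  rewrite E (_ : (k == i) = false) ?mulr0 //; apply/negbTE.
  by apply: contra ik => /eqP ki; apply/eqP/val_inj.
rewrite nth_default // mul0r; apply: big1 => i _; rewrite E gtn_eqF ?mulr0 //.
exact: leq_trans hk.
Qed.

(** Take for [r] the gcd of the exponents occurring in [g]. By Bezout, a rotation preserving [g] has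
    order dividing [r]. *)
Lemma exponent_gcd g d : size g = d.+3 -> exists r : nat, exists h : {poly C},
  [/\ (0 < r)%N, (1 < size h)%N, g = h \Po 'X^r &
    forall q : C, (forall k, g`_k != 0 -> q ^+ k = 1) -> q ^+ r = 1].
Proof.
move=> sg; pose r := \big[gcdn/0%N]_(k < size g | g`_k != 0) k.
have rdvd k : g`_k != 0 -> (r %| k)%N.
  move=> gk; have hk : (k < size g)%N.
    by rewrite ltnNge; apply: contra gk => /(nth_default 0) ->.
  by rewrite /r (bigD1 (Ordinal hk)) //= dvdn_gcdl.
have gd : g`_d.+2 != 0 by have := lead_gt0 sg; rewrite lead_coefE sg nm_gt0.
have r0 : (0 < r)%N by apply: (dvdn_gt0 _ (rdvd _ gd)).
pose h := \poly_(i < size g) g`_(i * r).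
have gh : g = h \Po 'X^r.
  apply/polyP => i; rewrite coef_comp_poly_Xn // coef_poly; case: ifP => [ri|ri].
    rewrite divnK //; case: ltnP => // hi; apply: nth_default; apply: leq_trans hi _.
    by rewrite leq_div.
  by apply/eqP; apply: contraFT ri; exact: rdvd.
exists r, h; split => //.
  rewrite ltnNge; apply/negP => /size1_polyC hc.
  have := sg; rewrite gh hc comp_polyC => sc.
  by have := size_polyC_leq1 h`_0; rewrite sc.
move=> q hq; rewrite /r; elim/big_rec: _ => [|k m gk IH]; first by rewrite expr0.
by apply: expr_gcd => //; exact: hq.
Qed.

Definition power_map (c : C) (r : nat) : S2 -> S2 := rat_eval (('X - c%:P) ^+ r) 1.

Lemma power_mapE c r z : power_map c r (Some z) = Some ((z - c) ^+ r).
Proof. by rewrite /power_map rat_eval1 horner_exp hornerXsubC. Qed.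

Lemma size_power c r : size (('X - c%:P) ^+ r : {poly C}) = r.+1.
Proof. by rewrite size_exp_XsubC. Qed.

Lemma power_map_infty c r : power_map c r.+1 None = None.
Proof. by rewrite /power_map (@rat_eval1_infty _ _ r) ?size_power. Qed.

Lemma power_map_regular c r z : z != c -> ~ critical_point (power_map c r.+1) (Some z).
Proof.
move=> zc; apply; have [g g0 hg] := unity_gap r (fun x _ _ => 1 - x : C).
set u := z - c; have u0 : 0 < nm u by rewrite nm_gt0 subr_eq0.
(* The quotient [t] of two points this near [z], measured from [c], differs from 1 by less than
   [2 * e / (nm u / 2)], which is at most [4 * g / 5]. *)
pose e := Num.min (nm u / 2) (nm u * g / 5).
have e0 : 0 < e by rewrite lt_min !divr_gt0 ?mulr_gt0.
have [e1 e2] : e <= nm u / 2 /\ e <= nm u * g / 5 by rewrite !ge_min !lexx orbT.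
have [del del0 hdel] := chordal_near z e0; exists del => // y y' /hdel[z1 -> h1] /hdel[z2 -> h2].
rewrite !power_mapE => -[h]; congr Some.
have n1 : nm u / 2 <= nm (z1 - c).
  have := nm_ler u (- (z1 - z)); rewrite nmN (_ : u - - _ = z1 - c); last by rewrite /u; ring.
  by move: h1 e1; clear; lra.
have n10 : 0 < nm (z1 - c) by apply: lt_le_trans n1; rewrite divr_gt0.
have n1' : z1 - c != 0 by rewrite -nm_gt0.
pose t := (z2 - c) / (z1 - c).
have t1 : t ^+ r.+1 = 1 by rewrite expr_div_n -h divff // expf_neq0.
have small : nm (1 - t) < g.
  rewrite (_ : 1 - t = ((z1 - z) - (z2 - z)) / (z1 - c)); last by rewrite /t; field.
  rewrite nmM nmV ltr_pdivrMr //.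
  have := nmB (z1 - z) (z2 - z); move: h1 h2 e2 n1 u0 g0; clear; nra.
have /eqP := hg t t t t1 t1 t1 small; rewrite subr_eq0 eq_sym => /eqP tE.
by apply: (addIr (- c)); rewrite -[RHS](divfK n1') -/t tE mul1r.
Qed.

(** The distinct points [c + t] and [c + q * t] have the same image, however small [t] is. *)
Lemma power_map_center c r q : q != 1 -> q ^+ r = 1 -> critical_point (power_map c r) (Some c).
Proof.
move=> q1 qr [e e0 he].
have r0 : (0 < r)%N.
  rewrite lt0n; apply/eqP => r0; have := he (Some c) (Some (c + Complex (e / 4) 0)).
  rewrite !power_mapE r0 !expr0.
  have e4 : 0 <= e / 4 by rewrite divr_ge0 // ltW.
  have := chordal_le c (c + Complex (e / 4) 0).
  rewrite opprD addNKr nmN nm_real ger0_norm // => h1.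
  have := chordal_le c c; rewrite subrr nm0 mulr0 => h2.
  have h1' : chordal (Some c) (Some (c + Complex (e / 4) 0)) < e by move: h1 e0; clear; lra.
  have h2' : chordal (Some c) (Some c) < e by move: h2 e0; clear; lra.
  move=> /(_ h2' h1' erefl) [] /eqP; rewrite -subr_eq0 opprD addNKr oppr_eq0 -nm_eq0.
  by rewrite nm_real normr_eq0 mulf_eq0 gt_eqF //= invr_eq0 pnatr_eq0.
have nq := nm_unit r0 qr.
pose t : C := Complex (e / 4) 0.
have tn : nm t = e / 4 by rewrite nm_real ger0_norm // divr_ge0 // ltW.
have near (v : C) : nm v = 1 -> chordal (Some c) (Some (c + v * t)) < e.
  move=> v1; apply: (le_lt_trans (chordal_le _ _)).
  by rewrite opprD addNKr nmN nmM v1 tn; move: e0; clear; lra.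
have := he _ _ (near 1 (nm1 R)) (near q nq); rewrite !power_mapE.
rewrite (_ : c + 1 * t - c = t); last by ring.
rewrite (_ : c + q * t - c = q * t) ?exprMn ?qr ?mul1r //; last by ring.
move=> /(_ erefl) [] /addrI h.
have t0 : t != 0 by rewrite -nm_gt0 tn divr_gt0.
by move: q1; rewrite -{1}[q](mulfK t0) -h divff // eqxx.
Qed.
End Power.

Theorem theorem2p2 (R : realType) (f : sphere R -> sphere R) (d : nat)
    (A : sphere R -> Prop) (n : nat) :
  (2 <= d)%N -> polynomial_deg d f ->
  (4 <= n)%N -> has_card A n ->
  CTP f A ->
  (exists2 a, A a & ~ crit_values f (f a)) ->
  exists s g : sphere R -> sphere R,
    [/\ belyi s, rational_map g, (forall x, f x = g (s x))
      & has_card (fun y => (exists2 a, A a & y = s a) \/ crit_values s y) 3].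
Proof.
move=> d2 [p [sp fE]] n4 cA ctp [a Aa rega].
have {fE} fE : f = rat_eval p 1 by apply: funext.
subst f; case: d d2 sp => [|[|d]] // _ sp.
case: a Aa rega => [a|] Aa rega; last first.
  case: rega; exists None; split => //; exact: infinity_critical sp.
have reg z : p.[z] = p.[a] -> ~ critical_point (rat_eval p 1) (Some z).
  by move=> pz cz; apply: rega; exists (Some z); rewrite !rat_eval1 pz.
have deform := CTP_deformation sp cA ctp reg.
have inj z (pz : p.[z] = p.[a]) := regular_injective (reg z pz).
have [beta center] := center_exists sp.
have conf x := configuration sp Aa deform inj center cA n4 (x := x).
(* Centred at [beta], the affine symmetries of [p] become rotations, whose factors [q] satisfy
   [q ^+ k = 1] for each exponent [k] occurring in [g]. *)
pose g := p \Po ('X + beta%:P).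
have gE u : g.[u] = p.[u + beta] by rewrite horner_comp !hornerE.
have sg : size g = d.+3 by rewrite size_comp_poly2 ?sp // size_XaddC.
have [r [h [r0 sh gh hr]]] := exponent_gcd sg.
have sym x : symmetric_point p a x -> exists q : R[i], q ^+ r = 1 /\ x - beta = q * (a - beta).
  move=> [q [s [qE xE]]]; have sE := center q s qE; exists q; split; last first.
    by rewrite xE sE; ring.
  have gq : g \Po (q *: 'X) = g.
    rewrite /g -{2}qE -!comp_polyA !comp_polyD !comp_polyZ !comp_polyX !comp_polyC.
    congr (p \Po _); rewrite scalerDr -addrA -[q *: beta%:P]mul_polyC -polyCM -polyCD sE.
    by congr (_ + _%:P); ring.
  apply: hr => k gk; apply: (mulfI gk); rewrite mulr1 -coef_comp_scale gq //.
have [x0 [x0a fx0 /sym[q0 [q0r x0E]]]] := exists_symmetric sp Aa deform inj center cA n4.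
have q01 : q0 != 1.
  by apply: contraNneq x0a => q01; move: x0E; rewrite q01 mul1r => /addIr ->.
(* Were [a] the centre, its symmetric image [x0] would be [a] itself. This keeps 0 and
   [(a - beta) ^+ r] distinct at the end. *)
have ab : a != beta.
  apply: contraNneq x0a => ab; move/eqP: x0E; rewrite ab subrr mulr0 subr_eq0.
  by [].
(* [q0 != 1] and [q0 ^+ r = 1] exclude [r = 1]. *)
have [r' rE] : exists r', r = r'.+2.
  case: r r0 q0r {gh hr sym} => [|[|r']] // _ q0r; last by exists r'.
  by move: q01; rewrite -[q0]expr1 q0r eqxx.
exists (power_map beta r), (rat_eval h 1).
have crit y : crit_values (power_map beta r) y <-> y \in [:: None; Some 0].
  rewrite rE; split.
    move=> [[z|] [cz <-]]; last by rewrite power_map_infty.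
    have [->|zb] := eqVneq z beta; first by rewrite power_mapE subrr expr0n /= !inE eqxx ?orbT.
    by case: (power_map_regular zb cz).
  rewrite !inE => /orP[]/eqP->.
    exists None; rewrite power_map_infty; split => //.
    exact: (infinity_critical (size_power beta r'.+2)).
  exists (Some beta); rewrite power_mapE subrr expr0n /=; split => //.
  by apply: power_map_center q01 _; rewrite -rE.
split.
- split.
    exists r; first by rewrite rE.
    exists (('X - beta%:P) ^+ r), 1; split => //; first exact: coprimep1.
    by rewrite size_power size_poly1 rE.
  by exists 2 => //; exists [:: None; Some 0].
- by exists (maxn (size h) (size (1 : {poly R[i]}))).-1, h, 1; split => //; exact: coprimep1.
- have [m hm] : exists m, size h = m.+2 by case: (size h) sh => [|[|m]] // _; exists m.
  case=> [z|]; last by rewrite rE power_map_infty (rat_eval1_infty sp) (rat_eval1_infty hm).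
  rewrite power_mapE !rat_eval1; congr Some.
  by rewrite -{1}(subrK beta z) -gE gh horner_comp hornerXn.
have fibre x : A (Some x) ->
    power_map beta r (Some x) \in [:: None; Some 0; Some ((a - beta) ^+ r)].
  move=> Ax; rewrite power_mapE; have [->|xa] := eqVneq x a; first by rewrite !inE eqxx !orbT.
  have [[_ /sym[q [qr ->]]]|->] := conf x Ax xa.
    by rewrite exprMn qr mul1r !inE eqxx !orbT.
  by rewrite subrr rE expr0n /= !inE eqxx ?orbT.
exists [:: None; Some 0; Some ((a - beta) ^+ r)]; split => //.
  rewrite /= !inE /= andbT; apply/eqP => -[] /esym/eqP.
  by rewrite expf_eq0 subr_eq0 (negPf ab) andbF.
move=> y; split.
  case=> [[[x|] Ax ->]|/crit]; first exact: fibre.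
    by rewrite rE power_map_infty inE.
  by rewrite !inE => /orP[] ->; rewrite ?orbT.
rewrite !inE => /or3P[] /eqP->.
- by right; apply/crit; rewrite inE.
- by right; apply/crit; rewrite !inE eqxx orbT.
by left; exists (Some a) => //; rewrite power_mapE.
Qed.
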